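(* Let $(g,A)$ be a five-dimensional charged rotating black hole with two equal-magnitude angular momenta, as defined in the context, with angular momentum parameter $\hat J\ne0$ and charge parameter $\hat Q\neq0$. Then the Weyl tensor of $g$ in the exterior region (the bulk) is algebraically general: $g$ does not admit a multiple Weyl aligned null direction, i.e. there is no nowhere-vanishing null vector field $\ell$ on the exterior region satisfying $$\ell_{[\sigma}C_{\mu]\lambda[\nu\rho}\,\ell_{\tau]}\,\ell^\lambda=0 .$$
   Context: The black hole is described in coordinates $(t,R,\theta,\phi,\psi)$, $0<\theta<\pi/2$, by functions $f,m,N,\varpi,a_0,a_\phi$ of $R$ only, via $$ds^2=-f\,dt^2+\frac{m}{f}\Big(\frac{dR^2}{4N}+d\theta^2\Big)+\frac{N}{m}\Big[\sin^2\theta\,(d\phi-\varpi\,dt)^2+\cos^2\theta\,(d\psi-\varpi\,dt)^2\Big]+\frac{m^2-fN}{m f}\sin^2\theta\cos^2\theta\,(d\phi-d\psi)^2,$$ $$A=a_0\,dt+a_\phi(\sin^2\theta\,d\phi+\cos^2\theta\,d\psi).$$ A five-dimensional charged rotating black hole with two equal-magnitude angular momenta is a pair $(g,A)$ of this form on the exterior region $R>r_+^2$, where $f,m,N>0$, such that: (a) the Einstein--Maxwell equations hold: $\nabla^\mu F_{\mu\nu}=0$ with $F=dA$, and $R_{\mu\nu}-\frac12\mathcal R g_{\mu\nu}=2T_{\mu\nu}$ with $T_{\mu\nu}=F_{\mu\rho}F_\nu{}^\rho-\frac14g_{\mu\nu}F_{\rho\sigma}F^{\rho\sigma}$; in particular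 $N=(R-r_+^2)(R-r_-^2)$ with constants $r_+^2>r_-^2$, $r_+^2>0$; (b) (asymptotic flatness) as $R\to\infty$ the functions have asymptotic expansions (differentiable term by term) in integer powers of $R$ with $f=1-\hat M R^{-1}+O(R^{-2})$, $m=R+O(R^0)$, $a_\phi=O(R^{-1})$, $\varpi=\hat J R^{-2}+O(R^{-3})$, $a_0=\hat Q R^{-1}+O(R^{-2})$; (c) (horizon regularity) $f,m,\varpi,a_0,a_\phi$ extend smoothly in $R$ to a neighbourhood of $R=r_+^2$, with $f$ and $m$ having simple zeros there. The constants $\hat M,\hat J,\hat Q$ are proportional to the mass, angular momentum and electric charge. $C_{\mu\nu\rho\sigma}$ is the Weyl tensor. A multiple Weyl aligned null direction (multiple WAND) is a null direction $\ell$ such that, in a null frame containing $\ell$, all components of the Weyl tensor of boost weight $+2$ and $+1$ vanish; this is equivalent to the displayed (Bel--Debever) condition, i.e. to the Weyl tensor being of type II or more special. Square brackets denote antisymmetrization: over $\sigma,\mu$ in the first pair and over $\nu,\rho,\tau$ in the second group. *)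

(* Defs.v *)
(* Written over Stdlib's real numbers R, with Coquelicot's total derivatives. *)
From Stdlib Require Import Reals ZArith Lra ClassicalEpsilon.
From Coquelicot Require Import Coquelicot.

Open Scope R_scope.

(** * Tensor calculus in a chart with coordinates (t, R, theta, phi, psi) *)

Inductive coord : Set := Ct | CR | Cth | Cph | Cps.

Definition coord_eq_dec (i j : coord) : {i = j} + {i <> j}.
Proof. decide equality. Defined.

(* Both points of the chart and (components of) tangent vectors. *)
Definition point := coord -> R.
Definition vec := coord -> R.

Definition scalar_field := point -> R.
Definition vector_field := point -> vec.
Definition tensor1 := coord -> scalar_field.
Definition tensor2 := coord -> coord -> scalar_field.
Definition tensor3 := coord -> coord -> coord -> scalar_field.
Definition tensor4 := coord -> coord -> coord -> coord -> scalar_field.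

Definition sumc (F : coord -> R) : R :=
  F Ct + F CR + F Cth + F Cph + F Cps.

Definition delta (i j : coord) : R := if coord_eq_dec i j then 1 else 0.

Definition upd (p : point) (i : coord) (s : R) : point :=
  fun j => if coord_eq_dec i j then s else p j.

(* The partial derivative; [Derive] is total, so it is meaningful only for
   differentiable arguments. *)
Definition partial (i : coord) (F : scalar_field) : scalar_field :=
  fun p => Derive (fun s => F (upd p i s)) (p i).

Definition is_inverse (A B : coord -> coord -> R) : Prop :=
  forall i j, sumc (fun k => A i k * B k j) = delta i j.

(* The inverse matrix when there is one (see [metric_inverse] below for the
   metrics of interest), an arbitrary matrix otherwise. *)
Definition inverse (A : coord -> coord -> R) : coord -> coord -> R :=
  epsilon (inhabits (fun _ _ => 0)) (is_inverse A).

(* g^{ij} *)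
Definition ginv (g : tensor2) : tensor2 :=
  fun i j p => inverse (fun k l => g k l p) i j.

(* [christoffel g i j k] is Gamma^i_{jk}. *)
Definition christoffel (g : tensor2) : tensor3 := fun i j k p =>
  / 2 * sumc (fun l => ginv g i l p *
    (partial j (g l k) p + partial k (g l j) p - partial l (g j k) p)).

(* [riemann_up g i j k l] is
   R^i_{jkl} = d_k Gamma^i_{lj} - d_l Gamma^i_{kj}
               + Gamma^i_{km} Gamma^m_{lj} - Gamma^i_{lm} Gamma^m_{kj}. *)
Definition riemann_up (g : tensor2) : tensor4 := fun i j k l p =>
  partial k (christoffel g i l j) p - partial l (christoffel g i k j) p
  + sumc (fun m => christoffel g i k m p * christoffel g m l j p
                   - christoffel g i l m p * christoffel g m k j p).

Definition riemann (g : tensor2) : tensor4 := fun i j k l p =>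
  sumc (fun m => g i m p * riemann_up g m j k l p).

(* R_{jl} = R^i_{jil} *)
Definition ricci (g : tensor2) : tensor2 := fun j l p =>
  sumc (fun i => riemann_up g i j i l p).

Definition scalar_curvature (g : tensor2) : scalar_field := fun p =>
  sumc (fun i => sumc (fun j => ginv g i j p * ricci g i j p)).

(* In dimension n = 5 the coefficients 1 / (n - 2) and 1 / ((n - 1) (n - 2))
   of the Weyl tensor are 1 / 3 and 1 / 12. *)
Definition weyl (g : tensor2) : tensor4 := fun i j k l p =>
  riemann g i j k l p
  - / 3 * (g i k p * ricci g l j p - g i l p * ricci g k j p
           - g j k p * ricci g l i p + g j l p * ricci g k i p)
  + / 12 * scalar_curvature g p * (g i k p * g l j p - g i l p * g k j p).

(** * Einstein--Maxwell equations *)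

(* F = dA *)
Definition field_strength (A : tensor1) : tensor2 := fun i j p =>
  partial i (A j) p - partial j (A i) p.

(* [nabla2 g F k i j] is nabla_k F_{ij}. *)
Definition nabla2 (g F : tensor2) : tensor3 := fun k i j p =>
  partial k (F i j) p
  - sumc (fun l => christoffel g l k i p * F l j p)
  - sumc (fun l => christoffel g l k j p * F i l p).

(* nabla^i F_{ij} *)
Definition divergence2 (g F : tensor2) : tensor1 := fun j p =>
  sumc (fun k => sumc (fun i => ginv g k i p * nabla2 g F k i j p)).

(* T_{ij} = F_{ik} F_j^k - 1/4 g_{ij} F_{kl} F^{kl} *)
Definition stress_energy (g F : tensor2) : tensor2 := fun i j p =>
  sumc (fun k => sumc (fun l => F i k p * ginv g k l p * F j l p))
  - / 4 * g i j p *
    sumc (fun k => sumc (fun l => sumc (fun k' => sumc (fun l' =>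
      ginv g k k' p * ginv g l l' p * F k l p * F k' l' p)))).

Definition einstein_maxwell_at (g : tensor2) (A : tensor1) (p : point) : Prop :=
  let F := field_strength A in
  (forall j, divergence2 g F j p = 0) /\
  (forall i j, ricci g i j p - / 2 * scalar_curvature g p * g i j p
               = 2 * stress_energy g F i j p).

(** * Multiple Weyl aligned null directions *)

Definition lower (g : tensor2) (p : point) (v : vec) : vec :=
  fun i => sumc (fun j => g i j p * v j).

Definition is_null (g : tensor2) (p : point) (v : vec) : Prop :=
  sumc (fun i => sumc (fun j => g i j p * v i * v j)) = 0.

Definition antisym2 (T : coord -> coord -> R) : coord -> coord -> R :=
  fun a b => / 2 * (T a b - T b a).

Definition antisym3 (T : coord -> coord -> coord -> R) :
    coord -> coord -> coord -> R :=
  fun a b c => / 6 * (T a b c + T b c a + T c a b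
                      - T b a c - T a c b - T c b a).

(* l_{[s} C_{m]k[n r} l_{t]} l^k = 0 *)
Definition bel_debever (g : tensor2) (p : point) (v : vec) : Prop :=
  forall s m n r t : coord,
    antisym2 (fun s' m' =>
      antisym3 (fun n' r' t' =>
        sumc (fun k =>
          lower g p v s' * weyl g m' k n' r' p * lower g p v t' * v k))
      n r t) s m = 0.

Definition admits_multiple_WAND (g : tensor2) (D : point -> Prop) : Prop :=
  exists l : vector_field, forall p : point, D p ->
    (exists i, l p i <> 0) /\ is_null g p (l p) /\ bel_debever g p (l p).

(** * The metric and the potential *)

Record profile : Type := Profile {
  pf_f : R -> R;
  pf_m : R -> R;
  pf_N : R -> R;
  pf_varpi : R -> R;
  pf_a0 : R -> R;
  pf_aphi : R -> R
}.

(* The line element ds^2, polarized to a symmetric bilinear form. *)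
Definition line_element (b : profile) (p : point) (u v : vec) : R :=
  let f := pf_f b (p CR) in
  let m := pf_m b (p CR) in
  let N := pf_N b (p CR) in
  let w := pf_varpi b (p CR) in
  let th := p Cth in
  - f * (u Ct * v Ct)
  + m / f * (u CR * v CR / (4 * N) + u Cth * v Cth)
  + N / m * (sin th ^ 2 * ((u Cph - w * u Ct) * (v Cph - w * v Ct))
             + cos th ^ 2 * ((u Cps - w * u Ct) * (v Cps - w * v Ct)))
  + (m ^ 2 - f * N) / (m * f) * sin th ^ 2 * cos th ^ 2
    * ((u Cph - u Cps) * (v Cph - v Cps)).

Definition metric (b : profile) : tensor2 :=
  fun i j p => line_element b p (delta i) (delta j).

Definition potential_form (b : profile) (p : point) (v : vec) : R :=
  pf_a0 b (p CR) * v Ct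
  + pf_aphi b (p CR) * (sin (p Cth) ^ 2 * v Cph + cos (p Cth) ^ 2 * v Cps).

Definition potential (b : profile) : tensor1 :=
  fun i p => potential_form b p (delta i).

(* [rp2] stands for the constant r_+^2. *)
Definition exterior (rp2 : R) (p : point) : Prop :=
  rp2 < p CR /\ 0 < p Cth < PI / 2.

(** * Regularity, asymptotics and the horizon *)

(* Intended for open [D]. *)
Definition smooth_on (D : R -> Prop) (h : R -> R) : Prop :=
  forall (n : nat) (x : R), D x -> ex_derive_n h n x.

(* h(x) = O(x^k) as x -> +oo *)
Definition bigO_infty (h : R -> R) (k : Z) : Prop :=
  exists C : R, Rbar_locally p_infty (fun x => Rabs (h x) <= C * powerRZ x k).

(* The truncation c_0 x^p + c_1 x^(p-1) + ... + c_K x^(p-K). *)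
Definition truncation (p : Z) (c : nat -> R) (K : nat) (x : R) : R :=
  sum_f_R0 (fun n => c n * powerRZ x (p - Z.of_nat n)) K.

(* h has the asymptotic expansion sum_n c_n x^(p-n) as x -> +oo, which may be
   differentiated term by term any number [j] of times. *)
Definition expansion_infty (h : R -> R) (p : Z) (c : nat -> R) : Prop :=
  forall K j : nat,
    bigO_infty (Derive_n (fun x => h x - truncation p c K x) j)
               (p - Z.of_nat K - 1 - Z.of_nat j).

(* H is a smooth function near x0 which extends h from the right of x0. *)
Definition right_extension (h : R -> R) (x0 : R) (H : R -> R) : Prop :=
  exists eps : R, 0 < eps /\
    smooth_on (fun x => x0 - eps < x < x0 + eps) H /\
    forall x, x0 < x < x0 + eps -> H x = h x.

Definition extends_smoothly (h : R -> R) (x0 : R) : Prop :=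
  exists H, right_extension h x0 H.

Definition extends_with_simple_zero (h : R -> R) (x0 : R) : Prop :=
  exists H, right_extension h x0 H /\ H x0 = 0 /\ Derive H x0 <> 0.

(* [rp2] and [rm2] stand for r_+^2 and r_-^2; the latter may be negative. *)
Record charged_rotating_black_hole
    (b : profile) (rp2 rm2 M J Q : R) : Prop := {
  bh_rp2_pos : 0 < rp2;
  bh_rm2_lt : rm2 < rp2;
  bh_smooth_f : smooth_on (fun x => rp2 < x) (pf_f b);
  bh_smooth_m : smooth_on (fun x => rp2 < x) (pf_m b);
  bh_smooth_varpi : smooth_on (fun x => rp2 < x) (pf_varpi b);
  bh_smooth_a0 : smooth_on (fun x => rp2 < x) (pf_a0 b);
  bh_smooth_aphi : smooth_on (fun x => rp2 < x) (pf_aphi b);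
  bh_positive : forall x, rp2 < x ->
    0 < pf_f b x /\ 0 < pf_m b x /\ 0 < pf_N b x;
  bh_einstein_maxwell : forall p, exterior rp2 p ->
    einstein_maxwell_at (metric b) (potential b) p;
  bh_N : forall x, rp2 < x -> pf_N b x = (x - rp2) * (x - rm2);
  bh_asymp_f : exists c, expansion_infty (pf_f b) 0 c /\
    c 0%nat = 1 /\ c 1%nat = - M;
  bh_asymp_m : exists c, expansion_infty (pf_m b) 1 c /\ c 0%nat = 1;
  bh_asymp_aphi : exists c, expansion_infty (pf_aphi b) (-1) c;
  bh_asymp_varpi : exists c, expansion_infty (pf_varpi b) (-2) c /\
    c 0%nat = J;
  bh_asymp_a0 : exists c, expansion_infty (pf_a0 b) (-1) c /\ c 0%nat = Q;
  bh_horizon_f : extends_with_simple_zero (pf_f b) rp2;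
  bh_horizon_m : extends_with_simple_zero (pf_m b) rp2;
  bh_horizon_varpi : extends_smoothly (pf_varpi b) rp2;
  bh_horizon_a0 : extends_smoothly (pf_a0 b) rp2;
  bh_horizon_aphi : extends_smoothly (pf_aphi b) rp2
}.

(** * The inverse metric exists *)

Lemma inverseP (A B : coord -> coord -> R) :
  is_inverse A B -> is_inverse A (inverse A).
Proof. intros H. unfold inverse. apply epsilon_spec. exists B. exact H. Qed.

(* g^{-1} = - (d_t + w (d_phi + d_psi))^2 / f + 4 f N / m d_R^2 + f / m d_th^2
     + m / N (d_phi + d_psi)^2
     + f / (m sin^2 cos^2) (cos^2 d_phi - sin^2 d_psi)^2 *)
Definition explicit_inverse (b : profile) (p : point) (i j : coord) : R :=
  let f := pf_f b (p CR) in
  let m := pf_m b (p CR) in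
  let N := pf_N b (p CR) in
  let w := pf_varpi b (p CR) in
  let s := sin (p Cth) in
  let c := cos (p Cth) in
  let T k := delta Ct k + w * (delta Cph k + delta Cps k) in
  let S k := delta Cph k + delta Cps k in
  let U k := c ^ 2 * delta Cph k - s ^ 2 * delta Cps k in
  - / f * (T i * T j) + 4 * f * N / m * (delta CR i * delta CR j)
  + f / m * (delta Cth i * delta Cth j) + m / N * (S i * S j)
  + f / (m * s ^ 2 * c ^ 2) * (U i * U j).

Lemma metric_inverse (b : profile) (rp2 : R) (p : point) :
  exterior rp2 p ->
  0 < pf_f b (p CR) -> 0 < pf_m b (p CR) -> 0 < pf_N b (p CR) ->
  is_inverse (fun i j => metric b i j p) (explicit_inverse b p).
Proof.
  intros [_ [th0 th1]] Hf Hm HN.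
  assert (Hs : 0 < sin (p Cth)) by (apply sin_gt_0; lra).
  assert (Hc : 0 < cos (p Cth)) by (apply cos_gt_0; lra).
  assert (E : cos (p Cth) ^ 2 = 1 - sin (p Cth) ^ 2).
  { generalize (sin2_cos2 (p Cth)). unfold Rsqr. simpl. lra. }
  assert (E' : 1 - sin (p Cth) ^ 2 <> 0).
  { rewrite <- E. apply pow_nonzero. lra. }
  intros i j; unfold metric, line_element, explicit_inverse, sumc.
  cbv zeta. rewrite E.
  generalize dependent (pf_f b (p CR)). generalize dependent (pf_m b (p CR)).
  generalize dependent (pf_N b (p CR)). generalize (pf_varpi b (p CR)).
  generalize dependent (sin (p Cth)).
  intros s Hs E E' w N HN m Hm f Hf.
  destruct i, j; unfold delta; cbn [coord_eq_dec coord_rect coord_rec];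
    simpl; field; repeat split; simpl in E'; lra.
Qed.

(* Main.v *)
Require Import Defs.
From Stdlib Require Import Reals ZArith Lra Lia FunctionalExtensionality.
From Coquelicot Require Import Coquelicot.

Open Scope R_scope.

(* In the frame adapted to the U(2) symmetry everything depends on R only, and the
   Weyl tensor is invariant under rotations of the (theta, U)-plane, where
   U = cos^2 d_phi - sin^2 d_psi.  Its components X = C_0123 and Y = C_1423, which do
   not see the Ricci tensor, force a multiple WAND into the span of d_t, d_R and
   d_phi + d_psi when X <> 0; moreover Y^2 < X^2 for large R, since J <> 0, and then
   eliminating the direction leaves two scalar equations, from which the Einstein
   equations remove all second derivatives.  Expand them in 1/R, with
   aphi = p/R + ... and N (log (N f / m^2))' = h/R + ...: the leading order gives
   M h = - 2 J^2, hence h <> 0, and the next one gives first p = 0 and then Q^2 h = 0.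
   Neither the Maxwell equations nor the horizon is needed: the contradiction comes
   from infinity. *)


(** * Sums over the coordinates and partial derivatives *)

(** The obstacle is to compute the curvature at all: [ginv] is selected by [epsilon], and
    [riemann_up] differentiates it. Cartan's equations avoid this: a connection is guessed in a
    frame and checked in lowered form. The frame stays unnormalized, so that every entry is rational
    in [f], [A], [B], [w], their derivatives, sin and cos, and [field] can decide the identities;
    square roots enter only in the passage to orthonormal components. Geometrically, the 3-spheres
    of constant t and R are Hopf-fibred, with scales A = N / m on the fibre and B = m / f on the
    base. X is proportional to w' and Y to (log (A / B))', and a multiple WAND must satisfy l4 / l0
    = Y / X in orthonormal components; inserting this ratio is what eliminates the direction. Two
    orders in 1/R suffice because the reduced Einstein equations tie the subleading coefficients to
    M, J, Q, p and h so tightly that everything cancels in the second order except a multiple of Q p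
    h in one equation and, once p = 0, of Q^2 h in the other. *)

Lemma sumc_ext (F G : coord -> R) : (forall i, F i = G i) -> sumc F = sumc G.
Proof. intros H; unfold sumc; rewrite !H; reflexivity. Qed.

Lemma sumc_plus (F G : coord -> R) :
  sumc (fun i => F i + G i) = sumc F + sumc G.
Proof. unfold sumc; ring. Qed.

Lemma sumc_minus (F G : coord -> R) :
  sumc (fun i => F i - G i) = sumc F - sumc G.
Proof. unfold sumc; ring. Qed.

Lemma sumc_mult_l (a : R) (F : coord -> R) :
  a * sumc F = sumc (fun i => a * F i).
Proof. unfold sumc; ring. Qed.

Lemma sumc_mult_r (a : R) (F : coord -> R) :
  sumc F * a = sumc (fun i => F i * a).
Proof. unfold sumc; ring. Qed.

Lemma sumc_swap (F : coord -> coord -> R) :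
  sumc (fun i => sumc (fun j => F i j)) = sumc (fun j => sumc (fun i => F i j)).
Proof. unfold sumc; ring. Qed.

Lemma sumc_zero (F : coord -> R) : (forall i, F i = 0) -> sumc F = 0.
Proof. intros H; unfold sumc; rewrite !H; ring. Qed.

Lemma sumc_delta_l (a : coord) (F : coord -> R) :
  sumc (fun i => delta a i * F i) = F a.
Proof. destruct a; unfold sumc, delta; simpl; ring. Qed.

Lemma sumc_delta_r (a : coord) (F : coord -> R) :
  sumc (fun i => F i * delta i a) = F a.
Proof. destruct a; unfold sumc, delta; simpl; ring. Qed.

Lemma upd_self (p : point) (k : coord) : upd p k (p k) = p.
Proof.
  apply functional_extensionality; intros j; unfold upd.
  destruct (coord_eq_dec k j); subst; reflexivity.
Qed.

(** [partial] is total, so the existence of the derivative has to be carried by a relation. *)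
Definition is_partial (k : coord) (F : scalar_field) (p : point) (v : R) : Prop :=
  is_derive (fun s => F (upd p k s)) (p k) v.

Lemma is_partial_unique k F p v : is_partial k F p v -> partial k F p = v.
Proof. apply is_derive_unique. Qed.

Lemma is_partial_plus k F G p u v :
  is_partial k F p u -> is_partial k G p v ->
  is_partial k (fun q => F q + G q) p (u + v).
Proof.
  intros HF HG.
  exact (is_derive_plus (V := R_NormedModule) _ _ _ _ _ HF HG).
Qed.

Lemma is_partial_minus k F G p u v :
  is_partial k F p u -> is_partial k G p v ->
  is_partial k (fun q => F q - G q) p (u - v).
Proof.
  intros HF HG.
  exact (is_derive_minus (V := R_NormedModule) _ _ _ _ _ HF HG).
Qed.

Lemma is_partial_mult k F G p u v :
  is_partial k F p u -> is_partial k G p v ->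
  is_partial k (fun q => F q * G q) p (u * G p + F p * v).
Proof.
  intros HF HG; unfold is_partial.
  pose proof (is_derive_mult _ _ _ _ _ HF HG Rmult_comm) as H.
  unfold plus, mult in H; simpl in H; rewrite !upd_self in H; exact H.
Qed.

Lemma is_partial_sumc k (F : coord -> scalar_field) p (v : coord -> R) :
  (forall i, is_partial k (F i) p (v i)) ->
  is_partial k (fun q => sumc (fun i => F i q)) p (sumc v).
Proof.
  intros H; unfold sumc.
  repeat apply is_partial_plus; apply H.
Qed.

(** Openness along coordinate lines only: this is all that a partial derivative can see. *)
Definition open_domain (D : point -> Prop) : Prop :=
  forall p k, D p -> locally (p k) (fun s => D (upd p k s)).

Lemma is_partial_ext (D : point -> Prop) k F G p v :
  open_domain D -> D p -> (forall q, D q -> F q = G q) ->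
  is_partial k F p v -> is_partial k G p v.
Proof.
  intros HD Hp HFG H; unfold is_partial.
  refine (is_derive_ext_loc _ _ _ _ _ H).
  apply filter_imp with (2 := HD p k Hp); intros s Hs; apply HFG, Hs.
Qed.

Lemma partial_ext (D : point -> Prop) k F G p :
  open_domain D -> D p -> (forall q, D q -> F q = G q) ->
  partial k F p = partial k G p.
Proof.
  intros HD Hp HFG; apply Derive_ext_loc.
  apply filter_imp with (2 := HD p k Hp); intros s Hs; apply HFG, Hs.
Qed.

Definition differentiable_on (D : point -> Prop) (F : scalar_field) : Prop :=
  forall p k, D p -> is_partial k F p (partial k F p).

Lemma differentiable_on_intro (D : point -> Prop) (F : scalar_field) :
  (forall p k, D p -> exists v, is_partial k F p v) -> differentiable_on D F.
Proof.
  intros H p k Hp; destruct (H p k Hp) as [v Hv].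
  rewrite (is_partial_unique _ _ _ _ Hv); exact Hv.
Qed.

Lemma differentiable_on_ext (D : point -> Prop) F G :
  open_domain D -> (forall q, D q -> F q = G q) ->
  differentiable_on D F -> differentiable_on D G.
Proof.
  intros HD HFG HF; apply differentiable_on_intro; intros p k Hp.
  exists (partial k F p); exact (is_partial_ext D k F G p _ HD Hp HFG (HF p k Hp)).
Qed.

Lemma differentiable_on_minus D F G :
  differentiable_on D F -> differentiable_on D G ->
  differentiable_on D (fun q => F q - G q).
Proof.
  intros HF HG; apply differentiable_on_intro; intros p k Hp; eexists.
  apply is_partial_minus; [apply HF | apply HG]; exact Hp.
Qed.

Lemma differentiable_on_mult D F G :
  differentiable_on D F -> differentiable_on D G ->
  differentiable_on D (fun q => F q * G q).
Proof.
  intros HF HG; apply differentiable_on_intro; intros p k Hp; eexists.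
  apply is_partial_mult; [apply HF | apply HG]; exact Hp.
Qed.

Lemma differentiable_on_sumc D (F : coord -> scalar_field) :
  (forall i, differentiable_on D (F i)) ->
  differentiable_on D (fun q => sumc (fun i => F i q)).
Proof.
  intros HF; apply differentiable_on_intro; intros p k Hp.
  exists (sumc (fun i => partial k (F i) p)).
  apply is_partial_sumc; intros i; apply HF, Hp.
Qed.

(** * Cartan's structure equations *)

Section Cartan.

Context (D : point -> Prop) (g : tensor2).
Context (E Th : tensor2) (eta : tensor1) (om : tensor3).
Context (D_open : open_domain D).

Definition connection_form : tensor3 := fun i c d p =>
  sumc (fun a => Th a i p * om a c d p).

Definition dcoframe (h c d : coord) (p : point) : R :=
  sumc (fun k => sumc (fun l =>
    E c k p * E d l p * (partial k (Th h l) p - partial l (Th h k) p))).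

Definition along (a : coord) (F : scalar_field) (p : point) : R :=
  sumc (fun k => E a k p * partial k F p).

(* [eta a * curvature a b c d] is g (e_a, R (e_c, e_d) e_b); the last sum comes from
   the commutators, as de^h (e_c, e_d) = - e^h ([e_c, e_d]). *)
Definition curvature (a b c d : coord) (p : point) : R :=
  along c (om d b a) p - along d (om c b a) p
  + sumc (fun e => om d b e p * om c e a p - om c b e p * om d e a p)
  + sumc (fun h => dcoframe h c d p * om h b a p).

Context (g_frame : forall p i j, D p ->
  g i j p = sumc (fun a => eta a p * Th a i p * Th a j p)).
Context (eta_neq_0 : forall p a, D p -> eta a p <> 0).
Context (Th_E : forall p a b, D p ->
  sumc (fun i => Th a i p * E b i p) = delta a b).
Context (E_Th : forall p i j, D p ->
  sumc (fun a => E a i p * Th a j p) = delta i j).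
Context (g_inverse : forall p, D p -> is_inverse (fun i j => g i j p)
                                       (fun i j => ginv g i j p)).

Lemma lower_frame p a i : D p ->
  sumc (fun j => g i j p * E a j p) = eta a p * Th a i p.
Proof.
  intros Hp.
  rewrite (sumc_ext _ (fun j => sumc (fun b =>
    eta b p * Th b i p * (Th b j p * E a j p)))).
  2:{ intros j; rewrite (g_frame p i j Hp), sumc_mult_r.
      apply sumc_ext; intros b; ring. }
  rewrite sumc_swap, (sumc_ext _ (fun b => eta b p * Th b i p * delta b a)).
  2:{ intros b; rewrite <- sumc_mult_l, Th_E by exact Hp; reflexivity. }
  apply (sumc_delta_r a (fun b => eta b p * Th b i p)).
Qed.

(** In the frame the metric is diagonal with nonzero entries [eta]. This lets an identity be checked
    after lowering an index, where the inverse metric has disappeared. *)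
Lemma metric_nondegenerate p (V : vec) : D p ->
  (forall n, sumc (fun m => g n m p * V m) = 0) -> forall m, V m = 0.
Proof.
  intros Hp H m.
  assert (HV : forall a, sumc (fun j => Th a j p * V j) = 0).
  { intros a. apply (Rmult_eq_reg_l (eta a p)); [|apply eta_neq_0; exact Hp].
    rewrite Rmult_0_r, sumc_mult_l.
    rewrite <- (sumc_zero (fun i => E a i p * sumc (fun j => g i j p * V j))).
    2:{ intros i; rewrite H; ring. }
    rewrite (sumc_ext (fun i => E a i p * _) (fun i => sumc (fun j =>
       g i j p * E a i p * V j))).
    2:{ intros i; rewrite sumc_mult_l; apply sumc_ext; intros j; ring. }
    rewrite sumc_swap; apply sumc_ext; intros j.
    rewrite <- (sumc_mult_r (V j)), <- Rmult_assoc; f_equal.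
    rewrite <- (lower_frame p a j Hp); apply sumc_ext; intros i.
    rewrite !(g_frame p) by exact Hp; f_equal.
    apply sumc_ext; intros b; ring. }
  rewrite <- (sumc_delta_l m V).
  rewrite (sumc_ext _ (fun j => sumc (fun a => E a m p * (Th a j p * V j)))).
  2:{ intros j; rewrite <- (E_Th p m j Hp), sumc_mult_r.
      apply sumc_ext; intros a; ring. }
  rewrite sumc_swap; apply sumc_zero; intros a.
  rewrite <- sumc_mult_l, HV; ring.
Qed.

Lemma ginv_frame p i j : D p ->
  ginv g i j p = sumc (fun a => / eta a p * E a i p * E a j p).
Proof.
  intros Hp.
  cut (ginv g i j p - sumc (fun a => / eta a p * E a i p * E a j p) = 0); [lra|].
  apply (metric_nondegenerate p (fun i =>
    ginv g i j p - sumc (fun a => / eta a p * E a i p * E a j p)) Hp).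
  intros n.
  rewrite (sumc_ext _ (fun m => g n m p * ginv g m j p
     - sumc (fun a => / eta a p * E a j p * (g n m p * E a m p)))).
  2:{ intros m; rewrite Rmult_minus_distr_l; f_equal.
      rewrite sumc_mult_l; apply sumc_ext; intros a; ring. }
  rewrite sumc_minus, (g_inverse p Hp n j), sumc_swap.
  rewrite (sumc_ext _ (fun a => E a j p * Th a n p)).
  { rewrite (E_Th p j n Hp).
    unfold delta; destruct (coord_eq_dec n j), (coord_eq_dec j n);
      try lra; subst; contradiction. }
  intros a; rewrite <- sumc_mult_l, (lower_frame p a n Hp).
  field; apply eta_neq_0; exact Hp.
Qed.

Lemma lower_christoffel p n i j : D p ->
  sumc (fun m => g n m p * christoffel g m i j p)
  = / 2 * (partial i (g n j) p + partial j (g n i) p - partial n (g i j) p).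
Proof.
  intros Hp; unfold christoffel.
  rewrite (sumc_ext _ (fun m => sumc (fun l => / 2 * (g n m p * ginv g m l p) *
    (partial i (g l j) p + partial j (g l i) p - partial l (g i j) p)))).
  2:{ intros m; rewrite <- !Rmult_assoc, sumc_mult_l.
      apply sumc_ext; intros l; ring. }
  rewrite sumc_swap, (sumc_ext _ (fun l => / 2 * (delta n l *
    (partial i (g l j) p + partial j (g l i) p - partial l (g i j) p)))).
  2:{ intros l; rewrite <- (g_inverse p Hp n l), <- Rmult_assoc.
      rewrite sumc_mult_l, sumc_mult_r; reflexivity. }
  rewrite <- sumc_mult_l, sumc_delta_l; reflexivity.
Qed.

(* The connection is characterized by its lowered form, which does not involve
   the inverse metric. *)
Context (om_lowered : forall p i c n, D p ->
  sumc (fun m => g n m p * partial i (E c m) p)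
  + / 2 * sumc (fun j => (partial i (g n j) p + partial j (g n i) p
                          - partial n (g i j) p) * E c j p)
  = sumc (fun d => connection_form i c d p * (eta d p * Th d n p))).

(** The equation nabla_i e_c = sum_d ([connection_form] i c d) e_d, solved for the coordinate
    derivative of e_c. Lowered by g it is exactly [om_lowered], and nondegeneracy raises the index
    again. *)
Lemma partial_frame p i c m : D p ->
  partial i (E c m) p
  = sumc (fun d => connection_form i c d p * E d m p)
    - sumc (fun j => christoffel g m i j p * E c j p).
Proof.
  intros Hp.
  cut (partial i (E c m) p + sumc (fun j => christoffel g m i j p * E c j p)
    - sumc (fun d => connection_form i c d p * E d m p) = 0); [lra|].
  apply (metric_nondegenerate p (fun m =>
    partial i (E c m) p + sumc (fun j => christoffel g m i j p * E c j p)
    - sumc (fun d => connection_form i c d p * E d m p)) Hp).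
  intros n.
  rewrite (sumc_ext _ (fun m => g n m p * partial i (E c m) p
    + sumc (fun j => g n m p * christoffel g m i j p * E c j p)
    - sumc (fun d => connection_form i c d p * (g n m p * E d m p)))).
  2:{ intros m'; rewrite Rmult_minus_distr_l, Rmult_plus_distr_l.
      rewrite !sumc_mult_l; f_equal; [f_equal|]; apply sumc_ext; intros; ring. }
  rewrite sumc_minus, sumc_plus, (sumc_swap (fun m' j => g n m' p * _ * _)).
  rewrite (sumc_swap (fun m' d => connection_form i c d p * _)).
  rewrite (sumc_ext (fun d => sumc (fun m' => connection_form i c d p * _))
    (fun d => connection_form i c d p * (eta d p * Th d n p))).
  2:{ intros d; rewrite <- sumc_mult_l, lower_frame by exact Hp; reflexivity. }
  rewrite <- (om_lowered p i c n Hp), sumc_mult_l.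
  rewrite (sumc_ext (fun j => sumc _) (fun j => / 2 *
    ((partial i (g n j) p + partial j (g n i) p - partial n (g i j) p) * E c j p))).
  { ring. }
  intros j; rewrite <- sumc_mult_r, (lower_christoffel p n i j Hp); ring.
Qed.

Context (E_diff : forall c m, differentiable_on D (E c m)).
Context (dE_diff : forall i c m, differentiable_on D (partial i (E c m))).
Context (Th_diff : forall c m, differentiable_on D (Th c m)).
Context (om_diff : forall a c d, differentiable_on D (om a c d)).
Context (E_schwarz : forall p k l c m, D p ->
  partial k (partial l (E c m)) p = partial l (partial k (E c m)) p).

Lemma connection_form_diff i c d : differentiable_on D (connection_form i c d).
Proof.
  apply differentiable_on_sumc; intros a.
  apply differentiable_on_mult; [apply Th_diff | apply om_diff].
Qed.

(** The definition contains the inverse chosen by [epsilon], which offers nothing to differentiate.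
    But [partial_frame], contracted with the coframe, expresses the Christoffel symbols through
    differentiable frame data on the open set D. *)
Lemma christoffel_diff m i j : differentiable_on D (christoffel g m i j).
Proof.
  apply (differentiable_on_ext D (fun q => sumc (fun c =>
    (sumc (fun d => connection_form i c d q * E d m q) - partial i (E c m) q)
    * Th c j q)) _ D_open).
  - intros q Hq.
    rewrite (sumc_ext _ (fun c => sumc (fun n =>
      christoffel g m i n q * (E c n q * Th c j q)))).
    2:{ intros c; rewrite (partial_frame q i c m Hq).
        match goal with |- (?x - (?x - ?y)) * _ = _ =>
          replace (x - (x - y)) with y by ring end.
        rewrite sumc_mult_r; apply sumc_ext; intros n; ring. }
    rewrite sumc_swap, (sumc_ext _ (fun n => christoffel g m i n q * delta n j)).
    2:{ intros n; rewrite <- sumc_mult_l, E_Th by exact Hq; reflexivity. }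
    apply (sumc_delta_r j (fun n => christoffel g m i n q)).
  - apply differentiable_on_sumc; intros c.
    apply differentiable_on_mult; [|apply Th_diff].
    apply differentiable_on_minus; [|apply dE_diff].
    apply differentiable_on_sumc; intros d.
    apply differentiable_on_mult; [apply connection_form_diff | apply E_diff].
Qed.

Lemma partial2_frame p k l c m : D p ->
  partial k (partial l (E c m)) p
  = sumc (fun d => partial k (connection_form l c d) p * E d m p
                   + connection_form l c d p * partial k (E d m) p)
    - sumc (fun j => partial k (christoffel g m l j) p * E c j p
                     + christoffel g m l j p * partial k (E c j) p).
Proof.
  intros Hp; apply is_partial_unique.
  apply (is_partial_ext D k (fun q =>
    sumc (fun d => connection_form l c d q * E d m q)
    - sumc (fun j => christoffel g m l j q * E c j q)) _ p _ D_open Hp).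
  { intros q Hq; symmetry; apply partial_frame, Hq. }
  apply is_partial_minus; apply is_partial_sumc; intros d; apply is_partial_mult.
  - apply connection_form_diff, Hp.
  - apply E_diff, Hp.
  - apply christoffel_diff, Hp.
  - apply E_diff, Hp.
Qed.

Definition curvature_form (c d k l : coord) (p : point) : R :=
  partial k (connection_form l c d) p - partial l (connection_form k c d) p
  + sumc (fun e => connection_form l c e p * connection_form k e d p
                   - connection_form k c e p * connection_form l e d p).

(** Both sides are the vector R(d_k, d_l) e_c, once through Christoffel symbols and once through the
    connection forms. They agree because mixed partial derivatives of e_c commute; after expanding
    these with [partial2_frame], the mixed products of the two connections cancel in pairs. *)
Lemma riemann_up_frame p m c k l : D p ->
  sumc (fun j => riemann_up g m j k l p * E c j p)
  = sumc (fun d => curvature_form c d k l p * E d m p).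
Proof.
  intros Hp.
  pose proof (E_schwarz p k l c m Hp) as H.
  rewrite !partial2_frame in H by exact Hp.
  rewrite !sumc_plus in H.
  assert (HL : forall k l, sumc (fun d => connection_form l c d p * partial k (E d m) p)
    = sumc (fun d => sumc (fun e => connection_form l c e p * connection_form k e d p) * E d m p)
      - sumc (fun j => sumc (fun d => connection_form l c d p * E d j p) * christoffel g m k j p)).
  { intros k' l'.
    rewrite (sumc_ext (fun d => connection_form l' c d p * partial k' (E d m) p)
      (fun d => sumc (fun e => connection_form l' c d p * connection_form k' d e p * E e m p)
        - sumc (fun j => connection_form l' c d p * E d j p * christoffel g m k' j p))).
    2:{ intros d; rewrite partial_frame by exact Hp.
        rewrite Rmult_minus_distr_l, !sumc_mult_l; f_equal; apply sumc_ext; intros; ring. }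
    rewrite sumc_minus; f_equal; rewrite sumc_swap; apply sumc_ext; intros e;
      rewrite <- sumc_mult_r; reflexivity. }
  assert (HR : forall k l, sumc (fun j => christoffel g m l j p * partial k (E c j) p)
    = sumc (fun j => sumc (fun d => connection_form k c d p * E d j p) * christoffel g m l j p)
      - sumc (fun j => sumc (fun e => christoffel g m l e p * christoffel g e k j p) * E c j p)).
  { intros k' l'.
    rewrite (sumc_ext (fun j => christoffel g m l' j p * partial k' (E c j) p)
      (fun j => sumc (fun d => connection_form k' c d p * E d j p) * christoffel g m l' j p
        - sumc (fun e => christoffel g m l' j p * christoffel g j k' e p * E c e p))).
    2:{ intros d; rewrite partial_frame by exact Hp.
        rewrite Rmult_minus_distr_l, !sumc_mult_l, sumc_mult_r.
        f_equal; apply sumc_ext; intros; ring. }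
    rewrite sumc_minus; f_equal; rewrite sumc_swap; apply sumc_ext; intros e;
      rewrite <- sumc_mult_r; reflexivity. }
  rewrite !HL, !HR in H.
  unfold riemann_up, curvature_form.
  rewrite (sumc_ext _ (fun j => partial k (christoffel g m l j) p * E c j p
    - partial l (christoffel g m k j) p * E c j p
    + (sumc (fun e => christoffel g m k e p * christoffel g e l j p) * E c j p
       - sumc (fun e => christoffel g m l e p * christoffel g e k j p) * E c j p))).
  2:{ intros j; rewrite sumc_minus; ring. }
  rewrite (sumc_ext (fun d => (_ - _ + _) * _) (fun d => partial k (connection_form l c d) p * E d m p
    - partial l (connection_form k c d) p * E d m p
    + (sumc (fun e => connection_form l c e p * connection_form k e d p) * E d m p
       - sumc (fun e => connection_form k c e p * connection_form l e d p) * E d m p))).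
  2:{ intros j; rewrite sumc_minus; ring. }
  rewrite !sumc_plus, !sumc_minus.
  lra.
Qed.

(** * Frame components of tensors *)

Definition comp1 (p : point) (X : coord -> R) (a : coord) : R :=
  sumc (fun i => E a i p * X i).

Definition comp2 (p : point) (T : coord -> coord -> R) (a b : coord) : R :=
  comp1 p (fun i => comp1 p (T i) b) a.

Definition comp4 (p : point) (T : coord -> coord -> coord -> coord -> R)
    (a b c d : coord) : R :=
  comp2 p (fun i j => comp2 p (T i j) c d) a b.

Lemma comp1_ext p X Y a : (forall i, X i = Y i) -> comp1 p X a = comp1 p Y a.
Proof. intros H; apply sumc_ext; intros i; rewrite H; reflexivity. Qed.

Lemma comp1_plus p X Y a :
  comp1 p (fun i => X i + Y i) a = comp1 p X a + comp1 p Y a.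
Proof. unfold comp1, sumc; ring. Qed.

Lemma comp1_minus p X Y a :
  comp1 p (fun i => X i - Y i) a = comp1 p X a - comp1 p Y a.
Proof. unfold comp1, sumc; ring. Qed.

Lemma comp1_mult_l p X r a : comp1 p (fun i => r * X i) a = r * comp1 p X a.
Proof. unfold comp1, sumc; ring. Qed.

Lemma comp1_mult_r p X r a : comp1 p (fun i => X i * r) a = comp1 p X a * r.
Proof. unfold comp1, sumc; ring. Qed.

Lemma comp1_sumc p (X : coord -> coord -> R) a :
  comp1 p (fun i => sumc (X i)) a = sumc (fun e => comp1 p (fun i => X i e) a).
Proof. unfold comp1, sumc; ring. Qed.

Lemma comp1_comp1 p (T : coord -> coord -> R) a b :
  comp1 p (fun i => comp1 p (fun j => T i j) b) a
  = comp1 p (fun j => comp1 p (fun i => T i j) a) b.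
Proof. unfold comp1, sumc; ring. Qed.

Lemma comp2_ext p S T a b : (forall i j, S i j = T i j) -> comp2 p S a b = comp2 p T a b.
Proof. intros H; apply comp1_ext; intros i; apply comp1_ext, H. Qed.

Lemma comp2_plus p S T a b :
  comp2 p (fun i j => S i j + T i j) a b = comp2 p S a b + comp2 p T a b.
Proof.
  unfold comp2; rewrite <- comp1_plus; apply comp1_ext; intros i; apply comp1_plus.
Qed.

Lemma comp2_minus p S T a b :
  comp2 p (fun i j => S i j - T i j) a b = comp2 p S a b - comp2 p T a b.
Proof.
  unfold comp2; rewrite <- comp1_minus; apply comp1_ext; intros i; apply comp1_minus.
Qed.

Lemma comp2_scal p r T a b :
  comp2 p (fun i j => r * T i j) a b = r * comp2 p T a b.
Proof.
  unfold comp2; rewrite <- comp1_mult_l; apply comp1_ext; intros i; apply comp1_mult_l.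
Qed.

Lemma comp2_prod p X Y a b :
  comp2 p (fun i j => X i * Y j) a b = comp1 p X a * comp1 p Y b.
Proof.
  unfold comp2; rewrite <- comp1_mult_r; apply comp1_ext; intros i; apply comp1_mult_l.
Qed.

Lemma comp2_sumc p (T : coord -> coord -> coord -> R) a b :
  comp2 p (fun i j => sumc (T i j)) a b
  = sumc (fun e => comp2 p (fun i j => T i j e) a b).
Proof.
  unfold comp2; rewrite <- comp1_sumc; apply comp1_ext; intros i; apply comp1_sumc.
Qed.

Lemma comp2_swap p T a b : comp2 p (fun i j => T j i) a b = comp2 p T b a.
Proof. apply (comp1_comp1 p (fun i j => T j i)). Qed.

Lemma comp1_coframe p h a : D p -> comp1 p (fun i => Th h i p) a = delta h a.
Proof.
  intros Hp; rewrite <- (Th_E p h a Hp); apply sumc_ext; intros; ring.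
Qed.

Lemma comp2_metric p a b : D p ->
  comp2 p (fun i j => g i j p) a b = eta a p * delta a b.
Proof.
  intros Hp; unfold comp2.
  rewrite (comp1_ext p _ (fun i => eta b p * Th b i p)).
  2:{ intros i; rewrite <- lower_frame by exact Hp; apply sumc_ext; intros; ring. }
  rewrite comp1_mult_l, comp1_coframe by exact Hp.
  unfold delta; destruct (coord_eq_dec b a), (coord_eq_dec a b); subst;
    try contradiction; ring.
Qed.

Lemma ginv_contract p X Y : D p ->
  sumc (fun k => sumc (fun l => X k * ginv g k l p * Y l))
  = sumc (fun a => / eta a p * comp1 p X a * comp1 p Y a).
Proof.
  intros Hp.
  rewrite (sumc_ext (fun k => sumc _) (fun k => sumc (fun a => sumc (fun l =>
    / eta a p * (E a k p * X k) * (E a l p * Y l))))).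
  2:{ intros k; rewrite sumc_swap; apply sumc_ext; intros l.
      rewrite ginv_frame, sumc_mult_l, sumc_mult_r by exact Hp.
      apply sumc_ext; intros; ring. }
  rewrite sumc_swap; apply sumc_ext; intros a.
  unfold comp1, sumc; ring.
Qed.

Lemma comp1_connection_form p b e d : D p ->
  comp1 p (fun l => connection_form l b e p) d = om d b e p.
Proof.
  intros Hp; unfold connection_form; rewrite comp1_sumc.
  rewrite (sumc_ext _ (fun a => om a b e p * delta a d)).
  { apply (sumc_delta_r d (fun a => om a b e p)). }
  intros a; rewrite comp1_mult_r, comp1_coframe by exact Hp; ring.
Qed.

(** The product rule for the form sum_h e^h [om h b e]. Antisymmetrized in c and d, its first term
    becomes the [dcoframe] term of [curvature]. *)
Lemma comp2_partial_connection_form p b e c d : D p ->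
  comp2 p (fun k l => partial k (connection_form l b e) p) c d
  = sumc (fun h => comp2 p (fun k l => partial k (Th h l) p) c d * om h b e p)
    + along c (om d b e) p.
Proof.
  intros Hp.
  rewrite (comp2_ext p _ (fun k l =>
    sumc (fun h => partial k (Th h l) p * om h b e p)
    + sumc (fun h => Th h l p * partial k (om h b e) p))).
  2:{ intros k l; rewrite <- sumc_plus; apply is_partial_unique, is_partial_sumc.
      intros h; apply is_partial_mult; [apply Th_diff | apply om_diff]; exact Hp. }
  rewrite comp2_plus, !comp2_sumc; f_equal.
  - apply sumc_ext; intros h; unfold comp2.
    rewrite <- comp1_mult_r; apply comp1_ext; intros i; apply comp1_mult_r.
  - rewrite (sumc_ext _ (fun h => delta d h * along c (om h b e) p)).
    { apply (sumc_delta_l d (fun h => along c (om h b e) p)). }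
    intros h; rewrite (comp2_ext p _ (fun k l => partial k (om h b e) p * Th h l p))
      by (intros; ring).
    rewrite comp2_prod, comp1_coframe by exact Hp.
    unfold delta; destruct (coord_eq_dec h d), (coord_eq_dec d h); subst;
      try contradiction; unfold along, comp1; ring.
Qed.

Lemma comp2_curvature_form p b a c d : D p ->
  comp2 p (fun k l => curvature_form b a k l p) c d = curvature a b c d p.
Proof.
  intros Hp; unfold curvature_form.
  rewrite comp2_plus, comp2_minus.
  rewrite (comp2_swap p (fun k l => partial k (connection_form l b a) p)).
  rewrite !comp2_partial_connection_form, comp2_sumc by exact Hp.
  rewrite (sumc_ext (fun e => comp2 p _ c d) (fun e =>
    om d b e p * om c e a p - om c b e p * om d e a p)).
  2:{ intros e; rewrite comp2_minus.
      rewrite (comp2_swap p (fun l k => connection_form l b e p * connection_form k e a p)).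
      rewrite !comp2_prod, !comp1_connection_form by exact Hp; reflexivity. }
  unfold curvature.
  rewrite (sumc_ext (fun h => dcoframe h c d p * om h b a p) (fun h =>
    comp2 p (fun k l => partial k (Th h l) p) c d * om h b a p
    - comp2 p (fun k l => partial k (Th h l) p) d c * om h b a p)).
  2:{ intros h; rewrite <- (comp2_swap p (fun k l => partial k (Th h l) p) c d).
      rewrite <- Rmult_minus_distr_r, <- comp2_minus; f_equal.
      unfold dcoframe, comp2, comp1; apply sumc_ext; intros k.
      rewrite sumc_mult_l; apply sumc_ext; intros l; ring. }
  rewrite !sumc_minus; ring.
Qed.

Lemma comp4_riemann p a b c d : D p ->
  comp4 p (fun i j k l => riemann g i j k l p) a b c d
  = eta a p * curvature a b c d p.
Proof.
  intros Hp; rewrite <- comp2_curvature_form by exact Hp.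
  unfold comp4.
  rewrite (comp2_ext p _ (fun i j => sumc (fun m => g i m p *
     comp2 p (fun k l => riemann_up g m j k l p) c d))).
  2:{ intros i j; unfold riemann; rewrite comp2_sumc; apply sumc_ext; intros m.
      apply comp2_scal. }
  rewrite comp2_sumc.
  rewrite (sumc_ext _ (fun m => eta a p * Th a m p * sumc (fun e =>
    E e m p * comp2 p (fun k l => curvature_form b e k l p) c d))).
  2:{ intros m; rewrite comp2_prod; f_equal.
      - rewrite <- (lower_frame p a m Hp); apply sumc_ext; intros i.
        rewrite !(g_frame p) by exact Hp; rewrite Rmult_comm; f_equal.
        apply sumc_ext; intros; ring.
      - unfold comp1 at 1; rewrite (sumc_ext _ (fun j => comp2 p (fun k l =>
          riemann_up g m j k l p * E b j p) c d)).
        2:{ intros j; rewrite <- comp2_scal; apply comp2_ext; intros; ring. }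
        rewrite <- comp2_sumc, (comp2_ext p _ (fun k l => sumc (fun e =>
          E e m p * curvature_form b e k l p))).
        2:{ intros k l; rewrite riemann_up_frame by exact Hp.
            apply sumc_ext; intros; ring. }
        rewrite comp2_sumc; apply sumc_ext; intros e; apply comp2_scal. }
  rewrite (sumc_ext _ (fun m => sumc (fun e => eta a p * (Th a m p * E e m p)
     * comp2 p (fun k l => curvature_form b e k l p) c d))).
  2:{ intros m; rewrite sumc_mult_l; apply sumc_ext; intros; ring. }
  rewrite sumc_swap.
  rewrite (sumc_ext _ (fun e => delta a e *
    (eta a p * comp2 p (fun k l => curvature_form b e k l p) c d))).
  { apply (sumc_delta_l a (fun e =>
      eta a p * comp2 p (fun k l => curvature_form b e k l p) c d)). }
  intros e; rewrite <- (Th_E p a e Hp), !sumc_mult_r; apply sumc_ext; intros; ring.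
Qed.

Definition ricci_frame (b d : coord) (p : point) : R :=
  sumc (fun a => curvature a b a d p).

Lemma comp2_ricci p b d : D p ->
  comp2 p (fun j l => ricci g j l p) b d = ricci_frame b d p.
Proof.
  intros Hp; unfold ricci; rewrite comp2_sumc.
  rewrite (sumc_ext _ (fun i => sumc (fun a =>
    E a i p * comp1 p (fun l => curvature_form b a i l p) d))).
  2:{ intros i; unfold comp2; rewrite comp1_comp1.
      rewrite (comp1_ext p _ (fun l => sumc (fun a => E a i p * curvature_form b a i l p))).
      - rewrite comp1_sumc; apply sumc_ext; intros a; apply comp1_mult_l.
      - intros l; unfold comp1.
        rewrite (sumc_ext _ (fun j => riemann_up g i j i l p * E b j p))
          by (intros; ring).
        rewrite riemann_up_frame by exact Hp; apply sumc_ext; intros; ring. }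
  rewrite sumc_swap; apply sumc_ext; intros a.
  apply (comp2_curvature_form p b a a d Hp).
Qed.

Lemma scalar_curvature_frame p : D p ->
  scalar_curvature g p = sumc (fun a => / eta a p * ricci_frame a a p).
Proof.
  intros Hp; unfold scalar_curvature.
  rewrite (sumc_ext _ (fun i => sumc (fun j => sumc (fun a =>
    / eta a p * (E a i p * (E a j p * ricci g i j p)))))).
  2:{ intros i; apply sumc_ext; intros j.
      rewrite ginv_frame, sumc_mult_r by exact Hp; apply sumc_ext; intros; ring. }
  rewrite (sumc_ext _ (fun i => sumc (fun a => sumc (fun j =>
    / eta a p * (E a i p * (E a j p * ricci g i j p)))))).
  2:{ intros; apply sumc_swap. }
  rewrite sumc_swap; apply sumc_ext; intros a.
  rewrite <- comp2_ricci by exact Hp; unfold comp2, comp1; rewrite sumc_mult_l.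
  apply sumc_ext; intros i; rewrite !sumc_mult_l; reflexivity.
Qed.

Definition weyl_frame (a b c d : coord) (p : point) : R :=
  eta a p * curvature a b c d p
  - / 3 * (eta a p * delta a c * ricci_frame d b p
           - eta a p * delta a d * ricci_frame c b p
           - eta b p * delta b c * ricci_frame d a p
           + eta b p * delta b d * ricci_frame c a p)
  + / 12 * scalar_curvature g p
    * (eta a p * delta a c * (eta d p * delta d b)
       - eta a p * delta a d * (eta c p * delta c b)).

Lemma comp4_plus p S T a b c d :
  comp4 p (fun i j k l => S i j k l + T i j k l) a b c d
  = comp4 p S a b c d + comp4 p T a b c d.
Proof.
  unfold comp4; rewrite <- comp2_plus; apply comp2_ext; intros; apply comp2_plus.
Qed.

Lemma comp4_minus p S T a b c d :
  comp4 p (fun i j k l => S i j k l - T i j k l) a b c d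
  = comp4 p S a b c d - comp4 p T a b c d.
Proof.
  unfold comp4; rewrite <- comp2_minus; apply comp2_ext; intros; apply comp2_minus.
Qed.

Lemma comp4_scal p r T a b c d :
  comp4 p (fun i j k l => r * T i j k l) a b c d = r * comp4 p T a b c d.
Proof.
  unfold comp4; rewrite <- comp2_scal; apply comp2_ext; intros; apply comp2_scal.
Qed.

Lemma comp4_prod_ik_lj p S T a b c d :
  comp4 p (fun i j k l => S i k * T l j) a b c d
  = comp2 p S a c * comp2 p T d b.
Proof.
  unfold comp4.
  rewrite (comp2_ext p _ (fun i j => comp1 p (S i) c * comp1 p (fun l => T l j) d)).
  { rewrite comp2_prod; f_equal; unfold comp2; apply comp1_comp1. }
  intros i j; apply (comp2_prod p (S i) (fun l => T l j)).
Qed.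

Lemma comp4_prod_il_kj p S T a b c d :
  comp4 p (fun i j k l => S i l * T k j) a b c d
  = comp2 p S a d * comp2 p T c b.
Proof.
  rewrite <- (comp4_prod_ik_lj p S T a b d c).
  unfold comp4; apply comp2_ext; intros i j.
  symmetry; apply (comp2_swap p (fun k l => S i l * T k j)).
Qed.

Lemma comp4_swap12 p T a b c d :
  comp4 p (fun i j k l => T j i k l) a b c d = comp4 p T b a c d.
Proof. apply (comp2_swap p (fun i j => comp2 p (T i j) c d)). Qed.

Lemma comp4_weyl p a b c d : D p ->
  comp4 p (fun i j k l => weyl g i j k l p) a b c d = weyl_frame a b c d p.
Proof.
  intros Hp; unfold weyl, weyl_frame.
  rewrite comp4_plus, comp4_minus, !comp4_scal, comp4_plus, !comp4_minus.
  rewrite comp4_riemann by exact Hp.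
  rewrite (comp4_swap12 p (fun j i k l => g j k p * ricci g l i p)).
  rewrite (comp4_swap12 p (fun j i k l => g j l p * ricci g k i p)).
  rewrite !(comp4_prod_ik_lj p (fun i j => g i j p)).
  rewrite !(comp4_prod_il_kj p (fun i j => g i j p)).
  rewrite !comp2_metric, !comp2_ricci by exact Hp; ring.
Qed.

Context (A : tensor1).

Definition field_frame (a b : coord) (p : point) : R :=
  comp2 p (fun i j => field_strength A i j p) a b.

Definition field_square (p : point) : R :=
  sumc (fun a => sumc (fun b =>
    / eta a p * / eta b p * field_frame a b p * field_frame a b p)).

Definition stress_energy_frame (a b : coord) (p : point) : R :=
  sumc (fun c => / eta c p * field_frame a c p * field_frame b c p)
  - / 4 * (eta a p * delta a b) * field_square p.

Lemma comp2_stress_energy p a b : D p ->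
  comp2 p (fun i j => stress_energy g (field_strength A) i j p) a b
  = stress_energy_frame a b p.
Proof.
  intros Hp; unfold stress_energy, stress_energy_frame.
  set (F := field_strength A).
  assert (HF2 : forall X Y : coord -> coord -> R,
    sumc (fun k => sumc (fun l => sumc (fun k' => sumc (fun l' =>
      ginv g k k' p * ginv g l l' p * X k l * Y k' l'))))
    = sumc (fun c => sumc (fun d =>
        / eta c p * / eta d p * comp2 p X c d * comp2 p Y c d))).
  { intros X Y.
    rewrite (sumc_ext _ (fun k => sumc (fun k' => ginv g k k' p *
      sumc (fun d => / eta d p * comp1 p (X k) d * comp1 p (Y k') d)))).
    2:{ intros k; rewrite sumc_swap; apply sumc_ext; intros k'.
        rewrite <- (ginv_contract p (X k) (Y k') Hp).
        rewrite sumc_mult_l; apply sumc_ext; intros l.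
        rewrite sumc_mult_l; apply sumc_ext; intros; ring. }
    rewrite (sumc_ext _ (fun k => sumc (fun d => sumc (fun k' =>
      / eta d p * (comp1 p (X k) d * ginv g k k' p * comp1 p (Y k') d))))).
    2:{ intros k; rewrite sumc_swap; apply sumc_ext; intros k'.
        rewrite sumc_mult_l; apply sumc_ext; intros; ring. }
    rewrite sumc_swap, (sumc_swap (fun c d => / eta c p * / eta d p * _ * _)).
    apply sumc_ext; intros d.
    rewrite (sumc_ext _ (fun k => / eta d p * sumc (fun k' =>
      comp1 p (X k) d * ginv g k k' p * comp1 p (Y k') d))).
    2:{ intros k; rewrite sumc_mult_l; reflexivity. }
    rewrite <- sumc_mult_l.
    rewrite (ginv_contract p (fun k => comp1 p (X k) d) (fun k => comp1 p (Y k) d) Hp).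
    rewrite sumc_mult_l; apply sumc_ext; intros c; unfold comp2; ring. }
  rewrite comp2_minus; f_equal.
  - rewrite (comp2_ext p _ (fun i j => sumc (fun c =>
      / eta c p * (comp1 p (fun k => F i k p) c * comp1 p (fun k => F j k p) c)))).
    2:{ intros i j; rewrite (ginv_contract p (fun k => F i k p) (fun k => F j k p) Hp).
        apply sumc_ext; intros; ring. }
    rewrite comp2_sumc; apply sumc_ext; intros c.
    rewrite comp2_scal.
    rewrite (comp2_prod p (fun i => comp1 p (fun k => F i k p) c)).
    symmetry; apply Rmult_assoc.
  - rewrite (HF2 (fun k l => F k l p) (fun k l => F k l p)).
    rewrite (comp2_ext p _ (fun i j => / 4 * field_square p * g i j p))
      by (intros; unfold field_square, field_frame; fold F; ring).
    rewrite comp2_scal, comp2_metric by exact Hp; ring.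
Qed.

Lemma einstein_frame p a b : D p -> einstein_maxwell_at g A p ->
  ricci_frame a b p - / 2 * scalar_curvature g p * (eta a p * delta a b)
  = 2 * stress_energy_frame a b p.
Proof.
  intros Hp [_ H].
  rewrite <- comp2_ricci, <- comp2_metric, <- comp2_stress_energy by exact Hp.
  rewrite <- !comp2_scal, <- comp2_minus; apply comp2_ext; intros i j; apply H.
Qed.

End Cartan.


(** * The Bel--Debever condition in an orthonormal frame *)

(** This is W (x, v, y, w). The second slot, which receives the null vector, is summed innermost, so
    that the contraction with l^k in the Bel--Debever condition appears as a unit. *)
Definition eval4 (W : coord -> coord -> coord -> coord -> R) (x v y w : vec) : R :=
  sumc (fun a => x a * sumc (fun c => y c * sumc (fun d => w d *
    sumc (fun b => v b * W a b c d)))).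

(** Contract s and t with u and the remaining free indices with x, y, w. Since x, y, w annihilate L,
    every term with L on one of them drops, and what remains is the antisymmetrized W (x, v, y, w)
    times the square of u.L, which is cancelled. No symmetry of W is assumed, hence the conclusion
    is a symmetry in y and w; for a Weyl tensor it means that both sides vanish. *)
Lemma bel_debever_contract (L : coord -> R) (W : coord -> coord -> coord -> coord -> R)
    (v u x y w : vec) :
  (forall s m n r t : coord,
    antisym2 (fun s' m' => antisym3 (fun n' r' t' =>
      sumc (fun k => L s' * W m' k n' r' * L t' * v k)) n r t) s m = 0) ->
  sumc (fun i => u i * L i) <> 0 ->
  sumc (fun i => x i * L i) = 0 ->
  sumc (fun i => y i * L i) = 0 ->
  sumc (fun i => w i * L i) = 0 ->
  eval4 W x v y w = eval4 W x v w y.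
Proof.
  intros H Hu Hx Hy Hw.
  set (lu := sumc (fun i => u i * L i)) in *.
  set (K := fun m n r => sumc (fun k => v k * W m k n r)).
  set (M := fun m n r t => K m n r * L t + K m r t * L n + K m t n * L r
                - K m r n * L t - K m n t * L r - K m t r * L n).
  assert (HM : forall s m n r t, L s * M m n r t - L m * M s n r t = 0).
  { intros s m n r t; specialize (H s m n r t); unfold antisym2, antisym3 in H.
    rewrite <- (Rmult_0_r 12), <- H; unfold M, K, sumc; field. }
  set (Kx := fun n r => sumc (fun m => x m * K m n r)).
  assert (HKx : forall n r t, Kx n r * L t + Kx r t * L n + Kx t n * L r
                - Kx r n * L t - Kx n t * L r - Kx t r * L n = 0).
  { intros n r t; apply (Rmult_eq_reg_l lu); [|exact Hu].
    transitivity (sumc (fun s => u s * sumc (fun m => x m *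
      (L s * M m n r t - L m * M s n r t)))
      + sumc (fun i => x i * L i) * sumc (fun s => u s * M s n r t)).
    - unfold lu, Kx, M, sumc; ring.
    - rewrite Hx, (sumc_zero (fun s => _)); [ring|].
      intros s; rewrite (sumc_zero (fun m => _)); [ring|].
      intros m; rewrite HM; ring. }
  apply (Rmult_eq_reg_l lu); [|exact Hu]; apply Rminus_diag_uniq.
  transitivity (sumc (fun n => y n * sumc (fun r => w r * sumc (fun t => u t *
    (Kx n r * L t + Kx r t * L n + Kx t n * L r
     - Kx r n * L t - Kx n t * L r - Kx t r * L n))))
    - sumc (fun n => y n * L n) * sumc (fun r => w r * sumc (fun t => u t * (Kx r t - Kx t r)))
    - sumc (fun r => w r * L r) * sumc (fun n => y n * sumc (fun t => u t * (Kx t n - Kx n t)))).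
  - assert (HE : forall y w, eval4 W x v y w
      = sumc (fun n => y n * sumc (fun r => w r * Kx n r))).
    { intros y' w'; unfold eval4, Kx, K.
      rewrite (sumc_ext _ (fun a => sumc (fun c => x a * (y' c *
        sumc (fun d => w' d * sumc (fun b => v b * W a b c d)))))).
      2:{ intros a; apply sumc_mult_l. }
      rewrite sumc_swap; apply sumc_ext; intros c; unfold sumc; ring. }
    rewrite !HE; unfold lu; clearbody Kx; unfold sumc; ring.
  - rewrite Hy, Hw, (sumc_zero (fun n => _)); [ring|].
    intros n; rewrite (sumc_zero (fun r => _)); [ring|].
    intros r; rewrite (sumc_zero (fun t => _)); [ring|].
    intros t; rewrite HKx; ring.
Qed.


(** The halves come from the cyclic identity: a quarter turn gives C_2031 = - C_3021, so the two
    other terms of the identity for C_2301 = X are equal and each is - X / 2. The same holds for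
    Y. *)
Definition isotropic_row (A0 A1 A4 B C X Y : R) (a b c : coord) : R :=
  match a, b, c with
  | Ct, Cth, Ct => A0 | Ct, Ct, Cth => - A0
  | CR, Cth, CR => A1 | CR, CR, Cth => - A1
  | Cps, Cth, Cps => A4 | Cps, Cps, Cth => - A4
  | Ct, Cth, Cps => B | Ct, Cps, Cth => - B
  | Cps, Cth, Ct => B | Cps, Ct, Cth => - B
  | Cph, Cth, Cph => C | Cph, Cph, Cth => - C
  | Ct, Cph, CR => X / 2 | Ct, CR, Cph => - X / 2
  | CR, Ct, Cph => X / 2 | CR, Cph, Ct => - X / 2
  | Cph, Ct, CR => X | Cph, CR, Ct => - X
  | Cps, Cph, CR => - Y / 2 | Cps, CR, Cph => Y / 2
  | CR, Cps, Cph => - Y / 2 | CR, Cph, Cps => Y / 2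
  | Cph, Cps, CR => - Y | Cph, CR, Cps => Y
  | _, _, _ => 0
  end.

(** With [swap_sign], the quarter turn e_theta -> e_phi, e_phi -> - e_theta. *)
Definition swap_coord (a : coord) : coord :=
  match a with Cth => Cph | Cph => Cth | _ => a end.

Definition swap_sign (a : coord) : R :=
  match a with Cth => - 1 | _ => 1 end.

(* The components of a Weyl tensor invariant under rotations of the
   (theta, phi)-plane of an orthonormal frame and under the reflection of the
   t-, phi- and psi-directions; only those with first index in that plane. *)
Definition isotropic_weyl (W : coord -> coord -> coord -> coord -> R)
    (A0 A1 A4 B C X Y : R) : Prop :=
  (forall a b c, W Cth a b c = isotropic_row A0 A1 A4 B C X Y a b c) /\
  (forall a b c, W Cph a b c = swap_sign a * swap_sign b * swap_sign c *
     isotropic_row A0 A1 A4 B C X Y (swap_coord a) (swap_coord b) (swap_coord c)).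

Definition vec5 (a b c d e : R) : vec := fun i =>
  match i with Ct => a | CR => b | Cth => c | Cph => d | Cps => e end.

Definition minkowski (x y : vec) : R :=
  - x Ct * y Ct + x CR * y CR + x Cth * y Cth + x Cph * y Cph + x Cps * y Cps.

Lemma sumc_vec5 a b c d e (F : coord -> R) :
  sumc (fun i => vec5 a b c d e i * F i)
  = a * F Ct + b * F CR + c * F Cth + d * F Cph + e * F Cps.
Proof. reflexivity. Qed.

Ltac expand_eval4 H :=
  unfold eval4 in H; 
  repeat (rewrite !sumc_vec5 in H; rewrite ?Rmult_0_l, ?Rplus_0_l, ?Rplus_0_r in H);
  unfold sumc in H.

(** The test vectors [y1], [y4], [x], [y] are orthogonal to l by construction. First l2 = l3 = 0, so
    e2 and e3 become admissible test vectors as well; then l0 Y = l4 X, which determines l up to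
    scale and the sign of l1. The two remaining conditions, linear in l0 and l4, turn into the
    conclusion by this ratio. *)
Lemma isotropic_type_II W A0 A1 A4 B C X Y (l : vec) :
  isotropic_weyl W A0 A1 A4 B C X Y ->
  minkowski l l = 0 -> (exists i, l i <> 0) ->
  (forall x y w, minkowski x l = 0 -> minkowski y l = 0 -> minkowski w l = 0 ->
     eval4 W x l y w = 0) ->
  Y ^ 2 < X ^ 2 ->
  (A0 + A1) * X + B * Y = 0 /\ Y * (A4 - A1) + B * X = 0.
Proof.
  intros [H2 H3] Hn Hl HW HXY.
  set (l0 := l Ct) in *; set (l1 := l CR) in *; set (l2 := l Cth) in *;
    set (l3 := l Cph) in *; set (l4 := l Cps) in *.
  assert (Hn' : l0 ^ 2 = l1 ^ 2 + l2 ^ 2 + l3 ^ 2 + l4 ^ 2)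
    by (unfold minkowski in Hn; fold l0 l1 l2 l3 l4 in Hn; lra).
  assert (HX : 0 < X ^ 2) by (pose proof (pow2_ge_0 Y); lra).
  assert (H0 : l0 <> 0).
  { intros E; rewrite E in Hn'.
    pose proof (pow2_ge_0 l1); pose proof (pow2_ge_0 l2);
    pose proof (pow2_ge_0 l3); pose proof (pow2_ge_0 l4).
    destruct Hl as [i Hi]; apply Hi; destruct i; fold l0 l1 l2 l3 l4; nra. }
  set (y1 := vec5 l1 l0 0 0 0); set (y4 := vec5 l4 0 0 0 l0).
  assert (Hy1 : minkowski y1 l = 0)
    by (unfold minkowski, y1; simpl; fold l0 l1 l2 l3 l4; ring).
  assert (Hy4 : minkowski y4 l = 0)
    by (unfold minkowski, y4; simpl; fold l0 l1 l2 l3 l4; ring).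
  (* After a rotation making l3 = 0, the components of l ^ C(e3, l, ., .)
     involve only X and Y, and they force l2 = 0. *)
  assert (H23 : l2 ^ 2 + l3 ^ 2 = 0).
  { destruct (Req_dec (l2 ^ 2 + l3 ^ 2) 0) as [E|E]; [exact E|exfalso].
    set (x := vec5 0 0 (- l3) l2 0).
    set (y := vec5 (l2 ^ 2 + l3 ^ 2) 0 (l0 * l2) (l0 * l3) 0).
    assert (Hx : minkowski x l = 0)
      by (unfold minkowski, x; simpl; fold l0 l1 l2 l3 l4; ring).
    assert (Hy : minkowski y l = 0)
      by (unfold minkowski, y; simpl; fold l0 l1 l2 l3 l4; ring).
    pose proof (HW x y1 y4 Hx Hy1 Hy4) as T1.
    pose proof (HW x y1 y Hx Hy1 Hy) as T2.
    unfold x, y, y1, y4 in T1, T2; expand_eval4 T1; expand_eval4 T2.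
    fold l0 l1 l2 l3 l4 in T1, T2.
    rewrite !H2, !H3 in T1; rewrite !H2, !H3 in T2.
    unfold isotropic_row, swap_sign, swap_coord in T1, T2.
    clear Hx Hy x y Hy1 Hy4 y1 y4; clearbody l0 l1 l2 l3 l4.
    ring_simplify in T1; field_simplify in T2.
    assert (E1 : l4 * X = l0 * Y).
    { apply (Rmult_eq_reg_l (l0 * (l2 ^ 2 + l3 ^ 2)));
        [|apply Rmult_integral_contrapositive; auto].
      lra. }
    assert (E2 : X * (- l0 ^ 2 + l1 ^ 2 - 2 * (l2 ^ 2 + l3 ^ 2)) + l0 * l4 * Y = 0).
    { apply (Rmult_eq_reg_l (l0 * (l2 ^ 2 + l3 ^ 2)));
        [|apply Rmult_integral_contrapositive; auto].
      lra. }
    (* By E1 and the null condition, E2 reads - 3 X (l2^2 + l3^2) = 0. *)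
    assert (E3 : X * (l2 ^ 2 + l3 ^ 2) = 0).
    { assert (l0 * l4 * Y = l4 ^ 2 * X) by (rewrite (Rmult_comm l0), Rmult_assoc, <- E1; ring).
      rewrite H, Hn' in E2; nra. }
    apply Rmult_integral in E3; destruct E3 as [E3|E3]; [|contradiction].
    rewrite E3 in HX; lra. }
  assert (E2 : l2 = 0) by nra.
  assert (E3 : l3 = 0) by nra.
  set (e2 := vec5 0 0 1 0 0); set (e3 := vec5 0 0 0 1 0).
  assert (He2 : minkowski e2 l = 0)
    by (unfold minkowski, e2; simpl; fold l0 l1 l2 l3 l4; rewrite E2; ring).
  assert (He3 : minkowski e3 l = 0)
    by (unfold minkowski, e3; simpl; fold l0 l1 l2 l3 l4; rewrite E3; ring).
  pose proof (HW e2 y1 e3 He2 Hy1 He3) as T1.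
  pose proof (HW e2 y4 e3 He2 Hy4 He3) as T2.
  pose proof (HW e2 e2 y1 He2 He2 Hy1) as T3.
  pose proof (HW e2 e2 y4 He2 He2 Hy4) as T4.
  unfold e2, e3, y1, y4 in T1, T2, T3, T4.
  expand_eval4 T1; expand_eval4 T2; expand_eval4 T3; expand_eval4 T4.
  fold l0 l1 l2 l3 l4 in T1, T2, T3, T4.
  rewrite !H2 in T1; rewrite !H2 in T2; rewrite !H2 in T3; rewrite !H2 in T4.
  unfold isotropic_row in T1, T2, T3, T4.
  clear He2 He3 e2 e3 Hy1 Hy4 y1 y4; clearbody l0 l1 l2 l3 l4.
  rewrite E2, E3 in T1, T2, T3, T4.
  assert (Hn2 : l0 ^ 2 = l1 ^ 2 + l4 ^ 2) by (rewrite Hn', E2, E3; ring).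
  assert (K4 : l4 * (l0 * Y - l4 * X) = 0).
  { assert (X * (l1 ^ 2 - l0 ^ 2) + l0 * l4 * Y = 0) by nra.
    rewrite Hn2 in H; lra. }
  assert (K1 : l1 * (l0 * Y - l4 * X) = 0).
  { apply (Rmult_eq_reg_l l0); [|exact H0]; nra. }
  assert (K : l0 * Y = l4 * X).
  { apply Rmult_integral in K4; apply Rmult_integral in K1.
    destruct K4 as [K4|K4]; [|lra]; destruct K1 as [K1|K1]; [|lra].
    exfalso; rewrite K1, K4 in Hn2; apply H0; nra. }
  (* If l1 = 0 then l0^2 = l4^2, and l0 Y = l4 X would force Y^2 = X^2. *)
  assert (N1 : l1 <> 0).
  { intros E; rewrite E in Hn2.
    assert (l0 ^ 2 * Y ^ 2 = l0 ^ 2 * X ^ 2).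
    { replace (l0 ^ 2 * Y ^ 2) with ((l0 * Y) ^ 2) by ring.
      rewrite K; rewrite Hn2; ring. }
    assert (0 < l0 ^ 2) by (apply pow2_gt_0; exact H0).
    apply Rmult_eq_reg_l in H; lra. }
  assert (F1 : l0 * (A0 + A1) + l4 * B = 0).
  { apply (Rmult_eq_reg_l l1); [|exact N1]; lra. }
  assert (F2 : l4 * (A4 - A1) + l0 * B = 0).
  { apply (Rmult_eq_reg_l l0); [|exact H0].
    assert (l4 * (l0 * A0 + l4 * B + l0 * A1) = 0)
      by (replace (l0 * A0 + l4 * B + l0 * A1) with (l0 * (A0 + A1) + l4 * B) by ring;
          rewrite F1; ring).
    lra. }
  split; apply (Rmult_eq_reg_l l0); try exact H0.
  - replace (l0 * ((A0 + A1) * X + B * Y))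
      with (X * (l0 * (A0 + A1)) + B * (l0 * Y)) by ring.
    rewrite K.
    replace (X * (l0 * (A0 + A1)) + B * (l4 * X))
      with (X * (l0 * (A0 + A1) + l4 * B)) by ring.
    rewrite F1; ring.
  - replace (l0 * (Y * (A4 - A1) + B * X))
      with ((l0 * Y) * (A4 - A1) + l0 * B * X) by ring.
    rewrite K.
    replace (l4 * X * (A4 - A1) + l0 * B * X)
      with (X * (l4 * (A4 - A1) + l0 * B)) by ring.
    rewrite F2; ring.
Qed.


(** * The adapted frame *)

Lemma comp1_sumc_scal E p (y : vec) (F : coord -> coord -> R) a :
  comp1 E p (fun i => sumc (fun c => y c * F i c)) a
  = sumc (fun c => y c * comp1 E p (fun i => F i c) a).
Proof. unfold comp1, sumc; ring. Qed.

Definition frame_vector (E : tensor2) (p : point) (x : vec) : vec :=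
  fun i => sumc (fun a => x a * E a i p).

Lemma sumc_frame_vector E p x (F : coord -> R) :
  sumc (fun i => frame_vector E p x i * F i) = sumc (fun a => x a * comp1 E p F a).
Proof. unfold frame_vector, comp1, sumc; ring. Qed.

Lemma eval4_frame_vector E p T x v y w :
  eval4 T (frame_vector E p x) (frame_vector E p v) (frame_vector E p y)
    (frame_vector E p w)
  = eval4 (comp4 E p T) x v y w.
Proof.
  unfold eval4; rewrite sumc_frame_vector; apply sumc_ext; intros a; f_equal.
  rewrite (comp1_ext E p _ (fun i => sumc (fun c => y c * comp1 E p (fun k =>
    sumc (fun d => w d * comp1 E p (fun l =>
      sumc (fun b => v b * comp1 E p (fun j => T i j k l) b)) d)) c))).
  2:{ intros i; rewrite sumc_frame_vector; apply sumc_ext; intros c; f_equal.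
      apply comp1_ext; intros k; rewrite sumc_frame_vector.
      apply sumc_ext; intros d; f_equal; apply comp1_ext; intros l.
      apply sumc_frame_vector. }
  rewrite comp1_sumc_scal; apply sumc_ext; intros c; f_equal.
  rewrite (comp1_ext E p _ (fun i => sumc (fun d => w d * comp1 E p (fun k =>
    comp1 E p (fun l => sumc (fun b => v b * comp1 E p (fun j => T i j k l) b)) d) c))).
  2:{ intros i; apply comp1_sumc_scal. }
  rewrite comp1_sumc_scal; apply sumc_ext; intros d; f_equal.
  rewrite (comp1_ext E p _ (fun i => sumc (fun b => v b * comp1 E p (fun k =>
    comp1 E p (fun l => comp1 E p (fun j => T i j k l) b) d) c))).
  2:{ intros i; rewrite <- comp1_sumc_scal; apply comp1_ext; intros k.
      apply comp1_sumc_scal. }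
  rewrite comp1_sumc_scal; apply sumc_ext; intros b; f_equal.
  unfold comp4, comp2; apply comp1_ext; intros i.
  rewrite (comp1_ext E p _ (fun k => comp1 E p (fun j => comp1 E p (T i j k) d) b)).
  2:{ intros k; apply comp1_comp1. }
  apply comp1_comp1.
Qed.


Section Adapted.

Context (r : R) (f f1 f2 A A1 A2 B B1 B2 w w1 w2 : R -> R).

(* The orthogonal frame d_t + w (d_phi + d_psi), d_R, d_theta,
   cos^2 d_phi - sin^2 d_psi, d_phi + d_psi, in which everything is rational in
   f, A = N / m, B = m / f, w, sin and cos; note m / (4 f N) = 1 / (4 f A). *)
Definition adapted_frame : tensor2 := fun a i p =>
  match a, i with
  | Ct, Ct => 1 | Ct, Cph => w (p CR) | Ct, Cps => w (p CR)
  | CR, CR => 1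
  | Cth, Cth => 1
  | Cph, Cph => cos (p Cth) ^ 2 | Cph, Cps => - sin (p Cth) ^ 2
  | Cps, Cph => 1 | Cps, Cps => 1
  | _, _ => 0
  end.

Definition adapted_coframe : tensor2 := fun a i p =>
  match a, i with
  | Ct, Ct => 1
  | CR, CR => 1
  | Cth, Cth => 1
  | Cph, Cph => 1 | Cph, Cps => -1
  | Cps, Cph => sin (p Cth) ^ 2 | Cps, Cps => cos (p Cth) ^ 2
  | Cps, Ct => - w (p CR)
  | _, _ => 0
  end.

Definition adapted_norm : tensor1 := fun a p =>
  match a with
  | Ct => - f (p CR)
  | CR => / (4 * (f (p CR) * A (p CR)))
  | Cth => B (p CR)
  | Cph => B (p CR) * (sin (p Cth) * cos (p Cth)) ^ 2
  | Cps => A (p CR)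
  end.

Definition adapted_metric : tensor2 := fun i j p =>
  sumc (fun a => adapted_norm a p * adapted_coframe a i p * adapted_coframe a j p).

(* nabla_{e_a} e_c = sum_d (adapted_connection a c d) e_d *)
Definition adapted_connection : tensor3 := fun a c d p =>
  let x := p CR in let S := sin (p Cth) in let C := cos (p Cth) in
  match a, c, d with
  | Ct, Ct, CR => 2 * f x * A x * f1 x
  | Ct, CR, Ct => f1 x / (2 * f x)
  | Ct, CR, Cps => - (w1 x / 2)
  | Ct, Cps, CR => 2 * f x * A x ^ 2 * w1 x
  | CR, Ct, Ct => f1 x / (2 * f x)
  | CR, Ct, Cps => w1 x / 2
  | CR, CR, CR => - (f1 x / (2 * f x) + A1 x / (2 * A x))
  | CR, Cth, Cth => B1 x / (2 * B x)
  | CR, Cph, Cph => B1 x / (2 * B x)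
  | CR, Cps, Cps => A1 x / (2 * A x)
  | CR, Cps, Ct => w1 x * A x / (2 * f x)
  | Cth, CR, Cth => B1 x / (2 * B x)
  | Cth, Cth, CR => - (2 * f x * A x * B1 x)
  | Cth, Cph, Cph => (C ^ 2 - S ^ 2) / (S * C)
  | Cth, Cph, Cps => - (S * C)
  | Cth, Cps, Cph => A x / (B x * (S * C))
  | Cph, CR, Cph => B1 x / (2 * B x)
  | Cph, Cth, Cph => (C ^ 2 - S ^ 2) / (S * C)
  | Cph, Cth, Cps => S * C
  | Cph, Cph, CR => - (2 * f x * A x * B1 x * (S * C) ^ 2)
  | Cph, Cph, Cth => - (S * C * (C ^ 2 - S ^ 2))
  | Cph, Cps, Cth => - (S * C * A x / B x)
  | Cps, Ct, CR => 2 * f x * A x ^ 2 * w1 x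
  | Cps, CR, Ct => w1 x * A x / (2 * f x)
  | Cps, CR, Cps => A1 x / (2 * A x)
  | Cps, Cth, Cph => A x / (B x * (S * C))
  | Cps, Cph, Cth => - (S * C * A x / B x)
  | Cps, Cps, CR => - (2 * f x * A x * A1 x)
  | _, _, _ => 0
  end.

Definition d_frame (k a i : coord) (p : point) : R :=
  match k, a, i with
  | CR, Ct, Cph => w1 (p CR) | CR, Ct, Cps => w1 (p CR)
  | Cth, Cph, Cph => - (2 * (sin (p Cth) * cos (p Cth)))
  | Cth, Cph, Cps => - (2 * (sin (p Cth) * cos (p Cth)))
  | _, _, _ => 0
  end.

Definition d_coframe (k a i : coord) (p : point) : R :=
  match k, a, i with
  | CR, Cps, Ct => - w1 (p CR)
  | Cth, Cps, Cph => 2 * (sin (p Cth) * cos (p Cth))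
  | Cth, Cps, Cps => - (2 * (sin (p Cth) * cos (p Cth)))
  | _, _, _ => 0
  end.

Definition d_norm (k a : coord) (p : point) : R :=
  let x := p CR in let S := sin (p Cth) in let C := cos (p Cth) in
  match k, a with
  | CR, Ct => - f1 x
  | CR, CR => - (f1 x * A x + f x * A1 x) / (4 * (f x * A x) ^ 2)
  | CR, Cth => B1 x
  | CR, Cph => B1 x * (S * C) ^ 2
  | CR, Cps => A1 x
  | Cth, Cph => 2 * B x * (S * C) * (C ^ 2 - S ^ 2)
  | _, _ => 0
  end.

Definition d_connection (k a c d : coord) (p : point) : R :=
  let x := p CR in let S := sin (p Cth) in let C := cos (p Cth) in
  match k with
  | CR =>
    match a, c, d with
    | Ct, Ct, CR => 2 * (f1 x * A x * f1 x + f x * A1 x * f1 x + f x * A x * f2 x)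
    | Ct, CR, Ct => f2 x / (2 * f x) - f1 x ^ 2 / (2 * f x ^ 2)
    | Ct, CR, Cps => - (w2 x / 2)
    | Ct, Cps, CR => 2 * (f1 x * A x ^ 2 * w1 x + 2 * f x * A x * A1 x * w1 x + f x * A x ^ 2 * w2 x)
    | CR, Ct, Ct => f2 x / (2 * f x) - f1 x ^ 2 / (2 * f x ^ 2)
    | CR, Ct, Cps => w2 x / 2
    | CR, CR, CR => - (f2 x / (2 * f x) - f1 x ^ 2 / (2 * f x ^ 2)
                       + A2 x / (2 * A x) - A1 x ^ 2 / (2 * A x ^ 2))
    | CR, Cth, Cth => B2 x / (2 * B x) - B1 x ^ 2 / (2 * B x ^ 2)
    | CR, Cph, Cph => B2 x / (2 * B x) - B1 x ^ 2 / (2 * B x ^ 2)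
    | CR, Cps, Cps => A2 x / (2 * A x) - A1 x ^ 2 / (2 * A x ^ 2)
    | CR, Cps, Ct => (w2 x * A x + w1 x * A1 x) / (2 * f x) - w1 x * A x * f1 x / (2 * f x ^ 2)
    | Cth, CR, Cth => B2 x / (2 * B x) - B1 x ^ 2 / (2 * B x ^ 2)
    | Cth, Cth, CR => - (2 * (f1 x * A x * B1 x + f x * A1 x * B1 x + f x * A x * B2 x))
    | Cth, Cps, Cph => (A1 x / B x - A x * B1 x / B x ^ 2) / (S * C)
    | Cph, CR, Cph => B2 x / (2 * B x) - B1 x ^ 2 / (2 * B x ^ 2)
    | Cph, Cph, CR => - (2 * (f1 x * A x * B1 x + f x * A1 x * B1 x + f x * A x * B2 x) * (S * C) ^ 2)
    | Cph, Cps, Cth => - (S * C * (A1 x / B x - A x * B1 x / B x ^ 2))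
    | Cps, Ct, CR => 2 * (f1 x * A x ^ 2 * w1 x + 2 * f x * A x * A1 x * w1 x + f x * A x ^ 2 * w2 x)
    | Cps, CR, Ct => (w2 x * A x + w1 x * A1 x) / (2 * f x) - w1 x * A x * f1 x / (2 * f x ^ 2)
    | Cps, CR, Cps => A2 x / (2 * A x) - A1 x ^ 2 / (2 * A x ^ 2)
    | Cps, Cth, Cph => (A1 x / B x - A x * B1 x / B x ^ 2) / (S * C)
    | Cps, Cph, Cth => - (S * C * (A1 x / B x - A x * B1 x / B x ^ 2))
    | Cps, Cps, CR => - (2 * (f1 x * A x * A1 x + f x * A1 x * A1 x + f x * A x * A2 x))
    | _, _, _ => 0
    end
  | Cth =>
    match a, c, d with
    | Cth, Cph, Cph => - (4 + (C ^ 2 - S ^ 2) ^ 2 / (S * C) ^ 2)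
    | Cth, Cph, Cps => - (C ^ 2 - S ^ 2)
    | Cth, Cps, Cph => - (A x / B x * (C ^ 2 - S ^ 2) / (S * C) ^ 2)
    | Cph, Cth, Cph => - (4 + (C ^ 2 - S ^ 2) ^ 2 / (S * C) ^ 2)
    | Cph, Cth, Cps => C ^ 2 - S ^ 2
    | Cph, Cph, CR => - (4 * f x * A x * B1 x * (S * C) * (C ^ 2 - S ^ 2))
    | Cph, Cph, Cth => - ((C ^ 2 - S ^ 2) ^ 2 - 4 * (S * C) ^ 2)
    | Cph, Cps, Cth => - ((C ^ 2 - S ^ 2) * A x / B x)
    | Cps, Cth, Cph => - (A x / B x * (C ^ 2 - S ^ 2) / (S * C) ^ 2)
    | Cps, Cph, Cth => - ((C ^ 2 - S ^ 2) * A x / B x)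
    | _, _, _ => 0
    end
  | _ => 0
  end.

Context (df : forall x, r < x -> is_derive f x (f1 x)).
Context (df1 : forall x, r < x -> is_derive f1 x (f2 x)).
Context (dA : forall x, r < x -> is_derive A x (A1 x)).
Context (dA1 : forall x, r < x -> is_derive A1 x (A2 x)).
Context (dB : forall x, r < x -> is_derive B x (B1 x)).
Context (dB1 : forall x, r < x -> is_derive B1 x (B2 x)).
Context (dw : forall x, r < x -> is_derive w x (w1 x)).
Context (dw1 : forall x, r < x -> is_derive w1 x (w2 x)).
Context (f_pos : forall x, r < x -> 0 < f x).
Context (A_pos : forall x, r < x -> 0 < A x).
Context (B_pos : forall x, r < x -> 0 < B x).

Lemma exterior_open : open_domain (exterior r).
Proof.
  intros p k [H1 [H2 H3]].
  destruct k; unfold exterior, upd; cbn.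
  - apply filter_forall; intros _; auto.
  - apply filter_imp with (fun x => r < x); [auto|].
    apply (open_gt r); exact H1.
  - apply filter_imp with (fun x => 0 < x /\ x < PI / 2); [tauto|].
    apply filter_and; [apply (open_gt 0) | apply (open_lt (PI / 2))]; assumption.
  - apply filter_forall; intros _; auto.
  - apply filter_forall; intros _; auto.
Qed.

Lemma sin_cos_exterior p : exterior r p ->
  sin (p Cth) <> 0 /\ cos (p Cth) <> 0 /\ cos (p Cth) ^ 2 = 1 - sin (p Cth) ^ 2.
Proof.
  intros [_ [H1 H2]]; repeat split.
  - apply Rgt_not_eq, sin_gt_0; lra.
  - apply Rgt_not_eq, cos_gt_0; lra.
  - generalize (sin2_cos2 (p Cth)); unfold Rsqr; simpl; lra.
Qed.

Ltac derive_atom h dh p Hp :=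
  change (Derive (fun z => h z) (p CR)) with (Derive h (p CR));
  rewrite ?(is_derive_unique _ _ _ (dh (p CR) Hp)).

Ltac ex_derive_atom Hr :=
  first [ exact (ex_intro _ _ (df _ Hr)) | exact (ex_intro _ _ (df1 _ Hr))
        | exact (ex_intro _ _ (dA _ Hr)) | exact (ex_intro _ _ (dA1 _ Hr))
        | exact (ex_intro _ _ (dB _ Hr)) | exact (ex_intro _ _ (dB1 _ Hr))
        | exact (ex_intro _ _ (dw _ Hr)) | exact (ex_intro _ _ (dw1 _ Hr)) ].

Ltac partial_tac p Hp :=
  unfold is_partial; cbn -[pow];
  first
    [ apply (is_derive_const (K := R_AbsRing) (V := R_NormedModule))
    | let Hr := fresh in let Hs := fresh in let Hc := fresh in let Hsc := fresh in
      pose proof (proj1 Hp) as Hr;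
      destruct (sin_cos_exterior p Hp) as [Hs [Hc Hsc]];
      pose proof (Rgt_not_eq _ _ (f_pos _ Hr));
      pose proof (Rgt_not_eq _ _ (A_pos _ Hr));
      pose proof (Rgt_not_eq _ _ (B_pos _ Hr));
      auto_derive;
      [ repeat split; try ex_derive_atom Hr;
        repeat (apply Rmult_integral_contrapositive; split);
        try assumption; try lra; try exact I
      | derive_atom f df p Hr; derive_atom f1 df1 p Hr;
        derive_atom A dA p Hr; derive_atom A1 dA1 p Hr;
        derive_atom B dB p Hr; derive_atom B1 dB1 p Hr;
        derive_atom w dw p Hr; derive_atom w1 dw1 p Hr;
        field; repeat split; assumption ] ].

Lemma is_partial_frame p k a i : exterior r p ->
  is_partial k (adapted_frame a i) p (d_frame k a i p).
Proof.
  intros Hp; destruct k, a, i; partial_tac p Hp.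
Qed.

Lemma is_partial_coframe p k a i : exterior r p ->
  is_partial k (adapted_coframe a i) p (d_coframe k a i p).
Proof.
  intros Hp; destruct k, a, i; partial_tac p Hp.
Qed.

Lemma is_partial_norm p k a : exterior r p ->
  is_partial k (adapted_norm a) p (d_norm k a p).
Proof.
  intros Hp; destruct k, a; partial_tac p Hp.
Qed.

Lemma is_partial_connection p k a c d : exterior r p ->
  is_partial k (adapted_connection a c d) p (d_connection k a c d p).
Proof.
  intros Hp; destruct a, c, d; destruct k; partial_tac p Hp.
Qed.

Lemma adapted_norm_neq_0 p a : exterior r p -> adapted_norm a p <> 0.
Proof.
  intros Hp; destruct (sin_cos_exterior p Hp) as [Hs [Hc _]].
  pose proof (f_pos _ (proj1 Hp)); pose proof (A_pos _ (proj1 Hp));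
    pose proof (B_pos _ (proj1 Hp)).
  destruct a; cbn -[pow].
  - lra.
  - apply Rinv_neq_0_compat; nra.
  - lra.
  - apply Rmult_integral_contrapositive; split; [lra|].
    apply pow_nonzero, Rmult_integral_contrapositive; auto.
  - lra.
Qed.

Lemma adapted_coframe_frame p a b : exterior r p ->
  sumc (fun i => adapted_coframe a i p * adapted_frame b i p) = delta a b.
Proof.
  intros Hp; destruct (sin_cos_exterior p Hp) as [_ [_ E]].
  destruct a, b; unfold sumc, delta; cbn -[pow]; rewrite ?E; ring.
Qed.

Lemma adapted_frame_coframe p i j : exterior r p ->
  sumc (fun a => adapted_frame a i p * adapted_coframe a j p) = delta i j.
Proof.
  intros Hp; destruct (sin_cos_exterior p Hp) as [_ [_ E]].
  destruct i, j; unfold sumc, delta; cbn -[pow]; rewrite ?E; ring.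
Qed.

Context (g : tensor2).
Context (g_adapted : forall p i j, exterior r p -> g i j p = adapted_metric i j p).

Definition d_metric (k i j : coord) (p : point) : R :=
  sumc (fun a =>
    (d_norm k a p * adapted_coframe a i p + adapted_norm a p * d_coframe k a i p)
      * adapted_coframe a j p
    + adapted_norm a p * adapted_coframe a i p * d_coframe k a j p).

Lemma partial_adapted_metric p k i j : exterior r p ->
  partial k (g i j) p = d_metric k i j p.
Proof.
  intros Hp.
  rewrite (partial_ext _ k (g i j) (adapted_metric i j) p exterior_open Hp)
    by (intros; apply g_adapted; assumption).
  apply is_partial_unique, is_partial_sumc; intros a.
  repeat apply is_partial_mult;
    [apply is_partial_norm | apply is_partial_coframe | apply is_partial_coframe];
    exact Hp.
Qed.

Lemma partial_adapted_frame p k a i : exterior r p ->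
  partial k (adapted_frame a i) p = d_frame k a i p.
Proof. intros Hp; apply is_partial_unique, is_partial_frame, Hp. Qed.

Lemma lower_adapted_frame p a i : exterior r p ->
  sumc (fun j => g i j p * adapted_frame a j p)
  = adapted_norm a p * adapted_coframe a i p.
Proof.
  apply (lower_frame (exterior r)).
  - intros; apply g_adapted; assumption.
  - intros; apply adapted_coframe_frame; assumption.
Qed.

(** The table is verified rather than derived: with the index lowered, both sides are explicit
    rational expressions, equal modulo cos^2 = 1 - sin^2. *)
Lemma adapted_connection_lowered p i c n : exterior r p ->
  sumc (fun m => g n m p * partial i (adapted_frame c m) p)
  + / 2 * sumc (fun j => (partial i (g n j) p + partial j (g n i) p
                          - partial n (g i j) p) * adapted_frame c j p)
  = sumc (fun d => connection_form adapted_coframe adapted_connection i c d p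
                   * (adapted_norm d p * adapted_coframe d n p)).
Proof.
  intros Hp; destruct (sin_cos_exterior p Hp) as [Hs [Hc Hsc]].
  pose proof (Rgt_not_eq _ _ (f_pos _ (proj1 Hp))) as Hf;
    pose proof (Rgt_not_eq _ _ (A_pos _ (proj1 Hp))) as HA;
    pose proof (Rgt_not_eq _ _ (B_pos _ (proj1 Hp))) as HB.
  rewrite (sumc_ext _ (fun m => adapted_metric n m p * d_frame i c m p)).
  2:{ intros m; rewrite g_adapted, partial_adapted_frame by exact Hp; reflexivity. }
  rewrite (sumc_ext (fun j => _ * adapted_frame c j p) (fun j =>
    (d_metric i n j p + d_metric j n i p - d_metric n i j p) * adapted_frame c j p)).
  2:{ intros j; rewrite !partial_adapted_metric by exact Hp; reflexivity. }
  assert (Hs2 : 1 - sin (p Cth) ^ 2 <> 0) by (rewrite <- Hsc; apply pow_nonzero, Hc).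
  destruct i, c, n; unfold d_metric, adapted_metric, connection_form, sumc;
    cbn -[pow]; field [Hsc]; repeat split; assumption.
Qed.
(** Only the last form, sin^2 dphi + cos^2 dpsi - w dt, is not closed: its differential is 2 sin cos
    dtheta ^ (dphi - dpsi) - w' dR ^ dt. *)
Lemma adapted_dcoframe h c d p : exterior r p ->
  dcoframe adapted_frame adapted_coframe h c d p
  = match h, c, d with
    | Cps, CR, Ct => - w1 (p CR) | Cps, Ct, CR => w1 (p CR)
    | Cps, Cth, Cph => 2 * (sin (p Cth) * cos (p Cth))
    | Cps, Cph, Cth => - (2 * (sin (p Cth) * cos (p Cth)))
    | _, _, _ => 0
    end.
Proof.
  intros Hp; destruct (sin_cos_exterior p Hp) as [_ [_ E]].
  unfold dcoframe.
  rewrite (sumc_ext _ (fun k => sumc (fun l => adapted_frame c k p *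
    adapted_frame d l p * (d_coframe k h l p - d_coframe l h k p)))).
  2:{ intros k; apply sumc_ext; intros l; f_equal.
      f_equal; apply is_partial_unique, is_partial_coframe, Hp. }
  destruct h, c, d; unfold sumc; cbn -[pow]; rewrite ?E; ring.
Qed.

(** The first index of [d_connection] may be read as a frame index: e_1 and e_2 are d_R and d_theta,
    and the other frame vectors differentiate only along t, phi and psi, on which nothing
    depends. *)
Lemma adapted_along a b c d p : exterior r p ->
  along adapted_frame a (adapted_connection b c d) p = d_connection a b c d p.
Proof.
  intros Hp; unfold along.
  rewrite (sumc_ext _ (fun k => adapted_frame a k p * d_connection k b c d p)).
  2:{ intros k; f_equal; apply is_partial_unique, is_partial_connection, Hp. }
  destruct a; unfold sumc; cbn -[pow d_connection]; try ring;
    unfold d_connection; ring.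
Qed.

Definition adapted_curvature (a b c d : coord) (p : point) : R :=
  d_connection c d b a p - d_connection d c b a p
  + sumc (fun e => adapted_connection d b e p * adapted_connection c e a p
                   - adapted_connection c b e p * adapted_connection d e a p)
  + match c, d with
    | CR, Ct => - w1 (p CR) | Ct, CR => w1 (p CR)
    | Cth, Cph => 2 * (sin (p Cth) * cos (p Cth))
    | Cph, Cth => - (2 * (sin (p Cth) * cos (p Cth)))
    | _, _ => 0
    end * adapted_connection Cps b a p.

Lemma adapted_curvatureE a b c d p : exterior r p ->
  curvature adapted_frame adapted_coframe adapted_connection a b c d p
  = adapted_curvature a b c d p.
Proof.
  intros Hp; unfold curvature, adapted_curvature.
  rewrite !adapted_along by exact Hp; f_equal.
  unfold sumc; rewrite !adapted_dcoframe by exact Hp; destruct c, d; ring.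
Qed.

(** One representative for each ordered couple of index pairs; [riemann_table] restores the
    antisymmetry in either pair. The factor [tau2] is (sin cos)^2 from the norm of e_3, and the
    halves again come from the cyclic identity and the rotation of the (theta, U)-plane. *)
Definition riemann_entry (tau2 r0101 r0404 r1414 r0114 r0202 r1212 r4242 r0242
    r2323 r0123 r1423 : R) (a b c d : coord) : R :=
  match a, b, c, d with
  | Ct, CR, Ct, CR => r0101
  | Ct, CR, CR, Cps => r0114 | CR, Cps, Ct, CR => r0114
  | CR, Cps, CR, Cps => r1414
  | Ct, Cps, Ct, Cps => r0404
  | Cth, Cph, Cth, Cph => r2323
  | Ct, CR, Cth, Cph => r0123 | Cth, Cph, Ct, CR => r0123
  | CR, Cps, Cth, Cph => r1423 | Cth, Cph, CR, Cps => r1423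
  | Ct, Cth, Ct, Cth => r0202 | Ct, Cph, Ct, Cph => tau2 * r0202
  | CR, Cth, CR, Cth => r1212 | CR, Cph, CR, Cph => tau2 * r1212
  | Cps, Cth, Cps, Cth => r4242 | Cps, Cph, Cps, Cph => tau2 * r4242
  | Ct, Cth, Cps, Cth => r0242 | Ct, Cph, Cps, Cph => tau2 * r0242
  | Cps, Cth, Ct, Cth => r0242 | Cps, Cph, Ct, Cph => tau2 * r0242
  | Ct, Cth, CR, Cph => r0123 / 2 | CR, Cph, Ct, Cth => r0123 / 2
  | Ct, Cph, CR, Cth => - r0123 / 2 | CR, Cth, Ct, Cph => - r0123 / 2
  | Cps, Cth, CR, Cph => - r1423 / 2 | CR, Cph, Cps, Cth => - r1423 / 2
  | Cps, Cph, CR, Cth => r1423 / 2 | CR, Cth, Cps, Cph => r1423 / 2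
  | _, _, _, _ => 0
  end.

Definition riemann_table tau2 r0101 r0404 r1414 r0114 r0202 r1212 r4242 r0242
    r2323 r0123 r1423 (a b c d : coord) : R :=
  let e := riemann_entry tau2 r0101 r0404 r1414 r0114 r0202 r1212 r4242 r0242
             r2323 r0123 r1423 in
  e a b c d - e b a c d - e a b d c + e b a d c.

(** [K0101] to [K1423] are the components g (e_a, R (e_c, e_d) e_b), with the powers of sin cos due
    to e_3 removed, so that they depend on R only. *)
Definition K0101 x := f2 x / 2 + f1 x * A1 x / (4 * A x) - 3 / 4 * A x * w1 x ^ 2.
Definition K0404 x := f x * A x ^ 3 * w1 x ^ 2 + f x * A x * A1 x * f1 x.
Definition K1414 x :=
  - (A2 x / 2) - A x ^ 2 * w1 x ^ 2 / (4 * f x) - f1 x * A1 x / (4 * f x).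
Definition K0114 x := - (w2 x * A x / 2 + w1 x * A1 x).
Definition K0202 x := f x * A x * B1 x * f1 x.
Definition K1212 x := B1 x ^ 2 / (4 * B x) - B2 x / 2 - A1 x * B1 x / (4 * A x)
  - f1 x * B1 x / (4 * f x).
Definition K4242 x := A x ^ 2 / B x - f x * A x * A1 x * B1 x.
Definition K0242 x := f x * A x ^ 2 * B1 x * w1 x.
Definition K2323 x := 4 * B x - f x * A x * B1 x ^ 2 - 3 * A x.
Definition K0123 x := - (w1 x * A x).
Definition K1423 x := A x * B1 x / B x - A1 x.

Lemma adapted_riemannE a b c d p : exterior r p ->
  let x := p CR in let tau := sin (p Cth) * cos (p Cth) in
  adapted_norm a p * adapted_curvature a b c d p
  = riemann_table (tau ^ 2) (K0101 x) (K0404 x) (K1414 x) (K0114 x) (K0202 x)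
      (K1212 x) (K4242 x) (K0242 x) (tau ^ 2 * K2323 x) (tau * K0123 x)
      (tau * K1423 x) a b c d.
Proof.
  intros Hp x tau; destruct (sin_cos_exterior p Hp) as [Hs [Hc Hsc]].
  pose proof (Rgt_not_eq _ _ (f_pos _ (proj1 Hp))) as Hf;
    pose proof (Rgt_not_eq _ _ (A_pos _ (proj1 Hp))) as HA;
    pose proof (Rgt_not_eq _ _ (B_pos _ (proj1 Hp))) as HB.
  assert (Hs2 : 1 - sin (p Cth) ^ 2 <> 0) by (rewrite <- Hsc; apply pow_nonzero, Hc).
  subst x tau; unfold riemann_table, K0101, K0404, K1414, K0114, K0202, K1212,
    K4242, K0242, K2323, K0123, K1423.
  destruct a, b, c, d; unfold adapted_curvature, sumc; cbn -[pow];
    field [Hsc]; repeat split; assumption.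
Qed.

Definition Ric00 x := 4 * f x * A x * K0101 x + 2 * K0202 x / B x + K0404 x / A x.
Definition Ric11 x := - K0101 x / f x + 2 * K1212 x / B x + K1414 x / A x.
Definition Ric22 x := - K0202 x / f x + 4 * f x * A x * K1212 x + K2323 x / B x
  + K4242 x / A x.
Definition Ric44 x := - K0404 x / f x + 4 * f x * A x * K1414 x + 2 * K4242 x / B x.
Definition Ric04 x := - (4 * f x * A x * K0114 x) + 2 * K0242 x / B x.

(** Exhibits the product that [adapted_riemannE] rewrites, so that the Ricci tensor is read off the
    table instead of being recomputed from the connection. *)
Lemma adapted_curvature_riemann a b c d p : exterior r p ->
  adapted_curvature a b c d p
  = / adapted_norm a p * (adapted_norm a p * adapted_curvature a b c d p).
Proof. intros Hp; field; apply adapted_norm_neq_0, Hp. Qed.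

Lemma adapted_ricciE b d p : exterior r p ->
  let x := p CR in let tau := sin (p Cth) * cos (p Cth) in
  ricci_frame adapted_frame adapted_coframe adapted_connection b d p
  = match b, d with
    | Ct, Ct => Ric00 x
    | CR, CR => Ric11 x
    | Cth, Cth => Ric22 x
    | Cph, Cph => tau ^ 2 * Ric22 x
    | Cps, Cps => Ric44 x
    | Ct, Cps => Ric04 x
    | Cps, Ct => Ric04 x
    | _, _ => 0
    end.
Proof.
  intros Hp x tau; destruct (sin_cos_exterior p Hp) as [Hs [Hc Hsc]].
  pose proof (Rgt_not_eq _ _ (f_pos _ (proj1 Hp))) as Hf;
    pose proof (Rgt_not_eq _ _ (A_pos _ (proj1 Hp))) as HA;
    pose proof (Rgt_not_eq _ _ (B_pos _ (proj1 Hp))) as HB.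
  unfold ricci_frame, sumc.
  rewrite !adapted_curvatureE by exact Hp.
  rewrite (adapted_curvature_riemann Ct), (adapted_curvature_riemann CR),
    (adapted_curvature_riemann Cth), (adapted_curvature_riemann Cph),
    (adapted_curvature_riemann Cps) by exact Hp.
  rewrite !adapted_riemannE by exact Hp; fold x tau.
  unfold adapted_norm; fold x tau.
  assert (Ht : tau <> 0) by (apply Rmult_integral_contrapositive; auto).
  change (f x <> 0) in Hf; change (A x <> 0) in HA; change (B x <> 0) in HB.
  clearbody x tau; unfold riemann_table.
  destruct b, d; unfold Ric00, Ric11, Ric22, Ric44, Ric04; cbn -[pow];
    field; repeat split; assumption.
Qed.

Context (g_inverse : forall p, exterior r p ->
  is_inverse (fun i j => g i j p) (fun i j => ginv g i j p)).

Definition d2_frame (k l a i : coord) (p : point) : R :=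
  match k, l, a, i with
  | CR, CR, Ct, Cph => w2 (p CR) | CR, CR, Ct, Cps => w2 (p CR)
  | Cth, Cth, Cph, Cph => - (2 * (cos (p Cth) ^ 2 - sin (p Cth) ^ 2))
  | Cth, Cth, Cph, Cps => - (2 * (cos (p Cth) ^ 2 - sin (p Cth) ^ 2))
  | _, _, _, _ => 0
  end.

Lemma is_partial_d_frame p k l a i : exterior r p ->
  is_partial k (d_frame l a i) p (d2_frame k l a i p).
Proof.
  intros Hp; destruct l, a, i; destruct k; partial_tac p Hp.
Qed.

Lemma is_partial2_frame p k l a i : exterior r p ->
  is_partial k (partial l (adapted_frame a i)) p (d2_frame k l a i p).
Proof.
  intros Hp.
  apply (is_partial_ext _ k (d_frame l a i) _ p _ exterior_open Hp).
  - intros q Hq; symmetry; apply partial_adapted_frame, Hq.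
  - apply is_partial_d_frame, Hp.
Qed.

Lemma adapted_frame_diff a i : differentiable_on (exterior r) (adapted_frame a i).
Proof.
  apply differentiable_on_intro; intros p k Hp; eexists.
  apply is_partial_frame, Hp.
Qed.

Lemma adapted_coframe_diff a i : differentiable_on (exterior r) (adapted_coframe a i).
Proof.
  apply differentiable_on_intro; intros p k Hp; eexists.
  apply is_partial_coframe, Hp.
Qed.

Lemma adapted_connection_diff a c d :
  differentiable_on (exterior r) (adapted_connection a c d).
Proof.
  apply differentiable_on_intro; intros p k Hp; eexists.
  apply is_partial_connection, Hp.
Qed.

Lemma partial_adapted_frame_diff l a i :
  differentiable_on (exterior r) (partial l (adapted_frame a i)).
Proof.
  apply differentiable_on_intro; intros p k Hp; eexists.
  apply is_partial2_frame, Hp.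
Qed.

Lemma adapted_frame_schwarz p k l a i : exterior r p ->
  partial k (partial l (adapted_frame a i)) p
  = partial l (partial k (adapted_frame a i)) p.
Proof.
  intros Hp; rewrite !(is_partial_unique _ _ _ _ (is_partial2_frame p _ _ a i Hp)).
  destruct k, l, a, i; reflexivity.
Qed.

Ltac cartan_side :=
  first
    [ assumption
    | exact exterior_open
    | exact (fun p i j Hq => g_adapted p i j Hq)
    | exact (fun p a Hq => adapted_norm_neq_0 p a Hq)
    | exact (fun p a b Hq => adapted_coframe_frame p a b Hq)
    | exact (fun p i j Hq => adapted_frame_coframe p i j Hq)
    | exact (fun p i c n Hq => adapted_connection_lowered p i c n Hq)
    | exact adapted_frame_diff | exact adapted_coframe_diff
    | exact adapted_connection_diff | exact partial_adapted_frame_diff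
    | exact (fun p k l a i Hq => adapted_frame_schwarz p k l a i Hq) ].

Lemma adapted_scalar_curvature p : exterior r p ->
  let x := p CR in
  scalar_curvature g p = - Ric00 x / f x + 4 * f x * A x * Ric11 x
    + 2 * Ric22 x / B x + Ric44 x / A x.
Proof.
  intros Hp x; destruct (sin_cos_exterior p Hp) as [Hs [Hc Hsc]].
  pose proof (Rgt_not_eq _ _ (f_pos _ (proj1 Hp))) as Hf;
    pose proof (Rgt_not_eq _ _ (A_pos _ (proj1 Hp))) as HA;
    pose proof (Rgt_not_eq _ _ (B_pos _ (proj1 Hp))) as HB.
  rewrite (scalar_curvature_frame (exterior r) g adapted_frame adapted_coframe
    adapted_norm adapted_connection exterior_open)
    by cartan_side.
  unfold sumc; rewrite !adapted_ricciE by exact Hp; unfold adapted_norm; fold x.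
  change (f x <> 0) in Hf; change (A x <> 0) in HA; change (B x <> 0) in HB.
  field; repeat split; assumption.
Qed.

(** * The Maxwell field and the Einstein equations in the adapted frame *)

Context (Apot : tensor1) (a a1 P P1 : R -> R).
Context (da : forall x, r < x -> is_derive a x (a1 x)).
Context (dP : forall x, r < x -> is_derive P x (P1 x)).
Context (Apot_adapted : forall p i, Apot i p =
  a (p CR) * delta i Ct + P (p CR) *
    (sin (p Cth) ^ 2 * delta i Cph + cos (p Cth) ^ 2 * delta i Cps)).

Definition d_potential (k i : coord) (p : point) : R :=
  match k, i with
  | CR, Ct => a1 (p CR)
  | CR, Cph => P1 (p CR) * sin (p Cth) ^ 2
  | CR, Cps => P1 (p CR) * cos (p Cth) ^ 2
  | Cth, Cph => 2 * P (p CR) * (sin (p Cth) * cos (p Cth))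
  | Cth, Cps => - (2 * P (p CR) * (sin (p Cth) * cos (p Cth)))
  | _, _ => 0
  end.

Lemma partial_potential p k i : exterior r p ->
  partial k (Apot i) p = d_potential k i p.
Proof.
  intros Hp; rewrite (partial_ext _ k _ _ p exterior_open Hp
    (fun q _ => Apot_adapted q i)).
  apply is_partial_unique; pose proof (proj1 Hp) as Hr.
  unfold is_partial, delta; destruct k, i; cbn -[pow]; auto_derive;
    try (repeat split; try exact I;
         first [exact (ex_intro _ _ (da _ Hr)) | exact (ex_intro _ _ (dP _ Hr))]);
    derive_atom a da p Hr; derive_atom P dP p Hr; ring.
Qed.

(** The combination a_0' + w a_phi' is the radial electric field seen along e_0, which rotates with
    angular velocity w. *)
Lemma adapted_field_frame b c p : exterior r p ->
  let x := p CR in let tau := sin (p Cth) * cos (p Cth) in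
  field_frame adapted_frame Apot b c p
  = match b, c with
    | CR, Ct => a1 x + w x * P1 x
    | Ct, CR => - (a1 x + w x * P1 x)
    | CR, Cps => P1 x
    | Cps, CR => - P1 x
    | Cth, Cph => 2 * tau * P x
    | Cph, Cth => - (2 * tau * P x)
    | _, _ => 0
    end.
Proof.
  intros Hp x tau; destruct (sin_cos_exterior p Hp) as [_ [_ Hsc]].
  unfold field_frame, field_strength, comp2, comp1, sumc.
  rewrite !partial_potential by exact Hp; subst x tau.
  destruct b, c; cbn -[pow]; ring [Hsc].
Qed.

Definition field_sq x :=
  - (8 * A x * (a1 x + w x * P1 x) ^ 2) + 8 * f x * P1 x ^ 2 + 8 * P x ^ 2 / B x ^ 2.

Lemma adapted_field_square p : exterior r p ->
  field_square adapted_frame adapted_norm Apot p = field_sq (p CR).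
Proof.
  intros Hp; destruct (sin_cos_exterior p Hp) as [Hs [Hc Hsc]].
  pose proof (Rgt_not_eq _ _ (f_pos _ (proj1 Hp))) as Hf;
    pose proof (Rgt_not_eq _ _ (A_pos _ (proj1 Hp))) as HA;
    pose proof (Rgt_not_eq _ _ (B_pos _ (proj1 Hp))) as HB.
  unfold field_square, sumc; rewrite !adapted_field_frame by exact Hp.
  unfold adapted_norm, field_sq; field; repeat split; assumption.
Qed.

(** [electric] and [magnetic] are the squares of the orthonormal components F_01 and F_14. *)
Definition electric x := 4 * A x * (a1 x + w x * P1 x) ^ 2.
Definition magnetic x := 4 * f x * P1 x ^ 2.

Lemma adapted_einstein p : exterior r p -> einstein_maxwell_at g Apot p ->
  let x := p CR in
  let R := - Ric00 x / f x + 4 * f x * A x * Ric11 x + 2 * Ric22 x / B x + Ric44 x / A x in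
  let F2 := field_sq x in
  Ric00 x / f x + / 2 * R = 2 * (electric x + / 4 * F2) /\
  4 * f x * A x * Ric11 x - / 2 * R = 2 * (magnetic x - electric x - / 4 * F2) /\
  Ric22 x / B x - / 2 * R = 2 * (4 * P x ^ 2 / B x ^ 2 - / 4 * F2) /\
  Ric44 x / A x - / 2 * R = 2 * (magnetic x - / 4 * F2) /\
  Ric04 x = 8 * f x * A x * (a1 x + w x * P1 x) * P1 x.
Proof.
  intros Hp HE x R F2; destruct (sin_cos_exterior p Hp) as [Hs [Hc Hsc]].
  pose proof (Rgt_not_eq _ _ (f_pos _ (proj1 Hp))) as Hf;
    pose proof (Rgt_not_eq _ _ (A_pos _ (proj1 Hp))) as HA;
    pose proof (Rgt_not_eq _ _ (B_pos _ (proj1 Hp))) as HB.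
  assert (H : forall b c,
    ricci_frame adapted_frame adapted_coframe adapted_connection b c p
    - / 2 * scalar_curvature g p * (adapted_norm b p * delta b c)
    = 2 * stress_energy_frame adapted_frame adapted_norm Apot b c p).
  { intros b c; apply (einstein_frame (exterior r)); cartan_side. }
  rewrite (adapted_scalar_curvature p Hp) in H; fold x R in H.
  unfold stress_energy_frame in H.
  rewrite (adapted_field_square p Hp) in H; fold x F2 in H.
  change (f x <> 0) in Hf; change (A x <> 0) in HA; change (B x <> 0) in HB.
  pose proof (H Ct Ct) as H00; pose proof (H CR CR) as H11;
    pose proof (H Cth Cth) as H22; pose proof (H Cps Cps) as H44;
    pose proof (H Ct Cps) as H04.
  rewrite adapted_ricciE in H00, H11, H22, H44, H04 by exact Hp.
  unfold sumc in H00, H11, H22, H44, H04.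
  rewrite !adapted_field_frame in H00 by exact Hp.
  rewrite !adapted_field_frame in H11 by exact Hp.
  rewrite !adapted_field_frame in H22 by exact Hp.
  rewrite !adapted_field_frame in H44 by exact Hp.
  rewrite !adapted_field_frame in H04 by exact Hp.
  unfold adapted_norm, delta in H00, H11, H22, H44, H04;
    cbn -[pow] in H00, H11, H22, H44, H04; fold x in H00, H11, H22, H44, H04.
  unfold electric, magnetic; clearbody R F2.
  repeat split.
  - apply (Rmult_eq_reg_l (f x)); [|exact Hf].
    transitivity (Ric00 x - / 2 * R * (- f x * 1)); [field; exact Hf|].
    rewrite H00; field; repeat split; assumption.
  - apply (Rmult_eq_reg_l (/ (4 * (f x * A x)))).
    2:{ apply Rinv_neq_0_compat; repeat apply Rmult_integral_contrapositive_currified; lra. }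
    transitivity (Ric11 x - / 2 * R * (/ (4 * (f x * A x)) * 1));
      [field; repeat split; assumption|].
    rewrite H11; field; repeat split; assumption.
  - apply (Rmult_eq_reg_l (B x)); [|exact HB].
    transitivity (Ric22 x - / 2 * R * (B x * 1)); [field; exact HB|].
    rewrite H22; field; repeat split; assumption.
  - apply (Rmult_eq_reg_l (A x)); [|exact HA].
    transitivity (Ric44 x - / 2 * R * (A x * 1)); [field; exact HA|].
    rewrite H44; field; repeat split; assumption.
  - transitivity (Ric04 x - / 2 * R * (- f x * 0)); [ring|].
    rewrite H04; field; repeat split; assumption.
Qed.

(** * Orthonormal components and the type II condition *)

Definition unit_norm (p : point) (i : coord) : R :=
  match i with
  | Ct => sqrt (f (p CR))
  | CR => / (2 * sqrt (f (p CR)) * sqrt (A (p CR)))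
  | Cth => sqrt (B (p CR))
  | Cph => sqrt (B (p CR)) * (sin (p Cth) * cos (p Cth))
  | Cps => sqrt (A (p CR))
  end.

Definition unit_weyl (p : point) (b c d e : coord) : R :=
  weyl_frame g adapted_frame adapted_coframe adapted_norm adapted_connection b c d e p
  / (unit_norm p b * unit_norm p c * unit_norm p d * unit_norm p e).

Lemma unit_norm_neq_0 p i : exterior r p -> unit_norm p i <> 0.
Proof.
  intros Hp; destruct (sin_cos_exterior p Hp) as [Hs [Hc _]].
  pose proof (Rgt_not_eq _ _ (sqrt_lt_R0 _ (f_pos _ (proj1 Hp)))).
  pose proof (Rgt_not_eq _ _ (sqrt_lt_R0 _ (A_pos _ (proj1 Hp)))).
  pose proof (Rgt_not_eq _ _ (sqrt_lt_R0 _ (B_pos _ (proj1 Hp)))).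
  destruct i; cbn; try apply Rinv_neq_0_compat;
    repeat apply Rmult_integral_contrapositive_currified; try assumption; lra.
Qed.

Lemma unit_norm_sq p i : exterior r p ->
  adapted_norm i p = (if coord_eq_dec i Ct then -1 else 1) * unit_norm p i ^ 2.
Proof.
  intros Hp; destruct (sin_cos_exterior p Hp) as [Hs [Hc _]].
  pose proof (sqrt_lt_R0 _ (f_pos _ (proj1 Hp))).
  pose proof (sqrt_lt_R0 _ (A_pos _ (proj1 Hp))).
  pose proof (pow2_sqrt _ (Rlt_le _ _ (f_pos _ (proj1 Hp)))) as E1.
  pose proof (pow2_sqrt _ (Rlt_le _ _ (A_pos _ (proj1 Hp)))) as E2.
  pose proof (pow2_sqrt _ (Rlt_le _ _ (B_pos _ (proj1 Hp)))) as E3.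
  destruct i; cbn -[pow].
  - rewrite E1; ring.
  - rewrite <- E1 at 1; rewrite <- E2 at 1; field; split; lra.
  - rewrite E3; ring.
  - rewrite <- E3 at 1; ring.
  - rewrite E2; ring.
Qed.

(** The normalization of e_3 absorbs every power of sin cos, which makes the rotation invariance
    visible. In X and Y the four indices are distinct, so each metric factor of the trace part
    vanishes. *)
Lemma unit_weyl_isotropic p : exterior r p ->
  let x := p CR in
  let A0 := K0202 x / (f x * B x) - / 3 * (Ric00 x / f x - Ric22 x / B x)
            - / 12 * scalar_curvature g p in
  let A1 := 4 * f x * A x * K1212 x / B x
            - / 3 * (Ric22 x / B x + 4 * f x * A x * Ric11 x)
            + / 12 * scalar_curvature g p in
  let A4 := K4242 x / (A x * B x) - / 3 * (Ric22 x / B x + Ric44 x / A x)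
            + / 12 * scalar_curvature g p in
  isotropic_weyl (unit_weyl p) A0 A1 A4
    ((K0242 x / B x - / 3 * Ric04 x) / (sqrt (f x) * sqrt (A x)))
    (K2323 x / B x ^ 2 - / 3 * (2 * Ric22 x / B x) + / 12 * scalar_curvature g p)
    (2 * K0123 x * sqrt (A x) / B x) (2 * K1423 x * sqrt (f x) / B x).
Proof.
  intros Hp x A0 A1' A4.
  destruct (sin_cos_exterior p Hp) as [Hs [Hc _]].
  pose proof (sqrt_lt_R0 _ (f_pos _ (proj1 Hp))) as Hf.
  pose proof (sqrt_lt_R0 _ (A_pos _ (proj1 Hp))) as HA.
  pose proof (sqrt_lt_R0 _ (B_pos _ (proj1 Hp))) as HB.
  pose proof (pow2_sqrt _ (Rlt_le _ _ (f_pos _ (proj1 Hp)))) as E1.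
  pose proof (pow2_sqrt _ (Rlt_le _ _ (A_pos _ (proj1 Hp)))) as E2.
  pose proof (pow2_sqrt _ (Rlt_le _ _ (B_pos _ (proj1 Hp)))) as E3.
  set (tau := sin (p Cth) * cos (p Cth)).
  set (Ric := fun b d => ricci_frame adapted_frame adapted_coframe adapted_connection b d p).
  assert (HW : forall b c d e, unit_weyl p b c d e =
    (riemann_table (tau ^ 2) (K0101 x) (K0404 x) (K1414 x) (K0114 x) (K0202 x)
       (K1212 x) (K4242 x) (K0242 x) (tau ^ 2 * K2323 x) (tau * K0123 x)
       (tau * K1423 x) b c d e
     - / 3 * (adapted_norm b p * delta b d * Ric e c
              - adapted_norm b p * delta b e * Ric d c
              - adapted_norm c p * delta c d * Ric e b
              + adapted_norm c p * delta c e * Ric d b)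
     + / 12 * scalar_curvature g p
       * (adapted_norm b p * delta b d * (adapted_norm e p * delta e c)
          - adapted_norm b p * delta b e * (adapted_norm d p * delta d c)))
    / (unit_norm p b * unit_norm p c * unit_norm p d * unit_norm p e)).
  { intros b c d e; unfold unit_weyl, weyl_frame.
    rewrite adapted_curvatureE, adapted_riemannE by exact Hp; reflexivity. }
  assert (HR := fun b d => adapted_ricciE b d p Hp : Ric b d = _);
    cbv zeta in HR; fold x tau in HR; clearbody Ric.
  unfold A0, A1', A4; set (Rs := scalar_curvature g p) in *; clearbody Rs.
  change (sqrt (f x) ^ 2 = f x) in E1; change (sqrt (A x) ^ 2 = A x) in E2;
    change (sqrt (B x) ^ 2 = B x) in E3.
  change (0 < sqrt (f x)) in Hf; change (0 < sqrt (A x)) in HA;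
    change (0 < sqrt (B x)) in HB.
  assert (Ht : tau <> 0) by (apply Rmult_integral_contrapositive; auto).
  split; intros b c d; rewrite HW; rewrite !HR; unfold adapted_norm, unit_norm;
    fold x tau; rewrite <- E1, <- E2, <- E3; unfold riemann_table; clearbody tau;
    rewrite ?sqrt_pow2 by lra;
    destruct b, c, d; unfold delta; cbn -[pow];
    field; repeat split; lra.
Qed.

Lemma weyl_frame_antisym b c d e p : exterior r p ->
  weyl_frame g adapted_frame adapted_coframe adapted_norm adapted_connection b c e d p
  = - weyl_frame g adapted_frame adapted_coframe adapted_norm adapted_connection b c d e p.
Proof.
  intros Hp; unfold weyl_frame; rewrite !adapted_curvatureE by exact Hp.
  assert (E : adapted_curvature b c e d p = - adapted_curvature b c d e p).
  { unfold adapted_curvature, sumc; destruct d, e; ring. }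
  rewrite E; ring.
Qed.

(** In A0 + A1 and in A4 - A1 the scalar curvature and [Ric22] cancel. The Ricci combinations left
    are Ric_00 + Ric_11 and Ric_44 - Ric_11 in orthonormal components, which the Einstein equations
    identify with twice the magnetic and twice the electric term. *)
Lemma adapted_type_II p (l : vec) : exterior r p ->
  einstein_maxwell_at g Apot p ->
  (exists i, l i <> 0) -> is_null g p l -> bel_debever g p l ->
  let x := p CR in
  f x * K1423 x ^ 2 < A x * K0123 x ^ 2 ->
  (K0202 x / (f x * B x) + 4 * f x * A x * K1212 x / B x - 2 / 3 * magnetic x)
    * K0123 x + (K0242 x / B x - / 3 * Ric04 x) / A x * K1423 x = 0 /\
  (K4242 x / (A x * B x) - 4 * f x * A x * K1212 x / B x - 2 / 3 * electric x)
    * K1423 x + (K0242 x / B x - / 3 * Ric04 x) / f x * K0123 x = 0.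
Proof.
  intros Hp HE Hl Hnull HBD x HXY.
  set (lam := fun b => sumc (fun i => adapted_coframe b i p * l i)).
  assert (Hlam : forall i, l i = frame_vector adapted_frame p lam i).
  { intros i; rewrite <- (sumc_delta_l i l); unfold frame_vector, lam.
    rewrite (sumc_ext _ (fun j => sumc (fun b =>
      adapted_coframe b j p * l j * adapted_frame b i p))).
    2:{ intros j; rewrite <- (adapted_frame_coframe p i j Hp), sumc_mult_r.
        apply sumc_ext; intros; ring. }
    rewrite sumc_swap; apply sumc_ext; intros b; rewrite sumc_mult_r; reflexivity. }
  set (u := fun b => unit_norm p b * lam b).
  assert (HL : forall i, lower g p l i
    = sumc (fun b => adapted_norm b p * lam b * adapted_coframe b i p)).
  { intros i; unfold lower.
    rewrite (sumc_ext _ (fun j => sumc (fun b => lam b *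
      (g i j p * adapted_frame b j p)))).
    2:{ intros j; rewrite Hlam; unfold frame_vector; rewrite sumc_mult_l.
        apply sumc_ext; intros; ring. }
    rewrite sumc_swap; apply sumc_ext; intros b.
    rewrite <- sumc_mult_l, lower_adapted_frame by exact Hp; ring. }
  set (vec_of := fun y : vec => frame_vector adapted_frame p (fun b => y b / unit_norm p b)).
  assert (HLv : forall y, sumc (fun i => vec_of y i * lower g p l i) = minkowski y u).
  { intros y; unfold vec_of; rewrite sumc_frame_vector.
    rewrite (sumc_ext _ (fun b => y b / unit_norm p b * (adapted_norm b p * lam b))).
    2:{ intros b; f_equal; unfold comp1.
        rewrite (sumc_ext _ (fun i => sumc (fun c => adapted_norm c p * lam c *
          (adapted_coframe c i p * adapted_frame b i p)))).
        2:{ intros i; rewrite HL, sumc_mult_l; apply sumc_ext; intros; ring. }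
        rewrite sumc_swap, (sumc_ext _ (fun c => adapted_norm c p * lam c * delta c b)).
        - apply (sumc_delta_r b (fun c => adapted_norm c p * lam c)).
        - intros c; rewrite <- sumc_mult_l, adapted_coframe_frame by exact Hp.
          reflexivity. }
    unfold sumc, minkowski, u; rewrite !unit_norm_sq by exact Hp.
    pose proof (fun i => unit_norm_neq_0 p i Hp) as Hn; cbn -[unit_norm pow].
    field; repeat split; apply Hn. }
  assert (Hlu : forall i, l i = vec_of u i).
  { intros i; rewrite Hlam; unfold vec_of, frame_vector, u; apply sumc_ext; intros b.
    f_equal; field; apply unit_norm_neq_0, Hp. }
  assert (Hu0 : minkowski u u = 0).
  { rewrite <- HLv, <- Hnull; unfold lower; apply sumc_ext; intros i.
    rewrite <- Hlu, sumc_mult_l; apply sumc_ext; intros; ring. }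
  assert (Hu : exists i, u i <> 0).
  { destruct (Req_dec (u Ct) 0) as [E0|E0]; [|exists Ct; exact E0].
    destruct (Req_dec (u CR) 0) as [E1|E1]; [|exists CR; exact E1].
    destruct (Req_dec (u Cth) 0) as [E2|E2]; [|exists Cth; exact E2].
    destruct (Req_dec (u Cph) 0) as [E3|E3]; [|exists Cph; exact E3].
    destruct (Req_dec (u Cps) 0) as [E4|E4]; [|exists Cps; exact E4].
    destruct Hl as [i Hi]; exfalso; apply Hi; rewrite Hlu.
    apply sumc_zero; intros b; destruct b;
      rewrite ?E0, ?E1, ?E2, ?E3, ?E4; unfold Rdiv; ring. }
  assert (Hut : u Ct <> 0).
  { intros E; unfold minkowski in Hu0; rewrite E in Hu0.
    destruct Hu as [i Hi]; apply Hi; destruct i; try exact E; nra. }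
  assert (HW : forall y1 y2 y3, minkowski y1 u = 0 -> minkowski y2 u = 0 ->
    minkowski y3 u = 0 -> eval4 (unit_weyl p) y1 u y2 y3 = 0).
  { assert (HF : forall y1 y2 y3, eval4 (fun i j k m => weyl g i j k m p)
        (vec_of y1) l (vec_of y2) (vec_of y3) = eval4 (unit_weyl p) y1 u y2 y3).
    { intros y1 y2 y3.
      transitivity (eval4 (fun i j k m => weyl g i j k m p)
        (vec_of y1) (vec_of u) (vec_of y2) (vec_of y3)).
      { unfold eval4; apply sumc_ext; intros a'; f_equal.
        apply sumc_ext; intros b'; f_equal; apply sumc_ext; intros c'; f_equal.
        apply sumc_ext; intros d'; rewrite Hlu; reflexivity. }
      unfold vec_of; rewrite eval4_frame_vector; unfold eval4.
      pose proof (fun i => unit_norm_neq_0 p i Hp) as Hn.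
      apply sumc_ext; intros a'; rewrite !sumc_mult_l; apply sumc_ext; intros c'.
      rewrite !sumc_mult_l; apply sumc_ext; intros d'.
      rewrite !sumc_mult_l; apply sumc_ext; intros b'.
      rewrite (comp4_weyl (exterior r) g adapted_frame adapted_coframe adapted_norm
        adapted_connection) by cartan_side.
      unfold unit_weyl; field; repeat split; apply Hn. }
    intros y1 y2 y3 H1 H2 H3.
    (* The unit vector along e_0 serves as the vector not orthogonal to l: a nonzero null vector has
       a nonzero time component. *)
    pose proof (bel_debever_contract (lower g p l) (fun i j k m => weyl g i j k m p)
      l (vec_of (vec5 1 0 0 0 0)) (vec_of y1) (vec_of y2) (vec_of y3)) as H.
    rewrite !HLv in H; rewrite !HF in H.
    specialize (H HBD).
    assert (N : minkowski (vec5 1 0 0 0 0) u <> 0).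
    { unfold minkowski; simpl; lra. }
    specialize (H N H1 H2 H3).
    assert (HA : eval4 (unit_weyl p) y1 u y3 y2 = - eval4 (unit_weyl p) y1 u y2 y3).
    { replace (- eval4 (unit_weyl p) y1 u y2 y3)
        with (-1 * eval4 (unit_weyl p) y1 u y2 y3) by ring.
      unfold eval4; rewrite sumc_mult_l; apply sumc_ext; intros a'.
      rewrite (sumc_ext _ (fun c => sumc (fun d => y3 c * (y2 d *
        sumc (fun b => u b * unit_weyl p a' b c d))))).
      2:{ intros; apply sumc_mult_l. }
      rewrite sumc_swap, !sumc_mult_l; apply sumc_ext; intros c'.
      rewrite !sumc_mult_l; apply sumc_ext; intros d'.
      rewrite !sumc_mult_l; apply sumc_ext; intros b'.
      unfold unit_weyl; rewrite (weyl_frame_antisym a' b' c' d' p Hp).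
      field; repeat split; apply (fun i => unit_norm_neq_0 p i Hp). }
    lra. }
  pose proof (f_pos _ (proj1 Hp)) as Hf; pose proof (A_pos _ (proj1 Hp)) as HA;
    pose proof (B_pos _ (proj1 Hp)) as HB.
  change (0 < f x) in Hf; change (0 < A x) in HA; change (0 < B x) in HB.
  pose proof (sqrt_lt_R0 _ Hf) as Hf'; pose proof (sqrt_lt_R0 _ HA) as HA'.
  pose proof (pow2_sqrt _ (Rlt_le _ _ Hf)) as E1.
  pose proof (pow2_sqrt _ (Rlt_le _ _ HA)) as E2.
  pose proof (isotropic_type_II _ _ _ _ _ _ _ _ u (unit_weyl_isotropic p Hp) Hu0 Hu HW) as HT.
  cbv zeta in HT; fold x in HT.
  assert (HXY' : (2 * K1423 x * sqrt (f x) / B x) ^ 2 < (2 * K0123 x * sqrt (A x) / B x) ^ 2).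
  { replace ((2 * K1423 x * sqrt (f x) / B x) ^ 2)
      with (4 / B x ^ 2 * (sqrt (f x) ^ 2 * K1423 x ^ 2)) by (field; lra).
    replace ((2 * K0123 x * sqrt (A x) / B x) ^ 2)
      with (4 / B x ^ 2 * (sqrt (A x) ^ 2 * K0123 x ^ 2)) by (field; lra).
    rewrite E1, E2; apply Rmult_lt_compat_l; [|exact HXY].
    apply Rdiv_lt_0_compat; [lra|apply pow_lt; exact HB]. }
  destruct (HT HXY') as [T1 T2]; clear HT.
  destruct (adapted_einstein p Hp HE) as [G0 [G1 [_ [G4 _]]]]; fold x in G0, G1, G4.
  set (Rs := - Ric00 x / f x + _ + _ + _) in G0, G1, G4.
  split.
  - assert (Q : Ric00 x / f x + 4 * f x * A x * Ric11 x = 2 * magnetic x) by lra.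
    apply (Rmult_eq_reg_l (2 * sqrt (A x) / B x)).
    2:{ apply Rgt_not_eq; apply Rdiv_lt_0_compat; lra. }
    rewrite Rmult_0_r; rewrite <- T1.
    replace (2 / 3 * magnetic x) with (/ 3 * (2 * magnetic x)) by field.
    rewrite <- Q; rewrite <- E1, <- E2, ?sqrt_pow2 by lra; field; lra.
  - assert (Q : Ric44 x / A x - 4 * f x * A x * Ric11 x = 2 * electric x) by lra.
    apply (Rmult_eq_reg_l (2 * sqrt (f x) / B x)).
    2:{ apply Rgt_not_eq; apply Rdiv_lt_0_compat; lra. }
    rewrite Rmult_0_r; rewrite <- T2.
    replace (2 / 3 * electric x) with (/ 3 * (2 * electric x)) by field.
    rewrite <- Q; rewrite <- E1, <- E2, ?sqrt_pow2 by lra; field; lra.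
Qed.

End Adapted.


(** * The reduced equations *)

Section Reduced.

Context (rp2 rm2 : R) (f f1 f2 m m1 m2 w w1 w2 a a1 P P1 : R -> R).

Definition horizon_poly (x : R) : R := (x - rp2) * (x - rm2).
Definition horizon_poly1 (x : R) : R := 2 * x - rp2 - rm2.

(** The squared length of the Hopf fibre generator d_phi + d_psi; [base_norm] is the scale of the
    2-sphere below it. They instantiate [A] and [B] of the adapted frame. *)
Definition fibre_norm x := horizon_poly x / m x.
Definition fibre_norm1 x := (horizon_poly1 x * m x - horizon_poly x * m1 x) / m x ^ 2.
Definition fibre_norm2 x := (2 * m x - horizon_poly x * m2 x) / m x ^ 2
  - 2 * (horizon_poly1 x * m x - horizon_poly x * m1 x) * m1 x / m x ^ 3.
Definition base_norm x := m x / f x.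
Definition base_norm1 x := (m1 x * f x - m x * f1 x) / f x ^ 2.
Definition base_norm2 x := (m2 x * f x - m x * f2 x) / f x ^ 2
  - 2 * (m1 x * f x - m x * f1 x) * f1 x / f x ^ 3.

(* Logarithmic derivatives are taken with respect to N d/dR, R-derivatives are
   marked by a suffix 1 or 2, and [twist] and [flux] are the momenta conjugate to
   varpi and a_0. *)
Definition dlog_f x := horizon_poly x * f1 x / f x.
Definition dlog_m x := horizon_poly x * m1 x / m x.
Definition dlog_f1 x := (horizon_poly1 x * f1 x + horizon_poly x * f2 x) / f x - horizon_poly x * f1 x ^ 2 / f x ^ 2.
Definition dlog_m1 x := (horizon_poly1 x * m1 x + horizon_poly x * m2 x) / m x - horizon_poly x * m1 x ^ 2 / m x ^ 2.
Definition twist x := horizon_poly x ^ 2 * w1 x / (f x * m x).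
Definition twist1 x := (2 * horizon_poly x * horizon_poly1 x * w1 x + horizon_poly x ^ 2 * w2 x) / (f x * m x)
  - horizon_poly x ^ 2 * w1 x * (f1 x * m x + f x * m1 x) / (f x * m x) ^ 2.
Definition flux x := horizon_poly x * (a1 x + w x * P1 x) / f x.
Definition dlog_base x := dlog_m x - dlog_f x.
(** N times the logarithmic derivative of A / B = N f / m^2, the squashing of the 3-sphere; A / B
    tends to 1 at infinity. *)
Definition dlog_squash x := horizon_poly1 x + dlog_f x - 2 * dlog_m x.

Definition rotation_term x := twist x ^ 2 * f x * m x / horizon_poly x.
Definition electric_term x := 4 / 3 * flux x ^ 2 * f x.
Definition radial_term x := 4 / 3 * m x * horizon_poly x * P1 x ^ 2.
Definition angular_term x := 4 / 3 * P x ^ 2 * f x * horizon_poly x / m x.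
Definition squash_term x := horizon_poly x ^ 2 * f x / m x ^ 2.

Definition reduced_equations x : Prop :=
  horizon_poly x * dlog_f1 x = angular_term x + radial_term x + rotation_term x + 2 * electric_term x /\
  horizon_poly x * dlog_m1 x = 2 * horizon_poly x - squash_term x - angular_term x + 2 * radial_term x + rotation_term x + electric_term x /\
  twist1 x = 4 * flux x * P1 x /\
  dlog_squash x * (dlog_f x + 2 * dlog_base x) + 3 * dlog_base x * dlog_m x
    = 4 * horizon_poly x - squash_term x - 3 * angular_term x - rotation_term x - 3 * electric_term x + 3 * radial_term x.

Definition type_II_equations x : Prop :=
  twist x * (squash_term x - (dlog_squash x + dlog_base x) * dlog_m x + angular_term x - radial_term x - electric_term x - rotation_term x)
    + (twist x * dlog_base x - 8 / 3 * flux x * horizon_poly x * P1 x) * dlog_squash x = 0 /\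
  twist x * f x * m x / horizon_poly x * (twist x * dlog_base x - 8 / 3 * flux x * horizon_poly x * P1 x)
    = dlog_squash x * (- dlog_f x * (dlog_squash x + 2 * dlog_base x) + angular_term x + radial_term x + electric_term x - rotation_term x).

Context (x : R).
Context (Hf : 0 < f x) (Hm : 0 < m x) (HN : 0 < horizon_poly x).

Let R00 := Ric00 f f1 f2 fibre_norm fibre_norm1 base_norm base_norm1 w1 x.
Let R11 := Ric11 f f1 f2 fibre_norm fibre_norm1 fibre_norm2 base_norm base_norm1 base_norm2 w1 x.
Let R22 := Ric22 f f1 fibre_norm fibre_norm1 base_norm base_norm1 base_norm2 x.
Let R44 := Ric44 f f1 fibre_norm fibre_norm1 fibre_norm2 base_norm base_norm1 w1 x.
Let R04 := Ric04 f fibre_norm fibre_norm1 base_norm base_norm1 w1 w2 x.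
Let Rs := - R00 / f x + 4 * f x * fibre_norm x * R11 + 2 * R22 / base_norm x + R44 / fibre_norm x.
Let F2 := field_sq f fibre_norm base_norm w a1 P P1 x.
Let El := electric fibre_norm w a1 P1 x.
Let Mg := magnetic f P1 x.

Context (G0 : R00 / f x + / 2 * Rs = 2 * (El + / 4 * F2)).
Context (G1 : 4 * f x * fibre_norm x * R11 - / 2 * Rs = 2 * (Mg - El - / 4 * F2)).
Context (G2 : R22 / base_norm x - / 2 * Rs = 2 * (4 * P x ^ 2 / base_norm x ^ 2 - / 4 * F2)).
Context (G4 : R44 / fibre_norm x - / 2 * Rs = 2 * (Mg - / 4 * F2)).
Context (G04 : R04 = 8 * f x * fibre_norm x * (a1 x + w x * P1 x) * P1 x).

Ltac reduce_tac :=
  unfold Rs, R00, R11, R22, R44, R04, F2, El, Mg, Ric00, Ric11, Ric22, Ric44, Ric04,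
    field_sq, electric, magnetic,
    K0101, K0404, K1414, K0114, K0202, K1212, K4242, K0242, K2323, K0123, K1423,
    squash_term, angular_term, radial_term, electric_term, rotation_term, dlog_squash, dlog_base, flux, twist1, twist, dlog_m1, dlog_f1, dlog_m, dlog_f, base_norm2, base_norm1, base_norm, fibre_norm2, fibre_norm1, fibre_norm;
  generalize dependent (horizon_poly x); generalize (horizon_poly1 x) as N1; intros N1 N;
  intros; field; repeat split; apply Rgt_not_eq; assumption.

(** The trace of the Einstein equations. In dimension 5 the trace of T is - F^2 / 4, so - 3/2 R = -
    F^2 / 2; the equation G2 counts twice, for theta and for U. *)
Lemma scalar_trace : Rs = F2 / 3.
Proof.
  assert (E : F2 = 2 * (Mg - El + 4 * P x ^ 2 / base_norm x ^ 2)).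
  { unfold F2, Mg, El, field_sq, magnetic, electric, base_norm; field; split; lra. }
  assert (- R00 / f x = - (R00 / f x)) by (field; lra).
  assert (2 * R22 / base_norm x = 2 * (R22 / base_norm x)).
  { unfold Rdiv; ring. }
  unfold Rs in *; lra.
Qed.

(** The time component in trace-reversed form; [dlog_m_equation] is the same for the fibre
    direction. *)
Lemma dlog_f_equation : horizon_poly x * dlog_f1 x = angular_term x + radial_term x + rotation_term x + 2 * electric_term x.
Proof.
  assert (E : R00 / f x - 2 * El - F2 / 3 = 0) by (pose proof scalar_trace; lra).
  apply Rminus_diag_uniq.
  transitivity (horizon_poly x * base_norm x / 2 * (R00 / f x - 2 * El - F2 / 3)); [|rewrite E; ring].
  clear G0 G1 G2 G4 G04 E; reduce_tac.
Qed.

Lemma dlog_m_equation :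
  horizon_poly x * dlog_m1 x = 2 * horizon_poly x - squash_term x - angular_term x + 2 * radial_term x + rotation_term x + electric_term x.
Proof.
  assert (E : R44 / fibre_norm x - 2 * Mg + F2 / 3 = 0) by (pose proof scalar_trace; lra).
  apply Rminus_diag_uniq.
  transitivity (horizon_poly x * base_norm x / 2 * (R44 / fibre_norm x - 2 * Mg + F2 / 3)); [|rewrite E; ring].
  clear G0 G1 G2 G4 G04 E; reduce_tac.
Qed.

(** The off-diagonal Einstein equation: w enters through the derivative of its conjugate
    momentum. *)
Lemma twist_equation : twist1 x = 4 * flux x * P1 x.
Proof.
  apply Rminus_diag_uniq.
  transitivity (base_norm x / (2 * f x) * (R04 - 8 * f x * fibre_norm x * (a1 x + w x * P1 x) * P1 x));
    [|rewrite G04; ring].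
  clear G0 G1 G2 G4 G04; reduce_tac.
Qed.

(** The radial component of the Einstein tensor contains no second derivatives: this is the
    constraint of the evolution in R. *)
Lemma constraint_equation :
  dlog_squash x * (dlog_f x + 2 * dlog_base x) + 3 * dlog_base x * dlog_m x
    = 4 * horizon_poly x - squash_term x - 3 * angular_term x - rotation_term x - 3 * electric_term x + 3 * radial_term x.
Proof.
  apply Rminus_diag_uniq.
  transitivity (horizon_poly x * base_norm x *
    (4 * f x * fibre_norm x * R11 - / 2 * Rs - 2 * (Mg - El - / 4 * F2))); [|rewrite G1; ring].
  clear G0 G1 G2 G4 G04; reduce_tac.
Qed.

Context (G_II :
  (K0202 f f1 fibre_norm base_norm1 x / (f x * base_norm x) + 4 * f x * fibre_norm x * K1212 f f1 fibre_norm fibre_norm1 base_norm base_norm1 base_norm2 x / base_norm x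
     - 2 / 3 * Mg) * K0123 fibre_norm w1 x
  + (K0242 f fibre_norm base_norm1 w1 x / base_norm x - / 3 * R04) / fibre_norm x * K1423 fibre_norm fibre_norm1 base_norm base_norm1 x = 0 /\
  (K4242 f fibre_norm fibre_norm1 base_norm base_norm1 x / (fibre_norm x * base_norm x)
     - 4 * f x * fibre_norm x * K1212 f f1 fibre_norm fibre_norm1 base_norm base_norm1 base_norm2 x / base_norm x - 2 / 3 * El)
     * K1423 fibre_norm fibre_norm1 base_norm base_norm1 x
  + (K0242 f fibre_norm base_norm1 w1 x / base_norm x - / 3 * R04) / f x * K0123 fibre_norm w1 x = 0).

(** The type II equations contain second derivatives only through [K1212], that is, through
    [dlog_m1] and [dlog_f1] (S1 and S2). The evolution equations replace these by first-order terms,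
    and the constraint brings the result to the stated form. *)
Lemma type_II_equations_hold : type_II_equations x.
Proof.
  destruct G_II as [T1 T2]; rewrite G04 in T1, T2.
  pose proof dlog_f_equation as Ea; pose proof dlog_m_equation as Em;
    pose proof constraint_equation as Ec.
  clear G_II.
  assert (S1 : twist x * (- 2 * (horizon_poly x * dlog_m1 x - horizon_poly x * dlog_f1 x - horizon_poly1 x * dlog_base x)
      - dlog_base x * (horizon_poly1 x - dlog_f x) - 2 * radial_term x)
    + (twist x * dlog_base x - 8 / 3 * flux x * horizon_poly x * P1 x) * dlog_squash x = 0).
  { transitivity (- (m x * horizon_poly x ^ 2 / f x ^ 2) * 0); [|ring]; rewrite <- T1.
    clear G0 G1 G2 G4 G04 T1 T2 Ea Em Ec; reduce_tac. }
  assert (S2 : twist x * f x * m x / horizon_poly x * (twist x * dlog_base x - 8 / 3 * flux x * horizon_poly x * P1 x)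
    = dlog_squash x * (- 2 * (horizon_poly x * dlog_m1 x - horizon_poly x * dlog_f1 x - horizon_poly1 x * dlog_base x)
      - dlog_m x * dlog_base x - squash_term x + 2 * electric_term x)).
  { apply Rminus_diag_uniq.
    transitivity (- (m x ^ 2 * horizon_poly x / f x) * 0); [|ring]; rewrite <- T2.
    clear G0 G1 G2 G4 G04 T1 T2 Ea Em Ec S1; reduce_tac. }
  (* N' and [dlog_m] are eliminated, so that S1, S2 and Ec are polynomials in the same quantities
     and differ linearly. *)
  assert (E1 : horizon_poly1 x = dlog_squash x - dlog_f x + 2 * dlog_m x) by (unfold dlog_squash; ring).
  assert (E2 : dlog_m x = dlog_f x + dlog_base x) by (unfold dlog_base; ring).
  rewrite Ea, Em, E1 in S1, S2; rewrite E2 in S1, S2, Ec.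
  unfold type_II_equations; rewrite E2; split.
  - rewrite <- S1; f_equal; f_equal; lra.
  - rewrite S2; f_equal; lra.
Qed.

End Reduced.


(** * The reduced equations for a black hole *)

Lemma smooth_on_derive D h x : smooth_on D h -> D x -> is_derive h x (Derive h x).
Proof. intros H Hx; apply Derive_correct, (H 1%nat x Hx). Qed.

Lemma smooth_on_derive2 D h x : smooth_on D h -> D x ->
  is_derive (Derive h) x (Derive (Derive h) x).
Proof. intros H Hx; apply Derive_correct, (H 2%nat x Hx). Qed.

Lemma is_derive_eq (h : R -> R) x u v : is_derive h x u -> u = v -> is_derive h x v.
Proof. intros H <-; exact H. Qed.

Section BlackHole.

Context (b : profile) (rp2 rm2 M J Q : R).
Context (bh : charged_rotating_black_hole b rp2 rm2 M J Q).

Let f := pf_f b.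
Let m := pf_m b.
Let w := pf_varpi b.
Let a := pf_a0 b.
Let P := pf_aphi b.
Let N := horizon_poly rp2 rm2.
Let f1 := Derive f.
Let f2 := Derive f1.
Let m1 := Derive m.
Let m2 := Derive m1.
Let w1 := Derive w.
Let w2 := Derive w1.
Let a1 := Derive a.
Let P1 := Derive P.

Lemma bh_f_pos x : rp2 < x -> 0 < f x.
Proof. apply (bh_positive _ _ _ _ _ _ bh). Qed.

Lemma bh_m_pos x : rp2 < x -> 0 < m x.
Proof. apply (bh_positive _ _ _ _ _ _ bh). Qed.

Lemma bh_N_pos x : rp2 < x -> 0 < N x.
Proof.
  intros Hx; unfold N, horizon_poly; rewrite <- (bh_N _ _ _ _ _ _ bh x Hx).
  apply (bh_positive _ _ _ _ _ _ bh), Hx.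
Qed.

Lemma bh_df x : rp2 < x -> is_derive f x (f1 x).
Proof. apply (smooth_on_derive _ f x (bh_smooth_f _ _ _ _ _ _ bh)). Qed.

Lemma bh_df1 x : rp2 < x -> is_derive f1 x (f2 x).
Proof. apply (smooth_on_derive2 _ f x (bh_smooth_f _ _ _ _ _ _ bh)). Qed.

Lemma bh_dm x : rp2 < x -> is_derive m x (m1 x).
Proof. apply (smooth_on_derive _ m x (bh_smooth_m _ _ _ _ _ _ bh)). Qed.

Lemma bh_dm1 x : rp2 < x -> is_derive m1 x (m2 x).
Proof. apply (smooth_on_derive2 _ m x (bh_smooth_m _ _ _ _ _ _ bh)). Qed.

Lemma bh_dw x : rp2 < x -> is_derive w x (w1 x).
Proof. apply (smooth_on_derive _ w x (bh_smooth_varpi _ _ _ _ _ _ bh)). Qed.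

Lemma bh_dw1 x : rp2 < x -> is_derive w1 x (w2 x).
Proof. apply (smooth_on_derive2 _ w x (bh_smooth_varpi _ _ _ _ _ _ bh)). Qed.

Lemma bh_da x : rp2 < x -> is_derive a x (a1 x).
Proof. apply (smooth_on_derive _ a x (bh_smooth_a0 _ _ _ _ _ _ bh)). Qed.

Lemma bh_dP x : rp2 < x -> is_derive P x (P1 x).
Proof. apply (smooth_on_derive _ P x (bh_smooth_aphi _ _ _ _ _ _ bh)). Qed.

Lemma bh_dN x : is_derive N x (horizon_poly1 rp2 rm2 x).
Proof. unfold N, horizon_poly, horizon_poly1; auto_derive; [exact I|ring]. Qed.

Lemma bh_dN1 x : is_derive (horizon_poly1 rp2 rm2) x 2.
Proof. unfold horizon_poly1; auto_derive; [exact I|ring]. Qed.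

Ltac quotient_derive Hx :=
  pose proof (Rgt_not_eq _ _ (bh_f_pos _ Hx)); pose proof (Rgt_not_eq _ _ (bh_m_pos _ Hx));
  auto_derive;
  [ repeat split;
    try first [ exact (ex_intro _ _ (bh_df _ Hx)) | exact (ex_intro _ _ (bh_df1 _ Hx))
      | exact (ex_intro _ _ (bh_dm _ Hx)) | exact (ex_intro _ _ (bh_dm1 _ Hx))
      | exact (ex_intro _ _ (bh_dN _)) | exact (ex_intro _ _ (bh_dN1 _)) ];
    repeat apply Rmult_integral_contrapositive_currified; try assumption; lra
  | change (Derive (fun z => f z)) with (Derive f);
    change (Derive (fun z => m z)) with (Derive m);
    change (Derive (fun z => f1 z)) with (Derive f1);
    change (Derive (fun z => m1 z)) with (Derive m1);
    change (Derive (fun z => horizon_poly rp2 rm2 z)) with (Derive N);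
    change (Derive (fun z => horizon_poly1 rp2 rm2 z)) with (Derive (horizon_poly1 rp2 rm2));
    rewrite ?(is_derive_unique _ _ _ (bh_dN _)), ?(is_derive_unique _ _ _ (bh_dN1 _));
    fold f1 m1; fold f2 m2; field; repeat split; assumption ].

Lemma bh_dA x : rp2 < x -> is_derive (fibre_norm rp2 rm2 m) x (fibre_norm1 rp2 rm2 m m1 x).
Proof. intros Hx; unfold fibre_norm, fibre_norm1; quotient_derive Hx. Qed.

Lemma bh_dA1 x : rp2 < x -> is_derive (fibre_norm1 rp2 rm2 m m1) x (fibre_norm2 rp2 rm2 m m1 m2 x).
Proof. intros Hx; unfold fibre_norm1, fibre_norm2; quotient_derive Hx. Qed.

Lemma bh_dB x : rp2 < x -> is_derive (base_norm f m) x (base_norm1 f f1 m m1 x).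
Proof. intros Hx; unfold base_norm, base_norm1; quotient_derive Hx. Qed.

Lemma bh_dB1 x : rp2 < x -> is_derive (base_norm1 f f1 m m1) x (base_norm2 f f1 f2 m m1 m2 x).
Proof. intros Hx; unfold base_norm1, base_norm2; quotient_derive Hx. Qed.

Lemma bh_A_pos x : rp2 < x -> 0 < fibre_norm rp2 rm2 m x.
Proof. intros Hx; apply Rdiv_lt_0_compat; [apply bh_N_pos | apply bh_m_pos]; exact Hx. Qed.

Lemma bh_B_pos x : rp2 < x -> 0 < base_norm f m x.
Proof. intros Hx; apply Rdiv_lt_0_compat; [apply bh_m_pos | apply bh_f_pos]; exact Hx. Qed.

(** For x = dphi - w dt and y = dpsi - w dt one has sin^2 x^2 + cos^2 y^2 = (sin^2 x + cos^2 y)^2 +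
    sin^2 cos^2 (x - y)^2, and (m^2 - f N) / (m f) = B - A; so the coefficient of the last square
    becomes B. *)
Lemma metric_adapted p i j : exterior rp2 p ->
  metric b i j p = adapted_metric f (fibre_norm rp2 rm2 m) (base_norm f m) w i j p.
Proof.
  intros Hp; destruct (sin_cos_exterior rp2 p Hp) as [_ [_ E]].
  pose proof (proj1 Hp) as Hx.
  pose proof (bh_f_pos _ Hx) as Hf; pose proof (bh_m_pos _ Hx) as Hm;
    pose proof (bh_N_pos _ Hx) as HN.
  unfold metric, line_element, adapted_metric, sumc, fibre_norm, base_norm.
  rewrite (bh_N _ _ _ _ _ _ bh _ Hx).
  destruct i, j; unfold adapted_norm, adapted_coframe, delta; cbn -[pow];
    unfold fibre_norm, base_norm; rewrite ?E; fold f m w;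
    change ((p CR - rp2) * (p CR - rm2)) with (N (p CR));
    change (horizon_poly rp2 rm2 (p CR)) with (N (p CR));
    clearbody f m w N; field [E]; lra.
Qed.

Lemma metric_ginv p : exterior rp2 p ->
  is_inverse (fun i j => metric b i j p) (fun i j => ginv (metric b) i j p).
Proof.
  intros Hp; apply inverseP with (B := explicit_inverse b p).
  destruct (bh_positive _ _ _ _ _ _ bh _ (proj1 Hp)) as [H1 [H2 H3]].
  apply (metric_inverse b rp2 p Hp H1 H2 H3).
Qed.

Lemma potential_adapted p i : potential b i p
  = a (p CR) * delta i Ct + P (p CR) *
    (sin (p Cth) ^ 2 * delta i Cph + cos (p Cth) ^ 2 * delta i Cps).
Proof. reflexivity. Qed.

(** The reduced equations depend on R only, so a single angle suffices; PI / 4 is any value inside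
    the range of theta. *)
Definition sample_point (x : R) : point := fun i =>
  match i with CR => x | Cth => PI / 4 | _ => 0 end.

Lemma sample_point_exterior x : rp2 < x -> exterior rp2 (sample_point x).
Proof.
  intros Hx; pose proof PI_RGT_0; unfold exterior; simpl; lra.
Qed.

Lemma bh_reduced_equations x : rp2 < x ->
  reduced_equations rp2 rm2 f f1 f2 m m1 m2 w w1 w2 a1 P P1 x.
Proof.
  intros Hx; pose proof (sample_point_exterior x Hx) as Hp.
  destruct (adapted_einstein rp2 _ _ _ _ _ _ _ _ _ _ _ _ bh_df bh_df1 bh_dA bh_dA1
    bh_dB bh_dB1 bh_dw bh_dw1 bh_f_pos bh_A_pos bh_B_pos (metric b) metric_adapted
    metric_ginv (potential b) a a1 P P1 bh_da bh_dP potential_adapted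
    (sample_point x) Hp (bh_einstein_maxwell _ _ _ _ _ _ bh _ Hp))
    as [G0 [G1 [G2 [G4 G04]]]].
  pose proof (bh_f_pos x Hx) as Hf; pose proof (bh_m_pos x Hx) as Hm;
    pose proof (bh_N_pos x Hx) as HN.
  split; [|split; [|split]].
  - exact (dlog_f_equation rp2 rm2 f f1 f2 m m1 m2 w w1 a1 P P1 x Hf Hm HN G0 G1 G2 G4).
  - exact (dlog_m_equation rp2 rm2 f f1 f2 m m1 m2 w w1 a1 P P1 x Hf Hm HN G0 G1 G2 G4).
  - exact (twist_equation rp2 rm2 f f1 m m1 w w1 w2 a1 P1 x Hf Hm HN G04).
  - exact (constraint_equation rp2 rm2 f f1 f2 m m1 m2 w w1 a1 P P1 x Hf Hm HN G1).
Qed.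

(** The last hypothesis is the inequality Y^2 < X^2 of [isotropic_type_II], freed of common positive
    factors, the last of which is f / m^2. *)
Lemma bh_type_II_equations x : rp2 < x ->
  admits_multiple_WAND (metric b) (exterior rp2) ->
  dlog_squash rp2 rm2 f f1 m m1 x ^ 2 < rotation_term rp2 rm2 f m w1 x ->
  type_II_equations rp2 rm2 f f1 m m1 w w1 a1 P P1 x.
Proof.
  intros Hx [l Hl] HK; pose proof (sample_point_exterior x Hx) as Hp.
  destruct (Hl _ Hp) as [L1 [L2 L3]].
  pose proof (bh_einstein_maxwell _ _ _ _ _ _ bh _ Hp) as HE.
  pose proof (bh_f_pos x Hx) as Hf; pose proof (bh_m_pos x Hx) as Hm;
    pose proof (bh_N_pos x Hx) as HN.
  destruct (adapted_einstein rp2 _ _ _ _ _ _ _ _ _ _ _ _ bh_df bh_df1 bh_dA bh_dA1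
    bh_dB bh_dB1 bh_dw bh_dw1 bh_f_pos bh_A_pos bh_B_pos (metric b) metric_adapted
    metric_ginv (potential b) a a1 P P1 bh_da bh_dP potential_adapted
    (sample_point x) Hp HE)
    as [G0 [G1 [G2 [G4 G04]]]].
  refine (type_II_equations_hold rp2 rm2 f f1 f2 m m1 m2 w w1 w2 a1 P P1 x Hf Hm HN
    G0 G1 G2 G4 G04 (adapted_type_II rp2 _ _ _ _ _ _ _ _ _ _ _ _ bh_df bh_df1 bh_dA bh_dA1
    bh_dB bh_dB1 bh_dw bh_dw1 bh_f_pos bh_A_pos bh_B_pos (metric b) metric_adapted
    metric_ginv (potential b) a a1 P P1 bh_da bh_dP potential_adapted
    (sample_point x) (l (sample_point x)) Hp HE L1 L2 L3 _)).
  cbv zeta; change (sample_point x CR) with x.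
  replace (f x * K1423 (fibre_norm rp2 rm2 m) (fibre_norm1 rp2 rm2 m m1) (base_norm f m) (base_norm1 f f1 m m1) x ^ 2)
    with (f x / m x ^ 2 * dlog_squash rp2 rm2 f f1 m m1 x ^ 2).
  2:{ unfold K1423, fibre_norm, fibre_norm1, base_norm, base_norm1, dlog_squash, dlog_f, dlog_m.
      change (horizon_poly rp2 rm2) with N; field; lra. }
  replace (fibre_norm rp2 rm2 m x * K0123 (fibre_norm rp2 rm2 m) w1 x ^ 2)
    with (f x / m x ^ 2 * rotation_term rp2 rm2 f m w1 x).
  2:{ unfold K0123, fibre_norm, rotation_term, twist; change (horizon_poly rp2 rm2) with N; field; lra. }
  apply Rmult_lt_compat_l; [|exact HK].
  apply Rdiv_lt_0_compat; [exact Hf | apply pow_lt, Hm].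
Qed.

End BlackHole.


(** * Asymptotic expansions in powers of 1/x *)

Definition eventually_bounded (h : R -> R) : Prop :=
  exists K X : R, forall x, X < x -> Rabs (h x) <= K.

(* h(x) = c_0 + c_1 / x + ... + c_(n-1) / x^(n-1) + O(1 / x^n) *)
Fixpoint expands (n : nat) (h : R -> R) (c : nat -> R) : Prop :=
  match n with
  | O => eventually_bounded h
  | S n' => expands n' (fun x => x * (h x - c O)) (fun i => c (S i))
  end.

Lemma expands_ext n h g c X :
  (forall x, X < x -> h x = g x) -> expands n h c -> expands n g c.
Proof.
  revert h g c; induction n as [|n IH]; intros h g c E; simpl.
  - intros [K [X' H]]; exists K, (Rmax X X'); intros x Hx.
    rewrite <- E; [apply H|]; [pose proof (Rmax_r X X')|pose proof (Rmax_l X X')]; lra.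
  - apply IH; intros x Hx; rewrite E by exact Hx; reflexivity.
Qed.

Lemma expands_coef_ext n h c d :
  (forall i, (i < n)%nat -> c i = d i) -> expands n h c -> expands n h d.
Proof.
  revert h c d; induction n as [|n IH]; intros h c d E H; [exact H|]; simpl in *.
  rewrite <- (E O) by lia; apply IH with (2 := H); intros i Hi; apply E; lia.
Qed.

Lemma eventually_bounded_plus h g : eventually_bounded h -> eventually_bounded g ->
  eventually_bounded (fun x => h x + g x).
Proof.
  intros [K [X H]] [L [Y G]]; exists (K + L), (Rmax X Y); intros x Hx.
  pose proof (Rmax_l X Y); pose proof (Rmax_r X Y).
  apply Rle_trans with (1 := Rabs_triang _ _).
  apply Rplus_le_compat; [apply H | apply G]; lra.
Qed.

Lemma eventually_bounded_mult h g : eventually_bounded h -> eventually_bounded g ->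
  eventually_bounded (fun x => h x * g x).
Proof.
  intros [K [X H]] [L [Y G]]; exists (K * L), (Rmax X Y); intros x Hx.
  pose proof (Rmax_l X Y); pose proof (Rmax_r X Y).
  rewrite Rabs_mult.
  apply Rmult_le_compat; try apply Rabs_pos; [apply H | apply G]; lra.
Qed.

Lemma eventually_bounded_const c : eventually_bounded (fun _ => c).
Proof. exists (Rabs c), 0; intros; lra. Qed.

Lemma expands_succ n h c : expands (S n) h c -> expands n h c.
Proof.
  revert h c; induction n as [|n IH]; intros h c H; [|exact (IH _ _ H)].
  destruct H as [K [X H]]; exists (K + Rabs (c O)), (Rmax X 1); intros x Hx.
  pose proof (Rmax_l X 1); pose proof (Rmax_r X 1).
  specialize (H x ltac:(lra)); rewrite Rabs_mult, (Rabs_pos_eq x) in H by lra.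
  replace (h x) with (h x - c O + c O) by ring.
  apply Rle_trans with (1 := Rabs_triang _ _).
  apply Rplus_le_compat_r; pose proof (Rabs_pos (h x - c O)); nra.
Qed.

Lemma expands_le n m h c : (m <= n)%nat -> expands n h c -> expands m h c.
Proof.
  intros Hm; induction Hm as [|n Hm IH]; [auto|].
  intros H; apply IH, expands_succ, H.
Qed.

Lemma expands_bounded n h c : expands n h c -> eventually_bounded h.
Proof. apply (expands_le n O); lia. Qed.

Lemma expands_plus n h g c d : expands n h c -> expands n g d ->
  expands n (fun x => h x + g x) (fun i => c i + d i).
Proof.
  revert h g c d; induction n as [|n IH]; intros h g c d H G.
  - apply eventually_bounded_plus; assumption.
  - simpl; apply (expands_ext n (fun x => x * (h x - c O) + x * (g x - d O)) _ _ 0).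
    + intros x _; ring.
    + exact (IH _ _ _ _ H G).
Qed.

Lemma expands_scal n h c r : expands n h c ->
  expands n (fun x => r * h x) (fun i => r * c i).
Proof.
  revert h c; induction n as [|n IH]; intros h c H.
  - apply eventually_bounded_mult; [apply eventually_bounded_const | exact H].
  - simpl; apply (expands_ext n (fun x => r * (x * (h x - c O))) _ _ 0).
    + intros x _; ring.
    + exact (IH _ _ H).
Qed.

Lemma expands_minus n h g c d : expands n h c -> expands n g d ->
  expands n (fun x => h x - g x) (fun i => c i - d i).
Proof.
  intros H G.
  apply (expands_ext n (fun x => h x + -1 * g x) _ _ 0); [intros; ring|].
  apply (expands_coef_ext n _ (fun i => c i + -1 * d i)); [intros; ring|].
  apply expands_plus; [exact H | apply expands_scal, G].
Qed.

(** The recursion peels off the constant term of the first factor, following x (h g - c0 d0) = c0 x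
    (g - d0) + x (h - c0) g, so that [expands_mult] is a direct induction. *)
Fixpoint cauchy_product (c d : nat -> R) (i : nat) : R :=
  match i with
  | O => c O * d O
  | S i' => c O * d i + cauchy_product (fun j => c (S j)) d i'
  end.

Lemma expands_mult n h g c d : expands n h c -> expands n g d ->
  expands n (fun x => h x * g x) (cauchy_product c d).
Proof.
  revert h g c d; induction n as [|n IH]; intros h g c d H G.
  - apply eventually_bounded_mult; assumption.
  - simpl.
    apply (expands_ext n (fun x => c O * (x * (g x - d O)) + x * (h x - c O) * g x) _ _ 0).
    + intros x _; ring.
    + apply expands_plus; [apply expands_scal; exact G|].
      exact (IH _ _ _ _ H (expands_succ _ _ _ G)).
Qed.

(** Long division: x (g / h - d0 / c0) is again a quotient by h, with numerator x (g - d0) - (d0 /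
    c0) x (h - c0). *)
Fixpoint quotient_coef (d c : nat -> R) (i : nat) : R :=
  match i with
  | O => d O / c O
  | S i' => quotient_coef (fun j => d (S j) - d O / c O * c (S j)) c i'
  end.

Definition tends_to (h : R -> R) (l : R) : Prop :=
  forall eps, 0 < eps -> exists X, forall x, X < x -> Rabs (h x - l) < eps.

Lemma expands_tends n h c : expands (S n) h c -> tends_to h (c O).
Proof.
  intros H; simpl in H; apply expands_bounded in H; destruct H as [K [X HK]].
  intros eps Heps; exists (Rmax (Rmax X 1) (K / eps)); intros x Hx.
  pose proof (Rmax_l (Rmax X 1) (K / eps)); pose proof (Rmax_r (Rmax X 1) (K / eps)).
  pose proof (Rmax_l X 1); pose proof (Rmax_r X 1).
  specialize (HK x ltac:(lra)); rewrite Rabs_mult, (Rabs_pos_eq x) in HK by lra.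
  assert (K < x * eps).
  { apply (Rmult_lt_reg_r (/ eps)); [apply Rinv_0_lt_compat; exact Heps|].
    rewrite Rmult_assoc, Rinv_r, Rmult_1_r by lra; unfold Rdiv in *; lra. }
  apply (Rmult_lt_reg_l x); lra.
Qed.

Lemma tends_to_unique h l l' : tends_to h l -> tends_to h l' -> l = l'.
Proof.
  intros H H'; destruct (Req_dec l l') as [E|E]; [exact E|exfalso].
  assert (Heps : 0 < Rabs (l - l') / 2).
  { pose proof (Rabs_pos_lt (l - l') (Rminus_eq_contra _ _ E)); lra. }
  destruct (H _ Heps) as [X HX]; destruct (H' _ Heps) as [Y HY].
  pose proof (Rmax_l X Y); pose proof (Rmax_r X Y).
  specialize (HX (Rmax X Y + 1) ltac:(lra)); specialize (HY (Rmax X Y + 1) ltac:(lra)).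
  pose proof (Rabs_triang (h (Rmax X Y + 1) - l') (l - h (Rmax X Y + 1))) as T.
  replace (h (Rmax X Y + 1) - l' + (l - h (Rmax X Y + 1))) with (l - l') in T by ring.
  rewrite (Rabs_minus_sym l (h _)) in T; lra.
Qed.

Lemma expands_unique n h c d i : expands n h c -> expands n h d ->
  (i < n)%nat -> c i = d i.
Proof.
  revert h c d i; induction n as [|n IH]; intros h c d i H G Hi; [lia|].
  assert (E : c O = d O)
    by (apply (tends_to_unique h); eapply expands_tends; eassumption).
  destruct i as [|i]; [exact E|].
  simpl in H, G; rewrite <- E in G.
  exact (IH _ _ _ i H G ltac:(lia)).
Qed.

Lemma eventually_bounded_inv h l : tends_to h l -> l <> 0 ->
  exists X, (forall x, X < x -> h x <> 0) /\
    eventually_bounded (fun x => / h x).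
Proof.
  intros H Hl.
  assert (Heps : 0 < Rabs l / 2) by (pose proof (Rabs_pos_lt l Hl); lra).
  destruct (H _ Heps) as [X HX].
  assert (Hb : forall x, X < x -> Rabs l / 2 <= Rabs (h x)).
  { intros x Hx; specialize (HX x Hx).
    pose proof (Rabs_triang (h x) (l - h x)) as T.
    replace (h x + (l - h x)) with l in T by ring.
    rewrite (Rabs_minus_sym l) in T; lra. }
  assert (Hn : forall x, X < x -> h x <> 0).
  { intros x Hx E; specialize (Hb x Hx); rewrite E, Rabs_R0 in Hb; lra. }
  exists X; split; [exact Hn|].
  exists (/ (Rabs l / 2)), X; intros x Hx.
  rewrite Rabs_inv; apply Rinv_le_contravar; [exact Heps | apply Hb, Hx].
Qed.

(** The extra order of h gives the limit c0 even for n = 0; it makes 1 / h bounded. *)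
Lemma expands_div n h g c d : expands (S n) h c -> expands n g d -> c O <> 0 ->
  expands n (fun x => g x / h x) (quotient_coef d c).
Proof.
  intros H G Hc.
  destruct (eventually_bounded_inv h (c O) (expands_tends _ _ _ H) Hc) as [X [Hn Hb]].
  revert g d G; induction n as [|n IH]; intros g d G.
  - apply eventually_bounded_mult; [exact G | exact Hb].
  - simpl.
    apply (expands_ext n (fun x =>
      (x * (g x - d O) - d O / c O * (x * (h x - c O))) / h x) _ _ X).
    + intros x Hx; field; split; [exact Hc | apply Hn, Hx].
    + apply IH; [apply expands_succ, H|].
      apply expands_minus; [exact G|].
      apply (expands_scal n (fun x => x * (h x - c O)) (fun i => c (S i))).
      exact (expands_succ (S n) h c H).
Qed.

Definition shift_coef (c : nat -> R) (i : nat) : R :=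
  match i with O => 0 | S i' => c i' end.

Lemma expands_shift n h c : expands n h c ->
  expands (S n) (fun x => h x / x) (shift_coef c).
Proof.
  intros H; simpl; apply (expands_ext n h _ _ 0); [|exact H].
  intros x Hx; field; lra.
Qed.

Lemma expands_unshift n h c : expands (S n) h c -> c O = 0 ->
  expands n (fun x => x * h x) (fun i => c (S i)).
Proof.
  intros H Hc; simpl in H; rewrite Hc in H.
  apply (expands_ext n (fun x => x * (h x - 0)) _ _ 0); [intros; ring | exact H].
Qed.

Definition const_coef (r : R) (i : nat) : R := match i with O => r | _ => 0 end.

Lemma expands_zero n : expands n (fun _ => 0) (fun _ => 0).
Proof.
  induction n as [|n IH]; [apply eventually_bounded_const|]; simpl.
  apply (expands_ext n (fun _ => 0) _ _ 0); [intros; ring | exact IH].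
Qed.

Lemma expands_const n r : expands n (fun _ => r) (const_coef r).
Proof.
  destruct n as [|n]; [apply eventually_bounded_const|]; simpl.
  apply (expands_ext n (fun _ => 0) _ _ 0); [intros; ring | apply expands_zero].
Qed.

Fixpoint partial_sum (n : nat) (c : nat -> R) (y : R) : R :=
  match n with
  | O => 0
  | S n' => c O + y * partial_sum n' (fun i => c (S i)) y
  end.

Lemma expands_intro n h c K X :
  (forall x, X < x -> Rabs (h x - partial_sum n c (/ x)) <= K * (/ x) ^ n) ->
  expands n h c.
Proof.
  revert h c X; induction n as [|n IH]; intros h c X H; simpl in *.
  - exists K, X; intros x Hx; specialize (H x Hx); rewrite Rminus_0_r, Rmult_1_r in H.
    exact H.
  - apply (IH _ _ (Rmax X 1)); intros x Hx.
    pose proof (Rmax_l X 1); pose proof (Rmax_r X 1); specialize (H x ltac:(lra)).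
    replace (x * (h x - c O) - partial_sum n (fun i => c (S i)) (/ x))
      with (x * (h x - (c O + / x * partial_sum n (fun i => c (S i)) (/ x))))
      by (field; lra).
    rewrite Rabs_mult, (Rabs_pos_eq x) by lra.
    replace (K * (/ x) ^ n) with (x * (K * (/ x * (/ x) ^ n))) by (field; lra).
    apply Rmult_le_compat_l; lra.
Qed.


(** An expansion may not be differentiated in general, so one for h' is assumed and only its
    coefficients are identified. If d0 were nonzero, h' would stay away from 0 and the mean value
    theorem would make h unbounded. The higher coefficients follow by induction applied to x (h -
    c0). *)
Lemma expands_derive n (h h1 : R -> R) c d X :
  (forall x, X < x -> is_derive h x (h1 x)) ->
  expands n h c -> expands (S n) h1 d ->
  d O = 0 /\ forall i, (i < n)%nat -> d (S i) = - INR i * c i.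
Proof.
  revert h h1 c d X; induction n as [|n IH]; intros h h1 c d X Hd Hh Hh1.
  - split; [|intros; lia].
    destruct (Req_dec (d O) 0) as [E|E]; [exact E|exfalso].
    destruct Hh as [K [Y HK]].
    assert (Heps : 0 < Rabs (d O) / 2) by (pose proof (Rabs_pos_lt _ E); lra).
    destruct (expands_tends _ _ _ Hh1 _ Heps) as [Z HZ].
    set (x := Rmax X (Rmax Y Z) + 1).
    assert (Hx : X < x /\ Y < x /\ Z < x).
    { unfold x; pose proof (Rmax_l X (Rmax Y Z)); pose proof (Rmax_r X (Rmax Y Z)).
      pose proof (Rmax_l Y Z); pose proof (Rmax_r Y Z); lra. }
    assert (HK0 : 0 <= K) by (pose proof (HK x ltac:(lra)); pose proof (Rabs_pos (h x)); lra).
    (* Over an interval of this length a slope of size at least |d0| / 2 changes h by 2 K + 1, more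
       than the bound 2 K allows. *)
    set (t := (2 * K + 1) / (Rabs (d O) / 2)).
    assert (Ht : 0 < t) by (apply Rdiv_lt_0_compat; lra).
    destruct (MVT_gen h x (x + t) h1) as [z [Hz E1]].
    + intros y Hy; rewrite Rmin_left in Hy by lra; apply Hd; lra.
    + intros y Hy; rewrite Rmin_left in Hy by lra.
      apply derivable_continuous_pt; exists (h1 y); apply is_derive_Reals, Hd; lra.
    + rewrite Rmin_left, Rmax_right in Hz by lra.
      pose proof (HK x ltac:(lra)) as B1; pose proof (HK (x + t) ltac:(lra)) as B2.
      pose proof (HZ z ltac:(lra)) as B3.
      assert (B4 : Rabs (d O) / 2 < Rabs (h1 z)).
      { pose proof (Rabs_triang (h1 z) (d O - h1 z)) as T.
        replace (h1 z + (d O - h1 z)) with (d O) in T by ring.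
        rewrite (Rabs_minus_sym (d O)) in T; lra. }
      assert (B5 : Rabs (h (x + t) - h x) <= 2 * K).
      { apply Rle_trans with (1 := Rabs_triang _ _); rewrite Rabs_Ropp; lra. }
      rewrite E1, Rabs_mult in B5.
      replace (x + t - x) with t in B5 by ring; rewrite (Rabs_pos_eq t) in B5 by lra.
      assert (t * (Rabs (d O) / 2) = 2 * K + 1) by (unfold t; field; lra).
      nra.
  - destruct (IH h h1 c d X Hd (expands_succ _ _ _ Hh) (expands_succ _ _ _ Hh1)) as [E0 _].
    split; [exact E0|].
    (* The derivative of x (h - c0), written as x (h - c0) / x + x h' so that both terms have known
       expansions. *)
    assert (G : expands (S n) (fun x => x * (h x - c O) / x + x * h1 x)
      (fun i => shift_coef (fun j => c (S j)) i + d (S i))).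
    { apply expands_plus; [apply expands_shift; exact Hh|].
      exact (expands_unshift _ _ _ Hh1 E0). }
    assert (Hd' : forall x, Rmax X 0 < x ->
      is_derive (fun x => x * (h x - c O)) x (x * (h x - c O) / x + x * h1 x)).
    { intros x Hx; pose proof (Rmax_l X 0); pose proof (Rmax_r X 0).
      assert (Hx' : X < x) by lra; auto_derive.
      - exact (ex_intro _ _ (Hd x Hx')).
      - change (Derive (fun y => h y)) with (Derive h).
        rewrite (is_derive_unique _ _ _ (Hd x Hx')); field; lra. }
    destruct (IH _ _ _ _ _ Hd' Hh G) as [F0 F].
    intros [|i] Hi.
    + simpl in F0 |- *; lra.
    + specialize (F i ltac:(lia)); simpl shift_coef in F; rewrite S_INR; lra.
Qed.

(** * From the asymptotic hypotheses to [expands] *)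

Definition power_expansion (h : R -> R) (p : Z) (c : nat -> R) : Prop :=
  forall K : nat, bigO_infty (fun x => h x - truncation p c K x) (p - Z.of_nat K - 1).

Lemma partial_sum_sum K c y :
  partial_sum (S K) c y = sum_f_R0 (fun i => c i * y ^ i) K.
Proof.
  revert c; induction K as [|K IH]; intros c; [simpl; ring|].
  rewrite decomp_sum by lia; simpl pred.
  change (partial_sum (S (S K)) c y)
    with (c O + y * partial_sum (S K) (fun i => c (S i)) y).
  rewrite IH, scal_sum; f_equal; [simpl; ring|].
  apply sum_eq; intros i _; simpl; ring.
Qed.

Lemma powerRZ_inv_nat x k : powerRZ x (- Z.of_nat k) = (/ x) ^ k.
Proof.
  rewrite powerRZ_neg', <- pow_powerRZ, pow_inv; reflexivity.
Qed.

Lemma power_expansion_expands n h p c : power_expansion h p c ->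
  expands n (fun x => h x * powerRZ x (- p)) c.
Proof.
  (* A truncation always contains its term of index 0, so truncating at n controls order n + 1; one
     order is given up to include n = 0. *)
  intros H; apply expands_succ.
  destruct (H n) as [C [X HX]].
  apply (expands_intro (S n) _ _ C (Rmax X 0)); intros x Hx.
  pose proof (Rmax_l X 0); pose proof (Rmax_r X 0); specialize (HX x ltac:(lra)).
  assert (Hx0 : x <> 0) by lra.
  assert (Hpos : 0 < powerRZ x (- p)) by (apply powerRZ_lt; lra).
  replace (h x * powerRZ x (- p) - partial_sum (S n) c (/ x))
    with ((h x - truncation p c n x) * powerRZ x (- p)).
  - rewrite Rabs_mult, (Rabs_pos_eq (powerRZ x (- p))) by lra.
    replace ((/ x) ^ S n) with (powerRZ x (p - Z.of_nat n - 1) * powerRZ x (- p)).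
    + rewrite <- Rmult_assoc; apply Rmult_le_compat_r; lra.
    + rewrite <- powerRZ_add by exact Hx0.
      replace (p - Z.of_nat n - 1 + - p)%Z with (- Z.of_nat (S n))%Z by lia.
      apply powerRZ_inv_nat.
  - rewrite Rmult_minus_distr_r; f_equal.
    rewrite partial_sum_sum; unfold truncation.
    rewrite Rmult_comm, scal_sum; apply sum_eq; intros i _.
    rewrite Rmult_assoc, <- powerRZ_add by exact Hx0; f_equal.
    replace (p - Z.of_nat i + - p)%Z with (- Z.of_nat i)%Z by lia.
    apply powerRZ_inv_nat.
Qed.

Lemma expansion_infty_power h p c : expansion_infty h p c -> power_expansion h p c.
Proof.
  intros H K; specialize (H K O).
  replace (p - Z.of_nat K - 1)%Z with (p - Z.of_nat K - 1 - Z.of_nat 0)%Z by lia.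
  exact H.
Qed.

Lemma is_derive_powerRZ x z : 0 < x ->
  is_derive (fun y => powerRZ y z) x (IZR z * powerRZ x z / x).
Proof.
  intros Hx; destruct z as [|k|k]; simpl powerRZ.
  - replace (0 * 1 / x) with 0 by (field; lra).
    apply (is_derive_const (K := R_AbsRing) (V := R_NormedModule)).
  - auto_derive; [exact I|].
    rewrite INR_IPR; change (IPR k) with (IZR (Zpos k)).
    replace (x ^ Pos.to_nat k) with (x * x ^ Init.Nat.pred (Pos.to_nat k)); [field; lra|].
    pose proof (Pos2Nat.is_pos k); destruct (Pos.to_nat k); [lia|reflexivity].
  - assert (Hk : x ^ Pos.to_nat k <> 0) by (apply pow_nonzero; lra).
    auto_derive; [exact Hk|].
    rewrite INR_IPR; change (IZR (Zneg k)) with (- IPR k).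
    replace (x ^ Pos.to_nat k) with (x * x ^ Init.Nat.pred (Pos.to_nat k)) in *.
    + field; split; [|lra]; intros E; apply Hk; rewrite E; ring.
    + pose proof (Pos2Nat.is_pos k); destruct (Pos.to_nat k); [lia|reflexivity].
Qed.

Lemma is_derive_truncation p c K x : 0 < x ->
  is_derive (truncation p c K) x
    (truncation p (fun i => (IZR p - INR i) * c i) K x / x).
Proof.
  intros Hx; unfold truncation.
  assert (H : forall i, is_derive (fun y => c i * powerRZ y (p - Z.of_nat i)) x
    ((IZR p - INR i) * c i * powerRZ x (p - Z.of_nat i) / x)).
  { intros i.
    replace ((IZR p - INR i) * c i * powerRZ x (p - Z.of_nat i) / x)
      with (c i * (IZR (p - Z.of_nat i) * powerRZ x (p - Z.of_nat i) / x))
      by (rewrite minus_IZR, <- INR_IZR_INZ; field; lra).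
    apply (is_derive_scal (fun y => powerRZ y (p - Z.of_nat i)) x (c i)).
    apply is_derive_powerRZ, Hx. }
  induction K as [|K IH]; cbn [sum_f_R0]; [apply H|].
  rewrite Rdiv_plus_distr.
  exact (is_derive_plus (V := R_NormedModule) _ _ _ _ _ IH (H (S K))).
Qed.

(** The factor x keeps the exponent p and the indexing: the i-th coefficient is just multiplied by p
    - i. *)
Lemma expansion_infty_derive h p c X :
  expansion_infty h p c -> (forall x, X < x -> ex_derive h x) ->
  power_expansion (fun x => x * Derive h x) p (fun i => (IZR p - INR i) * c i).
Proof.
  intros H Hd K; destruct (H K 1%nat) as [C [Y HY]].
  exists C, (Rmax Y (Rmax X 0)); intros x Hx.
  pose proof (Rmax_l Y (Rmax X 0)); pose proof (Rmax_r Y (Rmax X 0)).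
  pose proof (Rmax_l X 0); pose proof (Rmax_r X 0).
  specialize (HY x ltac:(lra)).
  assert (Hx0 : 0 < x) by lra.
  assert (E : Derive_n (fun x => h x - truncation p c K x) 1 x
    = Derive h x - truncation p (fun i => (IZR p - INR i) * c i) K x / x).
  { apply is_derive_unique, (is_derive_minus (V := R_NormedModule)).
    - apply Derive_correct, Hd; lra.
    - apply is_derive_truncation, Hx0. }
  rewrite E in HY.
  replace (x * Derive h x - truncation p (fun i => (IZR p - INR i) * c i) K x)
    with (x * (Derive h x - truncation p (fun i => (IZR p - INR i) * c i) K x / x))
    by (field; lra).
  rewrite Rabs_mult, (Rabs_pos_eq x) by lra.
  replace (powerRZ x (p - Z.of_nat K - 1))
    with (x * powerRZ x (p - Z.of_nat K - 1 - Z.of_nat 1)).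
  - rewrite <- Rmult_assoc, (Rmult_comm C), Rmult_assoc.
    apply Rmult_le_compat_l; lra.
  - rewrite <- (powerRZ_1 x) at 1; rewrite <- powerRZ_add by lra; f_equal; lia.
Qed.


(** * The coefficients at infinity and the contradiction *)

Section Asymptotics.

Context (b : profile) (rp2 rm2 M J Q : R).
Context (bh : charged_rotating_black_hole b rp2 rm2 M J Q).

Let f := pf_f b.
Let m := pf_m b.
Let w := pf_varpi b.
Let a := pf_a0 b.
Let P := pf_aphi b.
Let N := horizon_poly rp2 rm2.
Let f1 := Derive f.
Let f2 := Derive f1.
Let m1 := Derive m.
Let m2 := Derive m1.
Let w1 := Derive w.
Let w2 := Derive w1.
Let a1 := Derive a.
Let P1 := Derive P.

Let AL := dlog_f rp2 rm2 f f1.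
Let H := dlog_squash rp2 rm2 f f1 m m1.
Let K := twist rp2 rm2 f m w1.
Let QQ := flux rp2 rm2 f w a1 P1.
Let Z := fun x => squash_term rp2 rm2 f m x / N x.
Let EE := electric_term rp2 rm2 f w a1 P1.
Let KAP := rotation_term rp2 rm2 f m w1.
Let PP := radial_term rp2 rm2 m P1.
Let BB := angular_term rp2 rm2 f m P.
Let s := rp2 + rm2.

(** The coefficients of N / x^2 = 1 - s / x + (r_+ r_-)^2 / x^2. *)
Definition nu_coef (i : nat) : R :=
  const_coef 1 i + (shift_coef (const_coef (- s)) i
    + shift_coef (shift_coef (const_coef (rp2 * rm2))) i).

Lemma expands_nu n : expands n (fun x => N x / x ^ 2) nu_coef.
Proof.
  apply expands_succ, expands_succ.
  apply (expands_ext _ (fun x => 1 + (- s / x + rp2 * rm2 / x / x)) _ _ 0).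
  - intros x Hx; unfold N, horizon_poly, s; field; lra.
  - apply expands_plus; [apply expands_const|]; apply expands_plus.
    + apply expands_shift, expands_const.
    + apply (expands_shift _ (fun x => rp2 * rm2 / x)), expands_shift, expands_const.
Qed.

Lemma expands_f n : exists c, expands n f c /\
  expands n (fun x => x ^ 2 * f1 x) (fun i => - INR (S i) * c (S i)) /\
  c 0%nat = 1 /\ c 1%nat = - M.
Proof.
  destruct (bh_asymp_f _ _ _ _ _ _ bh) as [c [Hc Hv]]; exists c; split; [|split; [|exact Hv]].
  - apply (expands_ext n _ _ _ 0) with (2 := power_expansion_expands n _ _ _
      (expansion_infty_power _ _ _ Hc)).
    intros x Hx; simpl; apply Rmult_1_r.
  - pose proof (power_expansion_expands (S n) _ _ _ (expansion_infty_derive _ _ _ rp2 Hc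
      (fun x Hx => bh_smooth_f _ _ _ _ _ _ bh 1%nat x Hx))) as E.
    apply expands_unshift in E; [|simpl; ring].
    refine (expands_coef_ext n _ _ _ _ (expands_ext n _ _ _ 0 _ E)).
    + intros i _; ring.
    + intros x Hx; simpl powerRZ; unfold f1, f; ring.
Qed.

Lemma expands_m n : exists c, expands n (fun x => m x / x) c /\
  expands n m1 (fun i => (1 - INR i) * c i) /\ c 0%nat = 1.
Proof.
  destruct (bh_asymp_m _ _ _ _ _ _ bh) as [c [Hc Hv]]; exists c; split; [|split; [|exact Hv]].
  - apply (expands_ext n _ _ _ 0) with (2 := power_expansion_expands n _ _ _
      (expansion_infty_power _ _ _ Hc)).
    intros x Hx; simpl; unfold m; field; lra.
  - apply (expands_ext n _ _ _ 0) with (2 := power_expansion_expands n _ _ _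
      (expansion_infty_derive _ _ _ rp2 Hc
        (fun x Hx => bh_smooth_m _ _ _ _ _ _ bh 1%nat x Hx))).
    intros x Hx; simpl; unfold m1, m; field; lra.
Qed.

Lemma expands_w n : exists c, expands n (fun x => x ^ 2 * w x) c /\
  expands n (fun x => x ^ 3 * w1 x) (fun i => (-2 - INR i) * c i) /\ c 0%nat = J.
Proof.
  destruct (bh_asymp_varpi _ _ _ _ _ _ bh) as [c [Hc Hv]]; exists c;
    split; [|split; [|exact Hv]].
  - apply (expands_ext n _ _ _ 0) with (2 := power_expansion_expands n _ _ _
      (expansion_infty_power _ _ _ Hc)).
    intros x Hx; simpl; unfold w; ring.
  - apply (expands_ext n _ _ _ 0) with (2 := power_expansion_expands n _ _ _
      (expansion_infty_derive _ _ _ rp2 Hc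
        (fun x Hx => bh_smooth_varpi _ _ _ _ _ _ bh 1%nat x Hx))).
    intros x Hx; simpl; unfold w1, w; ring.
Qed.

Lemma expands_a n : exists c, expands n (fun x => x ^ 2 * a1 x) c /\ c 0%nat = - Q.
Proof.
  destruct (bh_asymp_a0 _ _ _ _ _ _ bh) as [c [Hc Hv]].
  exists (fun i => (-1 - INR i) * c i); split; [|rewrite Hv; simpl; ring].
  apply (expands_ext n _ _ _ 0) with (2 := power_expansion_expands n _ _ _
    (expansion_infty_derive _ _ _ rp2 Hc
      (fun x Hx => bh_smooth_a0 _ _ _ _ _ _ bh 1%nat x Hx))).
  intros x Hx; simpl; unfold a1, a; ring.
Qed.

Lemma expands_P n : exists c, expands n (fun x => x * P x) c /\
  expands n (fun x => x ^ 2 * P1 x) (fun i => (-1 - INR i) * c i).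
Proof.
  destruct (bh_asymp_aphi _ _ _ _ _ _ bh) as [c Hc]; exists c; split.
  - apply (expands_ext n _ _ _ 0) with (2 := power_expansion_expands n _ _ _
      (expansion_infty_power _ _ _ Hc)).
    intros x Hx; simpl; unfold P; ring.
  - apply (expands_ext n _ _ _ 0) with (2 := power_expansion_expands n _ _ _
      (expansion_infty_derive _ _ _ rp2 Hc
        (fun x Hx => bh_smooth_aphi _ _ _ _ _ _ bh 1%nat x Hx))).
    intros x Hx; simpl; unfold P1, P; ring.
Qed.

Let X0 := Rmax rp2 0.

Lemma positive_at x : X0 < x -> rp2 < x /\ 0 < x /\ 0 < f x /\ 0 < m x /\ 0 < N x.
Proof.
  intros Hx; unfold X0 in Hx; pose proof (Rmax_l rp2 0); pose proof (Rmax_r rp2 0).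
  assert (H' : rp2 < x) by lra.
  repeat split; try lra;
    [apply (bh_f_pos b _ _ _ _ _ bh) | apply (bh_m_pos b _ _ _ _ _ bh)
    | apply (bh_N_pos b _ _ _ _ _ bh)]; exact H'.
Qed.

(** Powers of x are inserted to make each function bounded. The relation for [cF] eliminates the
    second coefficient of m, which occurs in f m / N and in Z = N f / m^2 and is not fixed by the
    hypotheses. *)
Lemma bh_expansions : exists ca cH cz ck cq ce ckap cb cp cpi cF p,
  (expands 3 AL ca /\ ca 0%nat = M) /\
  expands 4 H cH /\
  (expands 4 Z cz /\ cz 0%nat = 1) /\
  (expands 3 K ck /\ ck 0%nat = -2 * J) /\
  (expands 3 QQ cq /\ cq 0%nat = - Q) /\
  (expands 3 EE ce /\ ce 0%nat = 4 / 3 * Q ^ 2) /\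
  (expands 3 (fun x => x * KAP x) ckap /\ ckap 0%nat = 4 * J ^ 2) /\
  (expands 3 (fun x => x * BB x) cb /\ cb 0%nat = 4 / 3 * p ^ 2) /\
  (expands 3 (fun x => x * PP x) cp /\ cp 0%nat = 4 / 3 * p ^ 2) /\
  (expands 3 (fun x => N x * P1 x) cpi /\ cpi 0%nat = - p) /\
  (expands 3 (fun x => x * (f x * m x / N x)) cF /\ cF 0%nat = 1 /\
   2 * cF 1%nat = - 3 * M + s - cz 1%nat).
Proof.
  (* Order 9 is a reserve: divisions and the removal of a vanishing leading term cost orders, and at
     most 4 are needed in the end. *)
  destruct (expands_f 9) as [cf [Ef [Ef1 [Ef0 Ef2]]]].
  destruct (expands_m 9) as [cm [Em [Em1 Em0]]].
  destruct (expands_w 9) as [cw [Ew [Ew1 Ew0]]].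
  destruct (expands_a 9) as [c_a [Ea Ea0]].
  destruct (expands_P 9) as [cP [EP EP1]].
  pose proof (expands_nu 9) as En.
  assert (nu0 : nu_coef 0%nat = 1) by (unfold nu_coef; simpl; ring).
  assert (nu1 : nu_coef 1%nat = - s) by (unfold nu_coef; simpl; ring).
  assert (Hf0 : cf 0%nat <> 0) by lra.
  assert (Hm0 : cm 0%nat <> 0) by lra.
  assert (Hn0 : nu_coef 0%nat <> 0) by lra.
  pose proof (expands_div 8 _ _ _ _ Ef (expands_succ _ _ _ (expands_mult 9 _ _ _ _ En Ef1)) Hf0)
    as EAL.
  pose proof (expands_div 8 _ _ _ _ Em (expands_succ _ _ _ (expands_mult 9 _ _ _ _ En Em1)) Hm0)
    as Emu.
  pose proof (expands_mult 9 _ _ _ _ Em Em) as Emm.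
  pose proof (expands_div 8 _ _ _ _ Emm (expands_succ _ _ _ (expands_mult 9 _ _ _ _ En Ef))
    ltac:(simpl; rewrite Em0; lra)) as EZ.
  pose proof (expands_mult 9 _ _ _ _ Ef Em) as Efm.
  pose proof (expands_div 8 _ _ _ _ Efm (expands_succ _ _ _ (expands_mult 9 _ _ _ _
    (expands_mult 9 _ _ _ _ En En) Ew1)) ltac:(simpl; rewrite Em0, Ef0; lra)) as EK.
  pose proof (expands_div 8 _ _ _ _ En (expands_succ _ _ _ Efm) Hn0) as EF.
  assert (EwP : expands 9 (fun x => x ^ 2 * (w x * P1 x)) (shift_coef (shift_coef
     (cauchy_product cw (fun i => (-1 - INR i) * cP i))))).
  { apply (expands_ext 9 (fun x => (x ^ 2 * w x) * (x ^ 2 * P1 x) / x / x) _ _ 0).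
    - intros x Hx; field; lra.
    - apply (expands_shift 8 (fun x => (x ^ 2 * w x) * (x ^ 2 * P1 x) / x)).
      apply (expands_shift 7 (fun x => (x ^ 2 * w x) * (x ^ 2 * P1 x))).
      apply expands_succ, expands_succ, expands_mult; assumption. }
  pose proof (expands_div 8 _ _ _ _ Ef (expands_succ _ _ _ (expands_mult 9 _ _ _ _ En
    (expands_plus 9 _ _ _ _ Ea EwP))) Hf0) as EQ.
  pose proof (expands_mult 8 _ _ _ _ (expands_scal 8 _ _ (4 / 3) (expands_mult 8 _ _ _ _ EQ EQ))
    (expands_succ _ _ _ Ef)) as EEE.
  pose proof (expands_mult 8 _ _ _ _ (expands_mult 8 _ _ _ _ EK EK) EF) as EKAP.
  pose proof (expands_mult 9 _ _ _ _ En EP1) as Epi.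
  pose proof (expands_mult 9 _ _ _ _ (expands_scal 9 _ _ (4 / 3) (expands_mult 9 _ _ _ _ Em En))
     (expands_mult 9 _ _ _ _ EP1 EP1)) as EPP.
  pose proof (expands_div 8 _ _ _ _ Em (expands_succ _ _ _ (expands_mult 9 _ _ _ _
     (expands_scal 9 _ _ (4 / 3) (expands_mult 9 _ _ _ _ EP EP))
     (expands_mult 9 _ _ _ _ Ef En))) Hm0) as EBB.
  pose proof (expands_plus 8 _ _ _ _ (expands_const 8 2) (expands_shift 7 _ _
     (expands_const 7 (- s)))) as EN1.
  (* N' and 2 [dlog_m] both grow like 2 x. The leading terms cancel, and what is left of H is
     bounded. *)
  pose proof (expands_minus 8 _ _ _ _ EN1 (expands_scal 8 _ _ 2 Emu)) as EG.
  apply expands_unshift in EG.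
  2:{ simpl; rewrite nu0, Em0; field. }
  pose proof (expands_plus 7 _ _ _ _ EG (expands_succ _ _ _ EAL)) as EH.
  do 11 eexists; exists (cP 0%nat).
  repeat split.
  - apply (expands_le 8); [lia|]; apply (expands_ext 8 _ _ _ X0) with (2 := EAL).
    intros x Hx; destruct (positive_at x Hx) as [_ [H1 [H2 _]]].
    unfold AL, dlog_f; fold N; field; lra.
  - simpl; rewrite nu0, Ef0, Ef2; field.
  - apply (expands_le 7); [lia|]; apply (expands_ext 7 _ _ _ X0) with (2 := EH).
    intros x Hx; destruct (positive_at x Hx) as [_ [H1 [H2 [H3 _]]]].
    unfold H, dlog_squash, dlog_f, dlog_m, horizon_poly1, s; fold N; field; lra.
  - apply (expands_le 8); [lia|]; apply (expands_ext 8 _ _ _ X0) with (2 := EZ).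
    intros x Hx; destruct (positive_at x Hx) as [_ [H1 [H2 [H3 H4]]]].
    unfold Z, squash_term; fold N; field; lra.
  - simpl; rewrite nu0, Ef0, Em0; field.
  - apply (expands_le 8); [lia|]; apply (expands_ext 8 _ _ _ X0) with (2 := EK).
    intros x Hx; destruct (positive_at x Hx) as [_ [H1 [H2 [H3 _]]]].
    unfold K, twist; fold N; field; lra.
  - simpl; rewrite nu0, Ef0, Em0, Ew0; field.
  - apply (expands_le 8); [lia|]; apply (expands_ext 8 _ _ _ X0) with (2 := EQ).
    intros x Hx; destruct (positive_at x Hx) as [_ [H1 [H2 _]]].
    unfold QQ, flux; fold N; field; lra.
  - simpl; rewrite nu0, Ef0, Ea0; field.
  - apply (expands_le 8); [lia|]; apply (expands_ext 8 _ _ _ X0) with (2 := EEE).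
    intros x Hx; destruct (positive_at x Hx) as [_ [H1 [H2 _]]].
    unfold EE, electric_term, flux; fold N; field; lra.
  - simpl; rewrite nu0, Ef0, Ea0; field.
  - apply (expands_le 8); [lia|]; apply (expands_ext 8 _ _ _ X0) with (2 := EKAP).
    intros x Hx; destruct (positive_at x Hx) as [_ [H1 [H2 [H3 H4]]]].
    unfold KAP, rotation_term, twist; fold N; field; lra.
  - simpl; rewrite nu0, Ef0, Em0, Ew0; field.
  - apply (expands_le 8); [lia|]; apply (expands_ext 8 _ _ _ X0) with (2 := EBB).
    intros x Hx; destruct (positive_at x Hx) as [_ [H1 [H2 [H3 H4]]]].
    unfold BB, angular_term; fold N; field; lra.
  - simpl; rewrite nu0, Ef0, Em0; field.
  - apply (expands_le 9); [lia|]; apply (expands_ext 9 _ _ _ X0) with (2 := EPP).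
    intros x Hx; destruct (positive_at x Hx) as [_ [H1 [H2 [H3 H4]]]].
    unfold PP, radial_term; fold N; field; lra.
  - simpl; rewrite nu0, Em0; field.
  - apply (expands_le 9); [lia|]; apply (expands_ext 9 _ _ _ X0) with (2 := Epi).
    intros x Hx; destruct (positive_at x Hx) as [_ [H1 _]]; field; lra.
  - simpl; rewrite nu0; field.
  - apply (expands_le 8); [lia|]; apply (expands_ext 8 _ _ _ X0) with (2 := EF).
    intros x Hx; destruct (positive_at x Hx) as [_ [H1 [H2 [H3 H4]]]]; field; lra.
  - simpl; rewrite nu0, Ef0, Em0; field.
  - simpl; rewrite nu0, nu1, Ef0, Em0, Ef2; field.
Qed.

Lemma expands_eq n h g c d X : (forall x, X < x -> h x = g x) ->
  expands n h c -> expands n g d -> forall i, (i < n)%nat -> c i = d i.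
Proof.
  intros E Hc Hd i Hi; apply (expands_unique n g c d i); [|exact Hd|exact Hi].
  exact (expands_ext n h g c X E Hc).
Qed.

Ltac log_derive Hx :=
  pose proof (Rgt_not_eq _ _ (bh_f_pos b _ _ _ _ _ bh _ Hx));
  pose proof (Rgt_not_eq _ _ (bh_m_pos b _ _ _ _ _ bh _ Hx));
  auto_derive;
  [ repeat split;
    try first [ exact (ex_intro _ _ (bh_df b _ _ _ _ _ bh _ Hx))
      | exact (ex_intro _ _ (bh_df1 b _ _ _ _ _ bh _ Hx))
      | exact (ex_intro _ _ (bh_dm b _ _ _ _ _ bh _ Hx))
      | exact (ex_intro _ _ (bh_dm1 b _ _ _ _ _ bh _ Hx))
      | exact (ex_intro _ _ (bh_dw1 b _ _ _ _ _ bh _ Hx))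
      | exact (ex_intro _ _ (bh_dN rp2 rm2 _)) | exact (ex_intro _ _ (bh_dN1 rp2 rm2 _)) ];
    repeat apply Rmult_integral_contrapositive_currified; try assumption; lra
  | change (Derive (fun z => f z)) with (Derive f);
    change (Derive (fun z => m z)) with (Derive m);
    change (Derive (fun z => f1 z)) with (Derive f1);
    change (Derive (fun z => m1 z)) with (Derive m1);
    change (Derive (fun z => w1 z)) with (Derive w1);
    change (Derive (fun z => horizon_poly rp2 rm2 z)) with (Derive (horizon_poly rp2 rm2));
    change (Derive (fun z => horizon_poly1 rp2 rm2 z)) with (Derive (horizon_poly1 rp2 rm2));
    rewrite ?(is_derive_unique _ _ _ (bh_dN rp2 rm2 _)),
      ?(is_derive_unique _ _ _ (bh_dN1 rp2 rm2 _));
    fold f1 m1; fold f2 m2 w2; field; repeat split; assumption ].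

Lemma is_derive_dlog_f x : rp2 < x -> is_derive AL x (dlog_f1 rp2 rm2 f f1 f2 x).
Proof. intros Hx; unfold AL, dlog_f, dlog_f1; log_derive Hx. Qed.

Lemma is_derive_dlog_m x : rp2 < x -> is_derive (dlog_m rp2 rm2 m m1) x (dlog_m1 rp2 rm2 m m1 m2 x).
Proof. intros Hx; unfold dlog_m, dlog_m1; log_derive Hx. Qed.

Lemma is_derive_twist x : rp2 < x -> is_derive K x (twist1 rp2 rm2 f f1 m m1 w1 w2 x).
Proof. intros Hx; unfold K, twist, twist1; log_derive Hx. Qed.

Lemma is_derive_dlog_squash x : rp2 < x ->
  is_derive H x (2 + dlog_f1 rp2 rm2 f f1 f2 x - 2 * dlog_m1 rp2 rm2 m m1 m2 x).
Proof.
  intros Hx.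
  apply (is_derive_minus (V := R_NormedModule)
    (fun x => horizon_poly1 rp2 rm2 x + AL x) (fun x => 2 * dlog_m rp2 rm2 m m1 x)).
  - apply (is_derive_plus (V := R_NormedModule)); [apply bh_dN1 | apply is_derive_dlog_f, Hx].
  - apply (is_derive_scal (dlog_m rp2 rm2 m m1)), is_derive_dlog_m, Hx.
Qed.

Lemma is_derive_squash x : rp2 < x -> is_derive Z x (Z x * H x / N x).
Proof.
  intros Hx; pose proof (bh_N_pos b _ _ _ _ _ bh _ Hx).
  apply (is_derive_ext_loc (fun y => horizon_poly rp2 rm2 y * f y / m y ^ 2)).
  - apply filter_imp with (fun y => rp2 < y); [|apply (open_gt rp2); exact Hx].
    intros y Hy; pose proof (bh_N_pos b _ _ _ _ _ bh _ Hy).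
    pose proof (bh_m_pos b _ _ _ _ _ bh _ Hy).
    unfold Z, squash_term; fold N.
    match goal with |- @eq _ ?u ?v => change (@eq R u v) end.
    field; split; apply Rgt_not_eq; assumption.
  - assert (HN : horizon_poly rp2 rm2 x <> 0) by (apply Rgt_not_eq; assumption).
    unfold Z, H, squash_term, dlog_squash, dlog_f, dlog_m; fold N; unfold N; log_derive Hx.
Qed.

Lemma expands_over_N n h c : expands n h c ->
  exists d, expands (S (S n)) (fun x => h x / N x) (shift_coef (shift_coef d)) /\
    d 0%nat = c 0%nat /\ d 1%nat = c 1%nat + s * c 0%nat /\
    d 2%nat = c 2%nat + s * c 1%nat + (s ^ 2 - rp2 * rm2) * c 0%nat.
Proof.
  intros Hh; exists (quotient_coef c nu_coef); split; [|split; [|split]].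
  - apply (expands_ext _ (fun x => h x / (N x / x ^ 2) / x / x) _ _ X0).
    + intros x Hx; destruct (positive_at x Hx) as [_ [H1 [_ [_ H2]]]]; field; lra.
    + apply (expands_shift (S n) (fun x => h x / (N x / x ^ 2) / x)).
      apply (expands_shift n (fun x => h x / (N x / x ^ 2))).
      apply expands_div; [apply expands_nu | exact Hh |].
      unfold nu_coef; simpl; lra.
  - unfold nu_coef; simpl; field.
  - unfold nu_coef; simpl; field.
  - unfold nu_coef; simpl; field.
Qed.

Lemma no_multiple_WAND : J <> 0 -> Q <> 0 ->
  ~ admits_multiple_WAND (metric b) (exterior rp2).
Proof.
  intros HJ HQ HW.
  destruct bh_expansions as [ca [cH [cz [ck [cq [ce [ckap [cb [cp [cpi [cF [p HD]]]]]]]]]]]].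
  destruct HD as [[EA A0] [EH [[EZ Z0] [[EK K0] [[EQ Q0] [[EE' E0] [[EKAP KAP0] [[EB B0]
    [[EP P0] [[Epi pi0] [EF [F0 F1]]]]]]]]]]]].
  assert (RE : forall x, X0 < x -> reduced_equations rp2 rm2 f f1 f2 m m1 m2 w w1 w2 a1 P P1 x).
  { intros x Hx; apply (bh_reduced_equations b rp2 rm2 M J Q bh), (positive_at x Hx). }
  assert (DX : forall x, X0 < x -> rp2 < x) by (intros x Hx; apply (positive_at x Hx)).
  assert (Hpos : forall x, X0 < x -> x <> 0).
  { intros x Hx; destruct (positive_at x Hx) as [_ [H1 _]]; lra. }
  (* x times the sources left in N (H' - 2 (Z - 1)). The p^2 contributions of [BB] and [PP] cancel
     at leading order, leaving - 4 J^2. *)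
  set (rem := fun x => 3 * (x * BB x) - 3 * (x * PP x) - x * KAP x).
  assert (ER : expands 3 rem (fun i => 3 * cb i - 3 * cp i - ckap i)).
  { apply expands_minus; [apply expands_minus|]; try apply expands_scal; assumption. }
  (* By [expands_derive], the first-order equations for H, Z, AL and K relate the
     coefficients of their expansions. *)
  destruct (expands_over_N 3 _ _ ER) as [cR [ER' [R0 _]]].
  assert (DH : forall x, X0 < x ->
    is_derive H x (2 * (Z x - 1) + rem x / N x / x)).
  { intros x Hx; apply (is_derive_eq H x) with (1 := is_derive_dlog_squash x (DX x Hx)).
    destruct (RE x Hx) as [R1 [R2 _]]; destruct (positive_at x Hx) as [_ [H1 [_ [_ H2]]]].
    fold N BB PP KAP EE in R1, R2.
    apply (Rmult_eq_reg_l (N x)); [|lra].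
    transitivity (2 * N x + N x * dlog_f1 rp2 rm2 f f1 f2 x
      - 2 * (N x * dlog_m1 rp2 rm2 m m1 m2 x)); [ring|].
    rewrite R1, R2; unfold Z, rem; fold BB PP KAP EE; field; lra. }
  destruct (expands_derive 3 _ _ _ _ _ DH (expands_succ _ _ _ EH)
    (expands_plus 4 _ _ _ _ (expands_scal 4 _ _ 2
       (expands_minus 4 _ _ _ _ EZ (expands_const 4 1)))
       (expands_shift 3 _ _ (expands_le 5 3 _ _ ltac:(lia) ER')))) as [_ GH].
  (* Writing z_i and h_i for the coefficients of Z and H, these say z1 = 0, 2 z2 = - h1 and, after
     the next rewriting, 2 z3 - 4 J^2 = - 2 h2. *)
  pose proof (GH 0%nat ltac:(lia)) as GH0; pose proof (GH 1%nat ltac:(lia)) as GH1;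
    pose proof (GH 2%nat ltac:(lia)) as GH2.
  simpl in GH0, GH1, GH2; rewrite R0, B0, P0, KAP0 in GH2.
  clear GH ER' R0 cR DH.
  destruct (expands_over_N 3 _ _ (expands_mult 3 _ _ _ _ (expands_succ 3 _ _ EZ)
    (expands_succ 3 _ _ EH))) as [cd [Ed [d0 [d1 d2]]]].
  destruct (expands_derive 4 _ _ _ _ _ (fun x Hx => is_derive_squash x (DX x Hx)) EZ Ed)
    as [_ GZ].
  (* From Z' = Z H / N: h0 = - z1, and once z1 = h0 = 0, h1 = - 2 z2 and h2 + s h1 = - 3 z3.
     Eliminating z3 gives 2 h2 - s h1 = 6 J^2. *)
  pose proof (GZ 1%nat ltac:(lia)) as GZ1; pose proof (GZ 2%nat ltac:(lia)) as GZ2;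
    pose proof (GZ 3%nat ltac:(lia)) as GZ3.
  simpl in GZ1, GZ2, GZ3; simpl in d0, d1, d2; rewrite d0, Z0 in GZ1;
    rewrite d1, Z0 in GZ2; rewrite d2, Z0 in GZ3.
  clear GZ Ed d0 d1 d2 cd.
  assert (EL : expands 0 (fun x => x * BB x + (x * PP x + x * KAP x)) (fun _ => 0)).
  { exact (expands_bounded 3 _ _ (expands_plus 3 _ _ _ _ EB
      (expands_plus 3 _ _ _ _ EP EKAP))). }
  destruct (expands_over_N 1 _ _ (expands_plus 1 _ _ _ _
    (expands_scal 1 _ _ 2 (expands_le 3 1 _ _ ltac:(lia) EE')) (expands_shift 0 _ _ EL)))
    as [cd [Ed [d0 _]]].
  assert (DA : forall x, X0 < x -> is_derive AL x
    ((2 * EE x + (x * BB x + (x * PP x + x * KAP x)) / x) / N x)).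
  { intros x Hx; apply (is_derive_eq AL x) with (1 := is_derive_dlog_f x (DX x Hx)).
    destruct (RE x Hx) as [R1 _]; destruct (positive_at x Hx) as [_ [H1 [_ [_ H2]]]].
    fold N BB PP KAP EE in R1; apply (Rmult_eq_reg_l (N x)); [|lra].
    rewrite R1; field; lra. }
  destruct (expands_derive 2 _ _ _ _ _ DA (expands_succ _ _ _ EA) Ed) as [_ GA].
  (* The coefficient of 1 / x of AL is - 8/3 Q^2. *)
  pose proof (GA 1%nat ltac:(lia)) as GA1; simpl in GA1, d0; rewrite d0, E0 in GA1.
  clear GA Ed d0 cd DA.
  destruct (expands_over_N 1 _ _ (expands_scal 1 _ _ 4 (expands_mult 1 _ _ _ _
    (expands_le 3 1 _ _ ltac:(lia) EQ) (expands_le 3 1 _ _ ltac:(lia) Epi)))) as [cd [Ed [d0 _]]].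
  assert (DK : forall x, X0 < x -> is_derive K x (4 * (QQ x * (N x * P1 x)) / N x)).
  { intros x Hx; apply (is_derive_eq K x) with (1 := is_derive_twist x (DX x Hx)).
    destruct (RE x Hx) as [_ [_ [R3 _]]]; destruct (positive_at x Hx) as [_ [H1 [_ [_ H2]]]].
    fold QQ in R3; transitivity (4 * QQ x * P1 x); [exact R3|].
    apply (Rmult_eq_reg_l (N x)); [field|]; lra. }
  destruct (expands_derive 2 _ _ _ _ _ DK (expands_succ _ _ _ EK) Ed) as [_ GK].
  (* The coefficient of 1 / x of the twist is - 4 Q p. *)
  pose proof (GK 1%nat ltac:(lia)) as GK1; simpl in GK1, d0; rewrite d0, Q0, pi0 in GK1.
  clear GK Ed d0 cd DK.
  assert (z1 : cz 1%nat = 0) by lra.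
  assert (h0 : cH 0%nat = 0) by lra.
  rewrite h0 in *.
  assert (EXH : expands 3 (fun x => x * H x) (fun i => cH (S i))).
  { apply expands_unshift; assumption. }
  rewrite z1 in *.
  (* Completing the square, N = rho^2 - delta2 and N' = 2 rho; the quadratic growth then cancels
     explicitly in the constraint and in the type II equations. *)
  set (rho := fun x => x - s / 2).
  set (delta2 := s ^ 2 / 4 - rp2 * rm2).
  assert (EZ2 : expands 2 (fun x => x * (x * (Z x - 1))) (fun i => cz (S (S i)))).
  { apply (expands_coef_ext 2 _ (fun i => cz (S (S i)) - const_coef 1 (S (S i))));
      [intros i _; simpl; ring|].
    apply (expands_unshift 2 _ (fun i => cz (S i) - const_coef 1 (S i)));
      [|simpl; rewrite z1; ring].
    apply (expands_unshift 3 _ (fun i => cz i - const_coef 1 i));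
      [|simpl; rewrite Z0; ring].
    apply expands_minus; [exact EZ | apply expands_const]. }
  assert (Hrho : forall x, N x = rho x ^ 2 - delta2).
  { intros x; unfold N, horizon_poly, rho, delta2, s; field. }
  assert (Hd : forall x, dlog_base rp2 rm2 f f1 m m1 x = rho x - (AL x + H x) / 2).
  { intros x; unfold AL, H, dlog_squash, dlog_base, horizon_poly1, rho, s; field. }
  assert (Hmu : forall x, dlog_m rp2 rm2 m m1 x = rho x + (AL x - H x) / 2).
  { intros x; unfold AL, H, dlog_squash, horizon_poly1, rho, s; field. }
  assert (RD : forall x, X0 < x -> N x * (Z x - 1)
    = rho x * H x + / 4 * H x ^ 2 + 3 / 4 * AL x ^ 2 - 3 * delta2
      - 3 * BB x - KAP x - 3 * EE x + 3 * PP x).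
  { intros x Hx; destruct (RE x Hx) as [_ [_ [_ R4]]].
    destruct (positive_at x Hx) as [_ [_ [_ [_ H2]]]].
    rewrite Hd, Hmu in R4; fold H AL N BB KAP EE PP in R4.
    replace (N x * (Z x - 1)) with (squash_term rp2 rm2 f m x - N x)
      by (unfold Z; field; lra).
    rewrite Hrho in R4 |- *; lra. }
  assert (EHH : expands 2 (fun x => H x * H x) (cauchy_product cH cH)).
  { apply (expands_le 4 2); [lia|]; apply expands_mult; assumption. }
  assert (EAA : expands 2 (fun x => AL x * AL x) (cauchy_product ca ca)).
  { apply (expands_le 3 2); [lia|]; apply expands_mult; assumption. }
  assert (EAH : expands 2 (fun x => AL x * H x) (cauchy_product ca cH)).
  { apply (expands_le 3 2); [lia|]; apply expands_mult; [exact EA | apply expands_succ, EH]. }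
  assert (EH2 := expands_le 4 2 _ _ ltac:(lia) EH).
  assert (EXH2 := expands_le 3 2 _ _ ltac:(lia) EXH).
  assert (EE2 := expands_le 3 2 _ _ ltac:(lia) EE').
  assert (ER2 := expands_shift 2 _ _ (expands_succ 2 _ _ ER)).
  (* The constraint RD to order 1 / x. Its second coefficient, with the relations above, reduces to
     2 e1 = M a1, where e1 and a1 are the second coefficients of [EE] and [AL]. *)
  assert (GD := expands_eq 2 (fun x => N x / x ^ 2 * (x * (x * (Z x - 1))))
    (fun x => x * H x + (- (s / 2) * H x + (/ 4 * (H x * H x) + (3 / 4 * (AL x * AL x)
      + (-3 * delta2 + (-3 * EE x + (rem x / x - 6 * ((x * BB x - x * PP x) / x))))))))
    _ _ X0
    ltac:(intros x Hx; pose proof (RD x Hx) as E; pose proof (Hpos x Hx);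
      transitivity (N x * (Z x - 1)); [field; assumption|]; rewrite E;
      unfold rem, rho; field; assumption)
    (expands_mult 2 _ _ _ _ (expands_nu 2) EZ2)
    (expands_plus 2 _ _ _ _ EXH2 (expands_plus 2 _ _ _ _ (expands_scal 2 _ _ _ EH2)
      (expands_plus 2 _ _ _ _ (expands_scal 2 _ _ _ EHH)
      (expands_plus 2 _ _ _ _ (expands_scal 2 _ _ _ EAA)
      (expands_plus 2 _ _ _ _ (expands_const 2 (-3 * delta2))
      (expands_plus 2 _ _ _ _ (expands_scal 2 _ _ _ EE2)
      (expands_minus 2 _ _ _ _ (expands_le 3 2 _ _ ltac:(lia) ER2)
        (expands_scal 2 _ _ 6 (expands_le 3 2 _ _ ltac:(lia) (expands_shift 2 _ _ (expands_succ 2 _ _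
           (expands_minus 3 _ _ _ _ EB EP))))))))))))).
  pose proof (GD 1%nat ltac:(lia)) as GD1.
  unfold nu_coef in GD1; simpl in GD1.
  rewrite h0, B0, P0, KAP0, A0 in GD1; clear GD.
  (* This is Y^2 < X^2 near infinity: x [KAP] tends to 4 J^2 > 0, while H = O(1 / x). *)
  assert (HK : exists X, forall x, X < x -> H x ^ 2 < KAP x).
  { destruct (expands_tends 1 (fun x => x * KAP x - x * H x * (x * H x) / x) _
      (expands_minus 2 _ _ _ _ (expands_le 3 2 _ _ ltac:(lia) EKAP)
        (expands_shift 1 _ _ (expands_le 3 1 _ _ ltac:(lia) (expands_mult 3 _ _ _ _ EXH EXH))))
      (4 * J ^ 2)) as [X HX].
    { pose proof (pow2_gt_0 J HJ); lra. }
    simpl in HX; rewrite KAP0 in HX.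
    exists (Rmax X 0); intros x Hx; pose proof (Rmax_l X 0); pose proof (Rmax_r X 0).
    specialize (HX x ltac:(lra)); apply Rabs_def2 in HX.
    assert (0 < x * KAP x - x * H x * (x * H x) / x) by lra.
    replace (x * KAP x - x * H x * (x * H x) / x) with (x * (KAP x - H x ^ 2)) in H2
      by (field; lra).
    assert (0 < KAP x - H x ^ 2); [|lra].
    apply (Rmult_lt_reg_l x); lra. }
  destruct HK as [X1 HX1].
  set (X2 := Rmax X0 X1).
  assert (HX2 : forall x, X2 < x -> X0 < x /\ X1 < x).
  { intros x Hx; unfold X2 in Hx; pose proof (Rmax_l X0 X1); pose proof (Rmax_r X0 X1); lra. }
  assert (T : forall x, X2 < x -> type_II_equations rp2 rm2 f f1 m m1 w w1 a1 P P1 x).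
  { intros x Hx; destruct (HX2 x Hx) as [Y0 Y1].
    apply (bh_type_II_equations b rp2 rm2 M J Q bh x (DX x Y0) HW).
    apply HX1, Y1. }
  (* The terms multiplied by K in the first type II equation, after the constraint has replaced the
     squashing term; the squares of rho and of H have cancelled. *)
  set (sig := fun x => 2 * (x * H x) + (- s * H x + (AL x * AL x + (- (1) * (AL x * H x)
    + (- (4) * delta2 + (- (4) * EE x
    + -2 * ((x * BB x - x * PP x + x * KAP x) / x))))))).
  assert (ES : exists c, expands 2 sig c /\
    c 0%nat = 2 * cH 1%nat + M ^ 2 - 4 * delta2 - 16 / 3 * Q ^ 2 /\
    c 1%nat = 2 * cH 2%nat - s * cH 1%nat + 2 * M * ca 1%nat - M * cH 1%nat
      - 4 * ce 1%nat - 8 * J ^ 2).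
  { eexists; split; [|split].
    - apply expands_plus; [apply expands_scal, EXH2|].
      apply expands_plus; [apply expands_scal, EH2|].
      apply expands_plus; [exact EAA|].
      apply expands_plus; [apply expands_scal, EAH|].
      apply expands_plus; [apply expands_const|].
      apply expands_plus; [apply expands_scal, EE2|].
      apply expands_scal, (expands_shift 1).
      apply (expands_le 3 1); [lia|].
      exact (expands_plus 3 _ _ _ _ (expands_minus 3 _ _ _ _ EB EP) EKAP).
    - simpl; rewrite h0, A0, E0; field.
    - simpl; rewrite h0, A0, B0, P0, KAP0; field. }
  destruct ES as [cS [ES [S0 S1]]].
  assert (T1 : forall x, X2 < x ->
    K x * sig x = 8 / 3 * (QQ x * (N x * P1 x) * H x)).
  { intros x Hx; destruct (HX2 x Hx) as [Y0 _]; destruct (T x Hx) as [U _].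
    pose proof (RD x Y0) as E; pose proof (Hpos x Y0).
    rewrite Hd, Hmu in U.
    replace (squash_term rp2 rm2 f m x) with (N x * (Z x - 1) + N x) in U.
    2:{ destruct (positive_at x Y0) as [_ [_ [_ [_ H2]]]]; unfold Z; field; lra. }
    fold K H AL N BB KAP EE PP QQ in U.
    rewrite E, Hrho in U.
    assert (V : sig x = 2 * rho x * H x + AL x ^ 2 - AL x * H x - 4 * delta2 - 4 * EE x
      - 2 * BB x + 2 * PP x - 2 * KAP x).
    { unfold sig, rho; field; assumption. }
    rewrite V; rewrite <- Hrho in U.
    apply Rminus_diag_uniq; rewrite <- U, (Hrho x); field. }
  assert (G1 := expands_eq 2 _ _ _ _ X2 T1
    (expands_mult 2 _ _ _ _ (expands_succ _ _ _ EK) ES)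
    (expands_scal 2 _ _ (8 / 3) (expands_mult 2 _ _ _ _ (expands_mult 2 _ _ _ _
      (expands_succ _ _ _ EQ) (expands_succ _ _ _ Epi)) EH2))).
  pose proof (G1 0%nat ltac:(lia)) as G10; pose proof (G1 1%nat ltac:(lia)) as G11.
  simpl in G10, G11; rewrite h0, K0, Q0, pi0 in G10, G11; clear G1.
  (* The second type II equation, grouped into bounded factors: on the left f m / N ~ 1 / x
     compensates the growth of [dlog_base] ~ x, on the right H ~ h1 / x that of the bracket. *)
  assert (T2 : forall x, X2 < x ->
    x * (f x * m x / N x) * (K x * (K x * (1 + (- s / 2 + - / 2 * (AL x + H x)) / x)
      - 8 / 3 * (QQ x * (N x * P1 x)) / x))
    = x * H x * (-2 * AL x + (s * AL x + (AL x * AL x + EE x)) / x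
        + (x * BB x + x * PP x - x * KAP x) / x / x)).
  { intros x Hx; destruct (HX2 x Hx) as [Y0 _]; destruct (T x Hx) as [_ U].
    pose proof (Hpos x Y0); destruct (positive_at x Y0) as [_ [_ [_ [_ HN]]]].
    rewrite Hd in U; fold K H AL N BB KAP EE PP QQ in U.
    replace (- AL x * (H x + 2 * (rho x - (AL x + H x) / 2)) + BB x + PP x + EE x - KAP x)
      with (x * (-2 * AL x + (s * AL x + (AL x * AL x + EE x)) / x
        + (x * BB x + x * PP x - x * KAP x) / x / x)) in U
      by (unfold rho; field; assumption).
    transitivity (H x * (x * (-2 * AL x + (s * AL x + (AL x * AL x + EE x)) / x
        + (x * BB x + x * PP x - x * KAP x) / x / x))); [|ring].
    rewrite <- U; unfold rho; field; split; try assumption; lra. }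
  assert (EA2 := expands_succ 2 _ _ EA).
  assert (EK2 := expands_succ 2 _ _ EK).
  assert (EL2 : exists c, expands 2 (fun x =>
      x * (f x * m x / N x) * (K x * (K x * (1 + (- s / 2 + - / 2 * (AL x + H x)) / x)
      - 8 / 3 * (QQ x * (N x * P1 x)) / x))) c /\
      c 0%nat = 4 * J ^ 2 /\
      c 1%nat = 4 * J ^ 2 * (cF 1%nat - s / 2 - M / 2) - 4 * J * ck 1%nat
        + 16 / 3 * J * Q * p).
  { eexists; split; [|split].
    - apply (expands_mult 2); [exact (expands_succ 2 _ _ EF)|].
      apply (expands_mult 2); [exact EK2|].
      apply (expands_minus 2).
      + apply (expands_mult 2); [exact EK2|].
        apply (expands_plus 2); [apply expands_const|].
        apply (expands_shift 1), (expands_succ 1).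
        apply (expands_plus 2); [apply expands_const|].
        apply expands_scal, (expands_plus 2); [exact EA2 | exact EH2].
      + apply (expands_shift 1), (expands_succ 1), expands_scal, (expands_mult 2);
          [exact (expands_succ 2 _ _ EQ) | exact (expands_succ 2 _ _ Epi)].
    - simpl; rewrite F0, K0; ring.
    - simpl; rewrite h0, F0, K0, A0, Q0, pi0; field. }
  destruct EL2 as [cL [EL2 [L0 L1]]].
  assert (ER3 : exists c, expands 2 (fun x =>
      x * H x * (-2 * AL x + (s * AL x + (AL x * AL x + EE x)) / x
        + (x * BB x + x * PP x - x * KAP x) / x / x)) c /\
      c 0%nat = - 2 * M * cH 1%nat /\
      c 1%nat = - 2 * M * cH 2%nat
        + cH 1%nat * (- 2 * ca 1%nat + s * M + M ^ 2 + 4 / 3 * Q ^ 2)).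
  { eexists; split; [|split].
    - apply (expands_mult 2); [exact EXH2|].
      apply (expands_plus 2); [apply (expands_plus 2)|].
      + apply expands_scal; exact EA2.
      + apply (expands_shift 1), (expands_succ 1).
        apply (expands_plus 2); [apply expands_scal, EA2|].
        apply (expands_plus 2); [exact EAA | exact EE2].
      + apply (expands_shift 1 (fun x => (x * BB x + x * PP x - x * KAP x) / x)).
        apply (expands_shift 0), (expands_le 3 0); [lia|].
        exact (expands_minus 3 _ _ _ _ (expands_plus 3 _ _ _ _ EB EP) EKAP).
    - simpl; rewrite A0; ring.
    - simpl; rewrite A0, E0; field. }
  destruct ER3 as [cr [ER3 [r0 r1]]].
  assert (G2 := expands_eq 2 _ _ _ _ X2 T2 EL2 ER3).
  pose proof (G2 0%nat ltac:(lia)) as G20; pose proof (G2 1%nat ltac:(lia)) as G21.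
  rewrite L0, r0 in G20; rewrite L1, r1 in G21; clear G2.
  clear - HJ HQ GH1 GH2 GZ1 GZ2 GZ3 GA1 GK1 GD1 G10 G11 G20 G21 S0 S1 F1 z1.
  set (h1 := cH 1%nat) in *; set (h2 := cH 2%nat) in *; set (a1' := ca 1%nat) in *.
  clearbody s h1 h2 a1' delta2.
  assert (HJ2 : 0 < J ^ 2) by (apply pow2_gt_0; exact HJ).
  assert (HQ2 : 0 < Q ^ 2) by (apply pow2_gt_0; exact HQ).
  (* G20 says 4 J^2 = - 2 M h1. *)
  assert (Hh1 : h1 <> 0) by (intros E; rewrite E in G20; lra).
  assert (Hh2 : 2 * h2 - s * h1 = 6 * J ^ 2) by lra.
  assert (Hz2 : cz 2%nat = - h1 / 2) by lra; rewrite Hz2 in GD1.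
  assert (He1 : 2 * ce 1%nat = M * a1') by lra.
  assert (HS0 : cS 0%nat = 0).
  { apply (Rmult_eq_reg_l (-2 * J)); lra. }
  (* By Hh2 and He1 this coefficient is - 2 J^2 - M h1, which G20 makes zero. *)
  assert (HS1 : cS 1%nat = 0) by lra.
  (* With both coefficients of [sig] zero, G11 reads 0 = 8/3 Q p h1. *)
  assert (Hp : p = 0).
  { rewrite HS0, HS1 in G11; apply (Rmult_eq_reg_l (Q * h1)); [lra|].
    apply Rmult_integral_contrapositive; auto. }
  rewrite Hp in GK1, G21.
  assert (Hk : ck 1%nat = 0) by lra.
  assert (Ha : a1' = - (8 / 3) * Q ^ 2) by lra.
  assert (HF : cF 1%nat = - (3 / 2) * M + s / 2) by lra.
  rewrite Hk, Ha, HF in G21.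
  replace (-2 * M * h2) with (-2 * M * (3 * J ^ 2 + s * h1 / 2)) in G21
    by (replace h2 with (3 * J ^ 2 + s * h1 / 2) by lra; ring).
  assert (G : M * (4 * J ^ 2) = M * (-2 * M * h1)) by (rewrite G20; ring).
  (* Both sides of G21 contain - 8 M J^2, on the right from - 6 M J^2 and M^2 h1 = - 2 M J^2. What
     remains is 20/3 Q^2 h1 = 0. *)
  assert (F : Q ^ 2 * h1 = 0) by lra.
  apply Rmult_integral in F; destruct F as [F|F]; [lra|contradiction].
Qed.

End Asymptotics.

Theorem mainTheorem7 :
  forall (b : profile) (rp2 rm2 M J Q : R),
    charged_rotating_black_hole b rp2 rm2 M J Q ->
    J <> 0 -> Q <> 0 ->
    ~ admits_multiple_WAND (metric b) (exterior rp2).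
Proof. exact no_multiple_WAND. Qed.
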